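(* Let $\Omega\subset\mathbf{R}^2$ be a bounded region whose boundary $\partial\Omega$ is a single real analytic closed curve, and let $K$ be its double layer potential on $L^2(\partial\Omega)$. There exists a constant $C>0$, depending only on $\Omega$, such that for every eigenvalue $\lambda\neq 0$ of $K$ and every real analytic eigenfunction $e_\lambda\in C^\omega(\partial\Omega)$, $Ke_\lambda=\lambda e_\lambda$, $e_\lambda\not\equiv0$, the zero set $N(e_\lambda)=\{x\in\partial\Omega : e_\lambda(x)=0\}$ satisfies $$\sharp N(e_\lambda)\le C\,\bigl|\log|\lambda|\bigr|.$$
   Context: For a bounded region $\Omega\subset\mathbf{R}^2$ with (at least) $C^2$ boundary, the double layer potential is the compact operator $K:L^2(\partial\Omega)\to L^2(\partial\Omega)$, $(K\psi)(x)=\int_{\partial\Omega}\psi(y)\,\nu_yE(x,y)\,ds_y$, where $E(x,y)=\frac1\pi\log\frac{1}{|x-y|}$, $ds_y$ is the line element, and $\nu_y$ denotes the outer normal derivative on $\partial\Omega$ in the variable $y$. $\sharp$ denotes the number of elements of a set, and $C^\omega(\partial\Omega)$ the real analytic functions on $\partial\Omega$. *)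

(* Defs.v *)
From HB Require Import structures.
From mathcomp Require Import all_boot all_order all_algebra.
From mathcomp Require Import complex.
From mathcomp Require Import all_classical all_reals all_analysis.
Set Implicit Arguments.
Unset Strict Implicit.
Unset Printing Implicit Defensive.
Import Order.TTheory GRing.Theory Num.Theory.
Import numFieldNormedType.Exports.
Local Open Scope classical_set_scope.
Local Open Scope ring_scope.

(* The plane is R * R.  Its library norm is the max norm, which gives the right
   topology; the Euclidean length is needed for log |x - y|, the line element and the
   unit normal. *)
Definition eucl {R : realType} (v : R * R) : R :=
  Num.sqrt (v.1 ^+ 2 + v.2 ^+ 2).

Definition frontier {T : topologicalType} (A : set T) : set T :=
  closure A `\` interior A.

Definition bounded_region {R : realType} (Omega : set (R * R)) : Prop :=
  [/\ Omega !=set0, open Omega, connected Omega & bounded_set Omega].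

Definition real_analytic {R : realType} (f : R -> R) : Prop :=
  forall t, exists2 r : R, 0 < r &
    exists a : R^nat, forall h, `|h| < r -> pseries a h @ \oo --> f (t + h).

Section Curve.
Context {R : realType}.
Implicit Types (Omega : set (R * R)) (gamma : R -> R * R) (t : R).

Definition velocity gamma t : R * R :=
  (derive1 (fst \o gamma) t, derive1 (snd \o gamma) t).

Definition speed gamma t : R := eucl (velocity gamma t).

(* The velocity rotated by -pi/2 and normalised: the outer normal at gamma t
   when Omega lies to the left of gamma. *)
Definition unit_normal gamma t : R * R :=
  ((velocity gamma t).2 / speed gamma t, - (velocity gamma t).1 / speed gamma t).

(* gamma is a regular real analytic parametrization of the boundary of Omega
   by R/Z.  The last clause fixes its orientation, making unit_normal gamma
   the outer unit normal; it excludes the reversed parametrization, for which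
   gamma t + s *: unit_normal gamma t enters Omega. *)
Record analytic_boundary_param Omega gamma : Prop := {
  abp_analytic1 : real_analytic (fst \o gamma) ;
  abp_analytic2 : real_analytic (snd \o gamma) ;
  abp_regular : forall t, velocity gamma t != 0 ;
  abp_periodic : forall t, gamma (t + 1) = gamma t ;
  abp_simple : set_inj `[0, 1[ gamma ;
  abp_image : range gamma = frontier Omega ;
  abp_outer : forall t,
    \forall s \near 0^'+, ~ Omega (gamma t + s *: unit_normal gamma t)
}.

(* The boundary of Omega is a single real analytic closed curve. *)
Definition analytic_boundary Omega : Prop :=
  exists gamma, analytic_boundary_param Omega gamma.

End Curve.

Section DoubleLayerPotential.
Context {R : realType}.
Implicit Types (gamma : R -> R * R) (x y : R * R).
Implicit Types (psi : R * R -> R[i]) (lambda : R[i]).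

Local Notation mu := (@lebesgue_measure R).

Definition log_potential x y : R := pi^-1 * ln (eucl (x - y))^-1.

(* The integral over the boundary against the line element ds_y, where
   y = gamma t and ds_y = speed gamma t dt; the normal derivative acts on the
   second variable of log_potential.  The value at y = x is immaterial. *)
Definition dlp_real gamma (f : R * R -> R) x : R :=
  (\int[mu]_(t in `[0%R, 1%R])
     (f (gamma t) * 'D_(unit_normal gamma t) (log_potential x) (gamma t)
        * speed gamma t))%R.

(* Functions on the boundary are represented by functions on the plane, of
   which only the values on the boundary are used.  They are complex valued;
   the real kernel acts separately on real and imaginary parts. *)
Definition dlp gamma psi x : R[i] :=
  Complex (dlp_real gamma (fun y => complex.Re (psi y)) x)
          (dlp_real gamma (fun y => complex.Im (psi y)) x).

(* P holds ds-almost everywhere on the boundary; as speed gamma does not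
   vanish, ds-null sets are those with Lebesgue-null preimage. *)
Definition ae_boundary gamma (P : R * R -> Prop) : Prop :=
  {ae mu, forall t, 0 <= t <= 1 -> P (gamma t)}.

Definition L2_boundary gamma psi : Prop :=
  [/\ measurable_fun (`[0%R, 1%R]%classic : set R) (fun t => complex.Re (psi (gamma t))),
      measurable_fun (`[0%R, 1%R]%classic : set R) (fun t => complex.Im (psi (gamma t))) &
      mu.-integrable `[0%R, 1%R]
        (fun t => (Normc.normc (psi (gamma t)) ^+ 2 * speed gamma t)%:E)].

(* K psi = lambda psi as elements of L^2 of the boundary. *)
Definition dlp_eigen_eq gamma lambda psi : Prop :=
  ae_boundary gamma (fun x => dlp gamma psi x = lambda * psi x).

Definition dlp_eigenvalue gamma lambda : Prop :=
  exists psi, [/\ L2_boundary gamma psi,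
    ~ ae_boundary gamma (fun x => psi x = 0) & dlp_eigen_eq gamma lambda psi].

(* psi is real analytic on the boundary, read in the analytic chart gamma. *)
Definition analytic_on_boundary gamma psi : Prop :=
  real_analytic (fun t => complex.Re (psi (gamma t))) /\
  real_analytic (fun t => complex.Im (psi (gamma t))).

End DoubleLayerPotential.

Definition boundary_zeros {R : realType} (Omega : set (R * R))
    (psi : R * R -> R[i]) : set (R * R) :=
  [set x | frontier Omega x /\ psi x = 0].

(* Main.v *)
(** Parametrize the boundary by a 1-periodic curve Z = x + i y.  Up to the factor - pi, the
    double layer potential is the operator A with kernel Im (Z'(s) / (Z(s) - Z(t))), which is
    analytic in t with bounds that are uniform in s.  An eigenfunction e = lambda^-1 K e
    therefore has Taylor expansions of a fixed radius, bounded by M / |lambda| times the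
    maximum of |e|, and a quantitative identity theorem bounds the number of its zeros by
    C ln (M' / |lambda|).  This is C'' |ln |lambda|| unless |lambda| is close to 1.

    If C denotes the real part of the Cauchy transform u |-> int (u(s) - u(t)) Z'(s) /
    (Z(s) - Z(t)) ds and w = +- pi is the constant A 1, then C^2 = A^2 - w^2 and
    A C + C A = 0, while int u' C u is a logarithmic energy, positive unless u is constant.
    Hence eigenfunctions with |lambda| = 1 are constant, and by compactness eigenfunctions
    with a zero have |lambda| bounded away from 1.  A change of variables moves every
    parametrization of the boundary to a fixed one. *)

Require Import Defs.
From HB Require Import structures.
From mathcomp Require Import all_boot all_order all_algebra.
From mathcomp Require Import complex finmap.
From mathcomp Require Import all_classical all_reals all_analysis.
From mathcomp Require Import measurable_realfun ring lra.
Import Order.TTheory GRing.Theory Num.Theory.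
Import numFieldNormedType.Exports.
Local Open Scope classical_set_scope.
Local Open Scope ring_scope.
Set Implicit Arguments.
Unset Strict Implicit.
Unset Printing Implicit Defensive.

(** * Power series with geometric bounds *)

(** The bound tends to 0 as |lambda| tends to 1, so near the unit circle it has to exclude zeros
    altogether, which no counting of zeros can do; this is why rigidity and compactness enter. As K
    is not self-adjoint on L^2, lambda is a priori complex, and eigenfunctions are carried as pairs
    of real functions.

    The relations between A and C come from the single complex transform T = C + i (A - w), which
    satisfies T^2 = - 2 i w T: up to a factor it is one of the two projections in Plemelj's
    formulas. This is proved on the curve alone, by exchanging the order in a double integral.
    Likewise analyticity enters only through real Taylor coefficients with explicit bounds, never
    through continuation to a complex strip.

    The constant precedes the parametrization in the theorem, and two parametrizations are at first
    related only by a map obtained by choice. They are compared through local lifts of this map, and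
    its degree is read off from the winding integrals. *)

Section PowerSeries.
Context {R : realType}.
Implicit Types (f g : R -> R) (t h d c M : R) (a b : nat -> R).

Definition psum a (N : nat) h : R := \sum_(i < N) a i * h ^+ i.

(* [a] lists the Taylor coefficients of [f] at [t] and [1 / c] bounds the radius of
   convergence from below; the explicit constants make all later estimates uniform in [t]. *)
Definition pexp f t a M c : Prop :=
  [/\ 0 <= M, 0 < c, forall n, `|a n| <= M * c ^+ n &
      forall h N, `|h| * c <= 2^-1 ->
        `|f (t + h) - psum a N h| <= 2 * M * (`|h| * c) ^+ N].

Lemma psumS a N h : psum a N.+1 h = psum a N h + a N * h ^+ N.
Proof. by rewrite /psum big_ord_recr. Qed.

Lemma psum0 a h : psum a 0 h = 0.
Proof. by rewrite /psum big_ord0. Qed.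

Lemma geo_le2 (x : R) N : 0 <= x -> x <= 2^-1 -> \sum_(i < N) x ^+ i <= 2.
Proof.
move=> x0 x1.
have H : (1 - x) * (\sum_(i < N) x ^+ i) = 1 - x ^+ N.
  rewrite -[in RHS](expr1n R N) subrXX; congr (_ * _);
  by apply: eq_bigr => i _; rewrite expr1n mul1r.
have h0 : 0 <= x ^+ N by apply: exprn_ge0.
have hS : 0 <= \sum_(i < N) x ^+ i by apply: sumr_ge0 => i _; apply: exprn_ge0.
nra.
Qed.

Lemma geo_shift_le2 (x : R) N k : 0 <= x -> x <= 2^-1 ->
  \sum_(i < N) (if (i < k)%N then 0 else x ^+ (i - k)) <= 2.
Proof.
move=> x0 x1; elim: k N => [|k IH] N.
  by rewrite (eq_bigr (fun i : 'I_N => x ^+ i)) ?geo_le2 // => i _; rewrite subn0.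
case: N => [|N]; first by rewrite big_ord0.
rewrite big_ord_recl /= add0r.
rewrite (eq_bigr (fun i : 'I_N => if (i < k)%N then 0 else x ^+ (i - k))) ?IH // => i _; rewrite /bump /= add1n ltnS subSS.
Qed.

Lemma geo_tail_le (x : R) N K : 0 <= x -> x <= 2^-1 ->
  \sum_(K <= i < N) x ^+ i <= 2 * x ^+ K.
Proof.
move=> x0 x1; have [NK|KN] := leqP N K.
  by rewrite big_geq // mulr_ge0 // exprn_ge0.
rewrite -{1}[K]add0n big_addn big_mkord.
under eq_bigr => i _ do rewrite exprD.
by rewrite -mulr_suml ler_wpM2r ?exprn_ge0 // geo_le2.
Qed.

(** Removes a geometric error term from an inequality. Identities between sums of series are proved
    below by comparing partial sums and then letting [N] grow through this lemma. *)
Lemma le_add_pow (x y z C : R) : 0 <= x -> x <= 2^-1 ->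
  (forall N, y <= z + C * x ^+ N) -> y <= z.
Proof.
move=> x0 x1 H; rewrite leNgt; apply/negP => zy.
have C0 : 0 < C by have := H 0%N; rewrite expr0 mulr1; lra.
have yz0 : 0 < y - z by lra.
have [N hN] : exists N : nat, C / (y - z) < N%:R.
  by exists (Num.truncn (C / (y - z))).+1; apply: truncnS_gt.
have := H N; rewrite leNgt => /negP; apply.
rewrite -ltrBrDl.
have xN : x ^+ N <= (2^-1) ^+ N by apply: lerXn2r; rewrite ?nnegrE.
have h2 : (N%:R : R) <= 2 ^+ N by rewrite -natrX ler_nat ltnW // ltn_expl.
have p2 : 0 < (2 : R) ^+ N by apply: exprn_gt0.
have : C < (y - z) * 2 ^+ N.
  rewrite ltr_pdivrMr // in hN; rewrite mulrC.
  by apply: lt_le_trans hN _; rewrite ler_wpM2r // ltW.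
rewrite exprVn in xN => hC.
apply: le_lt_trans (_ : C * (2 ^+ N)^-1 < _); first by rewrite ler_wpM2l // ltW.
by rewrite ltr_pdivrMr.
Qed.

Lemma le_add_pow_from (x y z C : R) N0 : 0 <= x -> x <= 2^-1 ->
  (forall N, (N0 <= N)%N -> y <= z + C * x ^+ N) -> y <= z.
Proof.
move=> x0 x1 H; apply: (@le_add_pow x _ _ (C * x ^+ N0)) => // N.
by rewrite -mulrA -exprD H // leq_addr.
Qed.

Lemma le_add_lin (y C e : R) : 0 < e -> (forall h, 0 < h -> h <= e -> y <= C * h) -> y <= 0.
Proof.
move=> e0 H; rewrite leNgt; apply/negP => y0.
have C0 : 0 < C.
  have := H e e0 (lexx _) => h1; rewrite ltNge; apply/negP => C0.
  by have : C * e <= 0; [rewrite mulr_le0_ge0 // ltW | lra].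
have := H (Num.min e (y / (2 * C))).
rewrite lt_min e0 ge_min lexx /= => /(_ _ isT).
have p : 0 < y / (2 * C) by rewrite divr_gt0 // mulr_gt0.
move=> /(_ p) h1.
have : C * Num.min e (y / (2 * C)) <= C * (y / (2 * C)).
  by apply: ler_wpM2l; [exact: ltW|rewrite ge_min lexx orbT].
have -> : C * (y / (2 * C)) = y / 2 by field; rewrite gt_eqF.
lra.
Qed.

Lemma ps_lim (b : nat -> R) (A x : R) : 0 <= x -> x <= 2^-1 ->
  (forall n, `|b n| <= A * x ^+ n) ->
  exists l, forall N, `|l - \sum_(i < N) b i| <= 2 * A * x ^+ N.
Proof.
move=> x0 x1 hb.
have A0 : 0 <= A by have := hb 0%N; rewrite expr0 mulr1; apply: le_trans.
have cb : cvgn (series b).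
  apply: normed_cvg.
  apply: (@series_le_cvg _ _ (geometric A x)) => //.
  - by move=> n /=.
  - by move=> n /=; rewrite mulr_ge0 // exprn_ge0.
  - by apply: is_cvg_geometric_series; rewrite ger0_norm //; lra.
exists (limn (series b)) => N.
have cv : (fun K => `|series b K - \sum_(i < N) b i|) @ \oo --> `|limn (series b) - \sum_(i < N) b i|.
  by apply: cvg_norm; apply: cvgB => //; apply: cvg_cst.
rewrite -(cvg_lim _ cv) //; apply: limr_le; first by apply/cvg_ex; eexists; exact: cv.
near=> K.
have NK : (N <= K)%N by near: K; exists N.
rewrite /series /= -(big_mkord xpredT b) (@big_cat_nat _ _ _ N 0%N K) //= big_mkord addrAC subrr add0r.
apply: le_trans (ler_norm_sum _ _ _) _.
apply: le_trans (ler_sum _ (fun i _ => hb i)) _.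
rewrite -mulr_sumr [2 * A]mulrC -mulrA ler_wpM2l //.
exact: geo_tail_le.
Unshelve. all: by end_near. Qed.

Lemma pexp_coef0 f t a M c : pexp f t a M c -> a 0%N = f t.
Proof.
case=> M0 c0 _ /(_ 0 1%N); rewrite normr0 mul0r invr_ge0 ler0n => /(_ isT).
rewrite expr1 mulr0 addr0 psumS psum0 add0r expr0 mulr1 normr_le0 subr_eq0.
by move/eqP.
Qed.

Lemma pexp_le f t a M c M' c' : pexp f t a M c -> M <= M' -> c <= c' -> pexp f t a M' c'.
Proof.
move=> [M0 c0 ha hf] MM cc; split=> [|||h N hh].
- exact: le_trans MM.
- exact: lt_le_trans cc.
- move=> n; apply: le_trans (ha n) _; apply: ler_pM; rewrite ?exprn_ge0 ?(ltW c0) //.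
  by apply: lerXn2r => //; rewrite nnegrE; [exact: ltW|exact: le_trans (ltW c0) cc].
have hc : `|h| * c <= `|h| * c' by rewrite ler_wpM2l.
apply: le_trans (hf h N (le_trans hc hh)) _.
apply: ler_pM; rewrite ?exprn_ge0 ?mulr_ge0 ?(ltW c0) //.
  by rewrite ler_wpM2l.
by apply: lerXn2r => //; rewrite nnegrE mulr_ge0 //; [exact: ltW|exact: le_trans (ltW c0) cc].
Qed.

Lemma pexp_bnd f t a M c h : pexp f t a M c -> `|h| * c <= 2^-1 -> `|f (t + h)| <= 2 * M.
Proof. by case=> M0 c0 _ hf /(hf _ 0%N); rewrite psum0 subr0 expr0 mulr1. Qed.

Lemma pexp_eq f g t a M c : pexp f t a M c ->
  (forall h, `|h| * c <= 2^-1 -> f (t + h) = g (t + h)) -> pexp g t a M c.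
Proof. by move=> [M0 c0 ha hf] fg; split=> // h N hh; rewrite -fg // hf. Qed.

Lemma pexp_cst (k : R) t c : 0 < c ->
  pexp (fun=> k) t (fun n => if n is 0 then k else 0) `|k| c.
Proof.
move=> c0; split=> // [n|h N hh].
  by case: n => [|n]; rewrite ?expr0 ?mulr1 // normr0 mulr_ge0 // exprn_ge0 // ltW.
case: N => [|N]; first by rewrite psum0 subr0 expr0 mulr1; have := normr_ge0 k; lra.
rewrite /psum big_ord_recl expr0 mulr1 big1 ?addr0 ?subrr ?normr0; last by move=> i _; rewrite mul0r.
by rewrite mulr_ge0 ?mulr_ge0 ?exprn_ge0 ?mulr_ge0 // ltW.
Qed.

Lemma pexp_scale (k : R) f t a M c : pexp f t a M c ->
  pexp (fun x => k * f x) t (fun n => k * a n) (`|k| * M) c.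
Proof.
move=> [M0 c0 ha hf]; split=> // [|n|h N hh]; first by rewrite mulr_ge0.
  by rewrite normrM -mulrA ler_wpM2l.
have -> : psum (fun n => k * a n) N h = k * psum a N h.
  by rewrite /psum mulr_sumr; apply: eq_bigr => i _; rewrite mulrA.
rewrite -mulrBr normrM.
have -> : 2 * (`|k| * M) * (`|h| * c) ^+ N = `|k| * (2 * M * (`|h| * c) ^+ N) by ring.
by rewrite ler_wpM2l // hf.
Qed.

Lemma pexp_add f g t a b M M' c : pexp f t a M c -> pexp g t b M' c ->
  pexp (fun x => f x + g x) t (fun n => a n + b n) (M + M') c.
Proof.
move=> [M0 c0 ha hf] [M0' _ hb hg]; split=> // [|n|h N hh]; first by rewrite addr_ge0.
  by rewrite mulrDl (le_trans (ler_normD _ _)) // lerD.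
have -> : psum (fun n => a n + b n) N h = psum a N h + psum b N h.
  by rewrite /psum -big_split; apply: eq_bigr => i _; rewrite mulrDl.
rewrite opprD addrACA mulrDr mulrDl (le_trans (ler_normD _ _)) // lerD //; [exact: hf|exact: hg].
Qed.

Definition conv a b n : R := \sum_(i < n.+1) b i * a (n - i)%N.

Lemma sum_conv a b N h :
  \sum_(i < N) b i * h ^+ i * psum a (N - i) h = psum (conv a b) N h.
Proof.
elim: N => [|N IH]; first by rewrite big_ord0 psum0.
rewrite psumS -IH /conv mulr_suml.
rewrite [X in _ = X + _](_ : _ = \sum_(i < N.+1) b i * h ^+ i * psum a (N - i) h); last first.
  by rewrite big_ord_recr /= subnn psum0 mulr0 addr0.
rewrite -big_split; apply: eq_bigr => i _ /=.
rewrite subSn; last by rewrite -ltnS.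
rewrite psumS mulrDr; congr (_ + _).
have iN : (i <= N)%N by rewrite -ltnS.
have -> : h ^+ N = h ^+ i * h ^+ (N - i) by rewrite -exprD subnKC.
by ring.
Qed.

Lemma le_nS_2X n : (n.+1%:R : R) <= 2 ^+ n.
Proof. by rewrite -natrX ler_nat ltn_expl. Qed.

(** The remainder of the Cauchy product splits as [(g - psum b N) * f + \sum b i * h ^+ i * (f -
    psum a (N - i))]. Coefficients and remainders are sums of about [n] equal bounds, and
    [n.+1 <= 2 ^ n] absorbs this number into the doubled [c]. *)
Lemma pexp_mul f g t a b M M' c : pexp f t a M c -> pexp g t b M' c ->
  pexp (fun x => f x * g x) t (conv a b) (2 * M * M') (2 * c).
Proof.
move=> [M0 c0 ha hf] [M0' _ hb hg].
have c0' := ltW c0.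
split=> [|||h N hh].
- by rewrite mulr_ge0 // mulr_ge0.
- by rewrite mulr_gt0.
- move=> n; apply: le_trans (ler_norm_sum _ _ _) _.
  have H (i : 'I_n.+1) : true -> `|b i * a (n - i)%N| <= M * M' * c ^+ n.
    move=> _; rewrite normrM.
    have iN : (i <= n)%N by rewrite -ltnS.
    apply: le_trans (ler_pM _ _ (hb i) (ha _)) _ => //.
    by rewrite -[in X in _ <= X](subnKC iN) exprD le_eqVlt; apply/orP; left; apply/eqP; ring.
  apply: le_trans (ler_sum _ H) _.
  rewrite sumr_const card_ord -[X in X <= _]mulr_natl exprMn.
  have := le_nS_2X n.
  have p : 0 <= M * M' * c ^+ n by rewrite !mulr_ge0 // exprn_ge0.
  move=> h2; apply: le_trans (ler_wpM2r p h2) _.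
  have p2 : 0 <= (2:R) ^+ n by rewrite exprn_ge0.
  have : 0 <= 2 ^+ n * (M * M' * c ^+ n) by rewrite mulr_ge0.
  have -> : 2 * M * M' * (2 ^+ n * c ^+ n) = 2 * (2 ^+ n * (M * M' * c ^+ n)) by ring.
  lra.
have x0 : 0 <= `|h| * c by rewrite mulr_ge0.
have hh' : `|h| * c <= 2^-1 by lra.
set x := `|h| * c in x0 hh' *.
have -> : `|h| * (2 * c) = 2 * x by rewrite /x; ring.
rewrite exprMn.
have -> : f (t + h) * g (t + h) - psum (conv a b) N h =
   (g (t + h) - psum b N h) * f (t + h) + \sum_(i < N) b i * h ^+ i * (f (t + h) - psum a (N - i) h).
  under eq_bigr do rewrite mulrBr.
  rewrite sumrB sum_conv -mulr_suml /psum; ring.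
apply: le_trans (ler_normD _ _) _.
have H1 : `|(g (t + h) - psum b N h) * f (t + h)| <= 4 * M * M' * x ^+ N.
  rewrite normrM; have := hf h 0%N hh'; rewrite psum0 subr0 expr0 mulr1 => h2.
  apply: le_trans (ler_pM _ _ (hg h N hh') h2) _ => //.
  by rewrite le_eqVlt; apply/orP; left; apply/eqP; rewrite /x; ring.
have H2 : `|\sum_(i < N) b i * h ^+ i * (f (t + h) - psum a (N - i) h)| <= N%:R * (2 * M * M' * x ^+ N).
  apply: le_trans (ler_norm_sum _ _ _) _.
  have H (i : 'I_N) : true -> `|b i * h ^+ i * (f (t + h) - psum a (N - i) h)| <= 2 * M * M' * x ^+ N.
    move=> _; rewrite !normrM normrX.
    have iN : (i <= N)%N by apply: ltnW.
    have hbi := ler_wpM2r (exprn_ge0 i (normr_ge0 h)) (hb i).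
    apply: le_trans (ler_pM _ _ hbi (hf h (N - i)%N hh')) _ => //.
    have -> : x ^+ N = c ^+ i * `|h| ^+ i * x ^+ (N - i) by rewrite -exprMn [c * _]mulrC -exprD subnKC.
    rewrite -/x.
    by rewrite le_eqVlt; apply/orP; left; apply/eqP; ring.
  apply: le_trans (ler_sum _ H) _.
  by rewrite sumr_const card_ord -[X in X <= _]mulr_natl.
apply: le_trans (lerD H1 H2) _.
have := le_nS_2X N; rewrite -natr1 => h3.
have p : 0 <= M * M' * x ^+ N by rewrite !mulr_ge0 // exprn_ge0.
have -> : 4 * M * M' * x ^+ N + N%:R * (2 * M * M' * x ^+ N) = (2 * N%:R + 4) * (M * M' * x ^+ N) by ring.
have -> : 2 * (2 * M * M') * (2 ^+ N * x ^+ N) = (4 * 2 ^+ N) * (M * M' * x ^+ N) by ring.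
apply: ler_wpM2r => //; have : 0 <= (N%:R : R) by []; lra.
Qed.

(** [B] is chosen so that [M / m * c = B - c]; the recursion then telescopes, since [(B - c) *
    \sum_i B ^+ (n - i) * c ^+ i = B ^+ n.+1 - c ^+ n.+1]. *)
Lemma conv_inv_bnd (c B m M : R) a b : 0 < c -> 0 < m -> 0 < M -> B = c * (1 + M / m) ->
  (forall n, `|a n| <= M * c ^+ n) ->
  (forall n, m * `|b n.+1| <= \sum_(i < n.+1) `|a i.+1| * `|b (n - i)%N|) ->
  m * `|b 0%N| <= 1 -> forall n, `|b n| <= m^-1 * B ^+ n.
Proof.
move=> c0 m0 M0 BE ha hb b0 n.
have Mm0 : 0 < M / m by rewrite divr_gt0.
have B0 : 0 < B by rewrite BE mulr_gt0 // addr_gt0.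
elim/ltn_ind: n => -[|n] IH.
  by rewrite expr0 mulr1 -(ler_pM2l m0) divff ?gt_eqF.
rewrite -(ler_pM2l m0) mulrA divff ?gt_eqF // mul1r; apply: le_trans (hb n) _.
apply: le_trans (_ : \sum_(i < n.+1) (M / m * c) * (B ^+ (n - i) * c ^+ i) <= _).
  apply: ler_sum => i _.
  have IHi := IH (n - i)%N (leq_ltn_trans (leq_subr _ _) (ltnSn _)).
  apply: le_trans (ler_pM _ _ (ha i.+1) IHi) _ => //.
  by rewrite exprS le_eqVlt; apply/orP; left; apply/eqP; ring.
rewrite -mulr_sumr.
have -> : M / m * c = B - c by rewrite BE; ring.
rewrite (eq_bigr (fun i : 'I_n.+1 => B ^+ (n.+1.-1 - i) * c ^+ i)) //.
rewrite -subrXX lerBlDr lerDl exprn_ge0 // ltW //.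
Qed.

Lemma inv_coefs_ex a : a 0%N != 0 -> exists b : nat -> R,
  b 0%N = (a 0%N)^-1 /\
  forall n, b n.+1 = - (a 0%N)^-1 * \sum_(i < n.+1) a i.+1 * b (n - i)%N.
Proof.
move=> a0.
(* Course-of-values recursion: [s n] lists the coefficients of index at most [n], all of which enter
   the next one. *)
pose fix s n : seq R := if n is k.+1 then
    rcons (s k) (- (a 0%N)^-1 * \sum_(i < k.+1) a i.+1 * nth 0 (s k) (k - i)%N)
  else [:: (a 0%N)^-1].
have szs n : size (s n) = n.+1 by elim: n => //= n IH; rewrite size_rcons IH.
have nths n k : (n <= k)%N -> nth 0 (s k) n = nth 0 (s n) n.
  elim: k => [|k IH]; first by rewrite leqn0 => /eqP ->.
  rewrite leq_eqVlt => /predU1P[-> //|nk] /=; rewrite nth_rcons szs nk.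
  by apply: IH; rewrite -ltnS.
exists (fun n => nth 0 (s n) n); split=> // n.
rewrite [LHS]/= nth_rcons szs ltnn eqxx; congr (_ * _); apply: eq_bigr => i _.
by rewrite nths // leq_subr.
Qed.

Lemma pexp_inv f t a M c (m : R) : 0 < m -> m <= `|f t| -> pexp f t a M c ->
  exists b, pexp (fun x => (f x)^-1) t b (2 * M / m ^+ 2) (2 * (c * (1 + M / m))).
Proof.
move=> m0 mf hpf; have a0 := pexp_coef0 hpf; case: (hpf) => M0 c0 ha hf.
rewrite -a0 in mf.
have mM : m <= M by have := ha 0%N; rewrite expr0 mulr1; apply: le_trans.
have Mp : 0 < M by exact: lt_le_trans mM.
have an0 : a 0%N != 0 by rewrite -normr_gt0; exact: lt_le_trans mf.
have [b [b0 bS]] := inv_coefs_ex an0.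
set B := c * (1 + M / m).
have Mm0 : 0 < M / m by rewrite divr_gt0.
have B0 : 0 < B by rewrite mulr_gt0 // addr_gt0.
have cB : c <= B by rewrite /B ler_peMr ?(ltW c0) // lerDl ltW.
have ia : `|a 0%N|^-1 <= m^-1 by rewrite lef_pV2 // posrE normr_gt0.
have hb : forall n, `|b n| <= m^-1 * B ^+ n.
  apply: (conv_inv_bnd c0 m0 Mp _ ha) => //.
    move=> n; rewrite bS normrM normrN normfV mulrA.
    apply: le_trans (_ : `|\sum_(i < n.+1) a i.+1 * b (n - i)%N| <= _).
      apply: ler_piMl => //; rewrite -(ler_pM2l m0) in ia.
      by rewrite divff ?gt_eqF in ia.
    by apply: le_trans (ler_norm_sum _ _ _) _; under eq_bigr do rewrite normrM.
  by rewrite b0 normfV -(divff (lt0r_neq0 m0)) ler_wpM2l // ltW.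
have cv n : conv a b n = (n == 0%N)%:R.
  case: n => [|n]; first by rewrite /conv big_ord1 subnn b0 mulVf.
  rewrite /conv big_ord_recr /= subnn bS.
  rewrite mulrAC mulNr mulVf // mulN1r.
  rewrite (reindex_inj rev_ord_inj) /=.
  apply/eqP; rewrite subr_eq0; apply/eqP; apply: eq_bigr => i _.
  rewrite !subSS mulrC; congr (_ * _); congr (a _).
  by have := ltn_ord i; rewrite ltnS => ?; rewrite subSn ?subKn // leq_subr.
exists b; split.
- by apply: divr_ge0; [rewrite mulr_ge0|rewrite exprn_ge0 // ltW].
- by rewrite mulr_gt0.
- move=> n; apply: le_trans (hb n) _.
  apply: ler_pM; rewrite ?invr_ge0 ?exprn_ge0 ?(ltW m0) ?(ltW B0) //.
    have -> : 2 * M / m ^+ 2 = m^-1 * (2 * (M / m)) by field; rewrite gt_eqF.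
    have q : 1 <= M / m by rewrite ler_pdivlMr // mul1r.
    by rewrite ler_peMr ?invr_ge0 ?(ltW m0) //; lra.
  by apply: lerXn2r; rewrite ?nnegrE ?mulr_ge0 ?(ltW B0) //; lra.
move=> h N hh.
have x0 : 0 <= `|h| * c by rewrite mulr_ge0 // ltW.
set x := `|h| * c in x0 *.
set y := `|h| * B.
have xy : y = x * (1 + M / m) by rewrite /y /B /x; ring.
have y4 : y <= 4^-1 by rewrite /y; clear - hh; lra.
have y0 : 0 <= y by rewrite mulr_ge0 // ltW.
have xley : x <= y by rewrite /x /y ler_wpM2l.
have xM : x * (M / m) <= 4^-1 by have : x * (M / m) <= y; [rewrite xy mulrDr mulr1; clear - x0; lra|clear - y4; lra].
have hx : x <= 2^-1 by clear - xley y4; lra.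
have fm : m / 2 <= `|f (t + h)|.
  have := hf h 1%N hx; rewrite psumS psum0 add0r expr0 mulr1 expr1 -/x => h1.
  have h2 : 2 * M * x <= m / 2.
    have -> : 2 * M * x = 2 * m * (x * (M / m)) by field; rewrite gt_eqF.
    by have := ler_wpM2l (ltW m0) xM; clear; lra.
  have := ler_normB (f (t + h)) (f (t + h) - a 0%N).
  rewrite opprB addrCA subrr addr0; clear - h1 h2 mf; lra.
have fn0 : f (t + h) != 0 by rewrite -normr_gt0; apply: lt_le_trans fm; clear - m0; lra.
have fi : `|(f (t + h))^-1| <= 2 / m.
  rewrite normfV -[2 / m]invrK lef_pV2 ?posrE ?invr_gt0 ?divr_gt0 ?normr_gt0 //.
  by rewrite invf_div.
have -> : `|h| * (2 * B) = 2 * y by rewrite /y; ring.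
have Mmm : 2 / m <= 2 * (2 * M / m ^+ 2).
  have -> : 2 * (2 * M / m ^+ 2) = 2 / m * (2 * (M / m)) by field; rewrite gt_eqF.
  have : 1 <= M / m by rewrite ler_pdivlMr // mul1r.
  have : 0 <= 2 / m by rewrite divr_ge0 // ltW.
  move=> q1 q2; rewrite ler_peMr //; clear - q2; lra.
case: N => [|N].
  by rewrite psum0 subr0 expr0 mulr1; exact: le_trans fi _.
have E : \sum_(i < N.+1) b i * h ^+ i * psum a (N.+1 - i) h = 1.
  rewrite sum_conv /psum big_ord_recl cv eqxx expr0 mulr1 big1 ?addr0 // => i _.
  by rewrite cv mul0r.
(* As the Cauchy product of [a] and [b] is the constant 1, the identity used for products expresses
   the remainder of the inverse through remainders of [f] alone. *)
have -> : (f (t + h))^-1 - psum b N.+1 h =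
   - (f (t + h))^-1 * \sum_(i < N.+1) b i * h ^+ i * (f (t + h) - psum a (N.+1 - i) h).
  under eq_bigr do rewrite mulrBr.
  rewrite sumrB E -mulr_suml -/(psum b N.+1 h); field.
  by rewrite fn0.
rewrite normrM normrN.
have H2 : `|\sum_(i < N.+1) b i * h ^+ i * (f (t + h) - psum a (N.+1 - i) h)| <= N.+1%:R * (m^-1 * (2 * M) * y ^+ N.+1).
  apply: le_trans (ler_norm_sum _ _ _) _.
  have H (i : 'I_N.+1) : true -> `|b i * h ^+ i * (f (t + h) - psum a (N.+1 - i) h)| <= m^-1 * (2 * M) * y ^+ N.+1.
    move=> _; rewrite !normrM normrX.
    have iN : (i <= N.+1)%N by apply: ltnW.
    have hbi := ler_wpM2r (exprn_ge0 i (normr_ge0 h)) (hb i).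
    have hfi : `|f (t + h) - psum a (N.+1 - i) h| <= 2 * M * y ^+ (N.+1 - i).
      apply: le_trans (hf h (N.+1 - i)%N hx) _; rewrite ler_wpM2l ?mulr_ge0 //.
      by apply: lerXn2r; rewrite ?nnegrE.
    apply: le_trans (ler_pM _ _ hbi hfi) _ => //.
    have -> : y ^+ N.+1 = B ^+ i * `|h| ^+ i * y ^+ (N.+1 - i) by rewrite -exprMn [B * _]mulrC -exprD subnKC.
    by rewrite le_eqVlt; apply/orP; left; apply/eqP; ring.
  apply: le_trans (ler_sum _ H) _.
  by rewrite sumr_const card_ord -[X in X <= _]mulr_natl.
apply: le_trans (ler_pM _ _ fi H2) _ => //.
have h3 : N.+1%:R <= (2:R) ^+ N.+1 by rewrite -natrX ler_nat ltnW // ltn_expl.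
have p : 0 <= 2 / m * (m^-1 * (2 * M) * y ^+ N.+1).
  by rewrite !mulr_ge0 ?exprn_ge0 ?invr_ge0 ?(ltW m0).
have -> : 2 / m * (N.+1%:R * (m^-1 * (2 * M) * y ^+ N.+1)) = N.+1%:R * (2 / m * (m^-1 * (2 * M) * y ^+ N.+1)) by ring.
apply: le_trans (ler_wpM2r p h3) _.
rewrite [(2 * y) ^+ _]exprMn; set u := 2 ^+ _; set v := y ^+ _.
by rewrite le_eqVlt; apply/orP; left; apply/eqP; field; rewrite gt_eqF.
Qed.

Lemma psum_tail b M c h N K : (forall n, `|b n| <= M * c ^+ n) -> 0 <= c ->
  `|h| * c <= 2^-1 -> (N <= K)%N -> `|psum b K h - psum b N h| <= 2 * M * (`|h| * c) ^+ N.
Proof.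
move=> hb c0 hh NK.
have M0 : 0 <= M by have := hb 0%N; rewrite expr0 mulr1; apply: le_trans.
rewrite /psum -!(big_mkord xpredT (fun i => b i * h ^+ i)) (@big_cat_nat _ _ _ N 0%N K) //=.
rewrite addrAC subrr add0r (le_trans (ler_norm_sum _ _ _)) //.
apply: le_trans (_ : \sum_(N <= i < K) M * (`|h| * c) ^+ i <= _).
  apply: ler_sum => i _; rewrite normrM normrX exprMn [X in M * X]mulrC mulrA.
  by rewrite ler_wpM2r ?exprn_ge0.
rewrite -mulr_sumr [2 * M]mulrC -mulrA ler_wpM2l // geo_tail_le // mulr_ge0 //.
Qed.

(** Horner's scheme: the quotient has the coefficients [b k = \sum_j a (k.+1 + j) * s ^+ j]. Their
    relation to [a] is kept in the conclusion because the count of zeros iterates it. The bound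
    becomes [2 * M * c] but [c] is unchanged, so arbitrarily many zeros can be divided out at the
    same radius. *)
Lemma pexp_div f t a M c (s : R) : pexp f t a M c -> `|s| * c <= 4^-1 -> f (t + s) = 0 ->
  exists g b, [/\ pexp g t b (2 * M * c) c,
    forall h, `|h| * c <= 2^-1 -> f (t + h) = (h - s) * g (t + h) &
    forall k, a k = (if k is j.+1 then b j else 0) - s * b k].
Proof.
move=> [M0 c0 ha hf] s4 fs0.
have c0' := ltW c0.
set x := `|s| * c in s4.
have x0 : 0 <= x by rewrite mulr_ge0.
have x2 : x <= 2^-1 by lra.
have bG k : forall j, `|a (k + j)%N * s ^+ j| <= (M * c ^+ k) * x ^+ j.
  move=> j; rewrite normrM normrX exprMn; apply: le_trans (ler_wpM2r _ (ha _)) _.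
    by rewrite exprn_ge0.
  by rewrite exprD le_eqVlt; apply/orP; left; apply/eqP; ring.
have /choice[G hG] k := ps_lim x0 x2 (bG k).
have Gb k : `|G k| <= 2 * M * c ^+ k.
  by have := hG k 0%N; rewrite big_ord0 subr0 expr0 mulr1 mulrA.
have GS k : a k = G k - s * G k.+1.
  apply/eqP; rewrite -subr_eq0 -normr_le0.
  apply: (@le_add_pow x _ _ (2 * (M * c ^+ k) * x + `|s| * (2 * (M * c ^+ k.+1)))) => // N.
  rewrite add0r.
  have -> : a k - (G k - s * G k.+1) = - (G k - \sum_(i < N.+1) a (k + i)%N * s ^+ i)
       + s * (G k.+1 - \sum_(i < N) a (k.+1 + i)%N * s ^+ i).
    rewrite big_ord_recl addn0 expr0 mulr1 mulrBr mulr_sumr.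
    rewrite (eq_bigr (fun i : 'I_N => s * (a (k.+1 + i)%N * s ^+ i))); first by ring.
    by move=> i _; rewrite lift0 addSnnS exprS; ring.
  apply: le_trans (ler_normD _ _) _; rewrite normrN normrM.
  have h1 := hG k N.+1; have h2 := ler_wpM2l (normr_ge0 s) (hG k.+1 N).
  apply: le_trans (lerD h1 h2) _.
  by rewrite exprS le_eqVlt; apply/orP; left; apply/eqP; ring.
have G0 : G 0%N = 0.
  rewrite -fs0; apply/eqP; rewrite -subr_eq0 -normr_le0.
  apply: (@le_add_pow x _ _ (4 * M)) => // N.
  have h1 := hG 0%N N; have h2 := hf s N x2; rewrite expr0 mulr1 in h1.
  have -> : G 0%N - f (t + s) = (G 0%N - \sum_(i < N) a (0 + i)%N * s ^+ i) - (f (t + s) - psum a N s).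
    by rewrite /psum; ring.
  apply: le_trans (ler_normB _ _) _; apply: le_trans (lerD h1 h2) _.
  by rewrite -/x le_eqVlt; apply/orP; left; apply/eqP; ring.
pose b k := G k.+1.
have bb n : `|b n| <= (2 * M * c) * c ^+ n.
  by rewrite -mulrA -exprS; exact: Gb.
have bs n : `|b n * s ^+ n| <= (2 * M * c) * x ^+ n.
  rewrite normrM normrX exprMn; apply: le_trans (ler_wpM2r _ (bb _)) _.
    by rewrite exprn_ge0.
  by rewrite le_eqVlt; apply/orP; left; apply/eqP; ring.
have [l hl] := ps_lim x0 x2 bs.
have pab N h : psum a N h = (h - s) * psum b N h - G N * h ^+ N.
  elim: N => [|N IH]; first by rewrite !psum0 G0; ring.
  by rewrite !psumS IH (GS N) /b exprS; ring.
(* [l] is the sum of the quotient series at [s], which removes the singularity. *)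
pose g y := if y == t + s then l else f y / (y - t - s).
have gE h : h != s -> g (t + h) = f (t + h) / (h - s).
  move=> hs; rewrite /g ifF; first by congr (_ / _); ring.
  by apply/negbTE; rewrite (inj_eq (addrI t)).
exists g, b; split.
- split=> // [|h N hh]; first by rewrite !mulr_ge0.
  have [->|hs] := eqVneq h s.
    by rewrite /g eqxx; exact: hl.
  have hs0 : h - s != 0 by rewrite subr_eq0.
  rewrite gE //.
  have y0 : 0 <= `|h| * c by rewrite mulr_ge0.
  apply: (@le_add_pow (`|h| * c) _ _ (4 * M / `|h - s|)) => // K.
  have -> : f (t + h) / (h - s) - psum b N h =
    (psum b (N + K) h - psum b N h) + (f (t + h) - psum a (N + K) h - G (N + K)%N * h ^+ (N + K)) / (h - s).
    by rewrite pab; field.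
  apply: le_trans (ler_normD _ _) _; apply: lerD.
    by apply: psum_tail => //; exact: leq_addr.
  rewrite normrM normfV [4 * M / _ * _]mulrAC ler_wpM2r ?invr_ge0 //.
  apply: le_trans (ler_normB _ _) _.
  apply: le_trans (_ : 2 * M * (`|h| * c) ^+ (N + K) + 2 * M * (`|h| * c) ^+ (N + K) <= _).
    apply: lerD; first exact: hf.
    rewrite normrM normrX; apply: le_trans (ler_wpM2r _ (Gb _)) _.
      by rewrite exprn_ge0.
    by rewrite exprMn le_eqVlt; apply/orP; left; apply/eqP; ring.
  rewrite exprD -mulrDl.
  have : (`|h| * c) ^+ N <= 1 by apply: exprn_ile1 => //; lra.
  have : 0 <= (`|h| * c) ^+ K by rewrite exprn_ge0.
  set u := _ ^+ N; set v := _ ^+ K => v0 u1.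
  have -> : (2 * M + 2 * M) * (u * v) = 4 * M * (u * v) by ring.
  by rewrite ler_wpM2l ?mulr_ge0 // ler_piMl.
- move=> h hh; have [->|hs] := eqVneq h s; first by rewrite fs0 subrr mul0r.
  by rewrite gE // mulrC divfK // subr_eq0.
- by case=> [|k]; rewrite /b GS // G0.
Qed.

(** Divide [f - f (t + h')], whose bound is [3 * M], by its linear factor: the quotient is at most
    [2 * (2 * (3 * M) * c)]. *)
Lemma pexp_lip f t a M c h h' : pexp f t a M c -> `|h| * c <= 2^-1 -> `|h'| * c <= 4^-1 ->
  `|f (t + h) - f (t + h')| <= 12 * M * c * `|h - h'|.
Proof.
move=> hf hh hh'; have h0 := hf; case: h0 => M0 c0 _ _.
have h1 := pexp_add hf (pexp_cst (- f (t + h')) t c0).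
have h2 : `|h'| * c <= 2^-1 by lra.
have fb := pexp_bnd hf h2.
have {}h1 := pexp_le h1 (_ : _ <= 3 * M) (lexx _).
have [|g [b [hg fg _]]] := pexp_div (h1 _) hh' (subrr _).
  by rewrite normrN; lra.
rewrite (fg _ hh) normrM mulrC ler_wpM2r //.
by apply: le_trans (pexp_bnd hg hh) _; rewrite le_eqVlt; apply/orP; left; apply/eqP; ring.
Qed.

Lemma pexp_uniq f t a b M c M' c' : pexp f t a M c -> pexp f t b M' c' -> a =1 b.
Proof.
move=> ha hb.
pose m := Num.max M M'; pose d := Num.max c c'.
have {}ha : pexp f t a m d by apply: pexp_le ha _ _; rewrite le_max lexx.
have {}hb : pexp f t b m d by apply: pexp_le hb _ _; rewrite le_max lexx orbT.
case: ha => m0 d0 _ ha; case: hb => _ _ _ hb.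
elim/ltn_ind => n IH.
apply/eqP; rewrite -subr_eq0 -normr_le0.
apply: (@le_add_lin _ (4 * m * d ^+ n.+1) (2 * d)^-1); first by rewrite invr_gt0 mulr_gt0.
move=> h h0; rewrite invfM => he.
have hh : `|h| * d <= 2^-1 by rewrite gtr0_norm // -ler_pdivlMr.
have h1 := ha h n.+1 hh; have h2 := hb h n.+1 hh.
have E : (a n - b n) * h ^+ n = (f (t + h) - psum b n.+1 h) - (f (t + h) - psum a n.+1 h).
  have -> : psum b n.+1 h = psum a n h + b n * h ^+ n.
    by rewrite psumS; congr (_ + _); apply: eq_bigr => i _; rewrite IH.
  by rewrite psumS; ring.
have hn : 0 < h ^+ n by rewrite exprn_gt0.
rewrite -(ler_pM2r hn) -[X in _ * X <= _]gtr0_norm // -normrM E.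
apply: le_trans (ler_normB _ _) _; apply: le_trans (lerD h2 h1) _.
by rewrite gtr0_norm // exprMn !exprS le_eqVlt; apply/orP; left; apply/eqP; ring.
Qed.

Lemma psum_recenter a N d h : psum a N (d + h) =
  psum (fun k => \sum_(n < N) a n * ('C(n, k)%:R * d ^+ (n - k))) N h.
Proof.
rewrite /psum; under [RHS]eq_bigr do rewrite mulr_suml.
rewrite exchange_big /=; apply: eq_bigr => n _.
rewrite exprDn mulr_sumr (big_ord_widen N (fun i => a n * (d ^+ (n - i) * h ^+ i *+ 'C(n, i)))) //=.
rewrite big_mkcond /=; apply: eq_bigr => k _; case: ifP => kn.
  by rewrite -mulr_natr; ring.
rewrite bin_small ?mul0r ?mulr0 ?mul0r //.
  by move: kn; rewrite ltnS => /negbT; rewrite -ltnNge.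
Qed.

Lemma bin_le_2X n k : ('C(n, k)%:R : R) <= 2 ^+ n.
Proof.
rewrite -natrX ler_nat; have -> : (2 ^ n = (1 + 1) ^ n)%N by [].
rewrite expnDn; have [kn|nk] := leqP k n; last by rewrite bin_small.
rewrite (bigD1 (Ordinal (_ : k < n.+1)%N)) //=.
by rewrite !exp1n !muln1 leq_addr.
Qed.

(** Binomial expansion of the series at [t]. The estimate ['C(n, k) <= 2 ^ n] is what doubles [c],
    and the condition on [d] makes the remaining geometric sums at most 2. *)
Lemma pexp_recenter f t a M c d : pexp f t a M c -> `|d| * c <= 4^-1 ->
  exists b, pexp f (t + d) b (2 * M) (2 * c).
Proof.
move=> [M0 c0 ha hf] d4; have c0' := ltW c0.
have y2 : `|d| * (2 * c) <= 2^-1 by lra.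
set y := `|d| * (2 * c) in y2.
have y0 : 0 <= y by rewrite !mulr_ge0.
pose u k n := a n * ('C(n, k)%:R * d ^+ (n - k)).
have hu k n : `|u k n| <= (M * (2 * c) ^+ k) * (if (n < k)%N then 0 else y ^+ (n - k)).
  rewrite /u; case: ltnP => kn; first by rewrite bin_small // mul0r !mulr0 normr0.
  rewrite !normrM normrX normr_nat.
  apply: le_trans (_ : (M * c ^+ n) * (2 ^+ n * `|d| ^+ (n - k)) <= _).
    by apply: ler_pM => //; rewrite ?mulr_ge0 ?exprn_ge0 // ler_wpM2r ?exprn_ge0 ?bin_le_2X.
  rewrite -[X in c ^+ X](subnKC kn) -[X in 2 ^+ X](subnKC kn) !exprD /y !exprMn.
  by rewrite le_eqVlt; apply/orP; left; apply/eqP; ring.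
(* A cruder bound that decays in [n] itself: a factor [2 ^+ k] is given away so that the partial
   sums of every coefficient converge at the one rate [2^-1 ^+ N]. *)
have hu' k n : `|u k n| <= (M * (4 * c) ^+ k) * (2^-1) ^+ n.
  apply: le_trans (hu k n) _.
  have -> : (4 * c) ^+ k = (2 * c) ^+ k * 2 ^+ k by rewrite -exprMn; congr (_ ^+ _); ring.
  rewrite -2!mulrA -[in X in _ <= X]mulrA ler_wpM2l // ler_wpM2l ?exprn_ge0 ?mulr_ge0 //.
  case: ltnP => kn; first by rewrite mulr_ge0 ?exprn_ge0 ?invr_ge0.
  rewrite -[X in 2^-1 ^+ X](subnKC kn) exprD mulrA -exprMn divff // expr1n mul1r.
  by apply: lerXn2r; rewrite ?nnegrE.
have h20 : (0 : R) <= 2^-1 by rewrite invr_ge0.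
have /choice[b hb] k := ps_lim h20 (lexx _) (hu' k).
have bN k N : `|\sum_(n < N) u k n| <= 2 * M * (2 * c) ^+ k.
  apply: le_trans (ler_norm_sum _ _ _) _.
  apply: le_trans (ler_sum _ (fun (i : 'I_N) _ => hu k i)) _.
  rewrite -mulr_sumr [X in _ <= X](_ : _ = M * (2 * c) ^+ k * 2); last by ring.
  by rewrite ler_wpM2l ?geo_shift_le2 // mulr_ge0 // exprn_ge0 // mulr_ge0.
have bb k : `|b k| <= 2 * M * (2 * c) ^+ k.
  apply: (@le_add_pow 2^-1 _ _ (2 * (M * (4 * c) ^+ k))) => // N.
  have -> : b k = \sum_(n < N) u k n + (b k - \sum_(n < N) u k n) by ring.
  by apply: le_trans (ler_normD _ _) _; apply: lerD.
exists b; split=> // [||h K hh]; rewrite ?mulr_ge0 ?mulr_gt0 //.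
have hc4 : `|h| * c <= 4^-1 by lra.
have dh : `|d + h| * c <= 2^-1.
  by have := ler_wpM2r c0' (ler_normD d h); rewrite mulrDl; lra.
rewrite -addrA.
apply: (@le_add_pow_from 2^-1 _ _ (2 * M + K%:R * (2 * M)) K) => // N NK.
set q := fun k => \sum_(n < N) u k n.
have -> : f (t + (d + h)) - psum b K h = (psum q N h - psum q K h) +
   ((f (t + (d + h)) - psum a N (d + h)) + (psum q K h - psum b K h)).
  by rewrite psum_recenter -/q; ring.
apply: le_trans (ler_normD _ _) _; apply: lerD.
  apply: psum_tail => //; last by rewrite mulr_ge0.
  by move=> n; exact: bN.
rewrite [X in _ <= X]mulrDl; apply: le_trans (ler_normD _ _) _; apply: lerD.
  apply: le_trans (hf _ _ dh) _; rewrite ler_wpM2l ?mulr_ge0 //.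
  by apply: lerXn2r; rewrite ?nnegrE ?mulr_ge0.
have -> : psum q K h - psum b K h = \sum_(k < K) (q k - b k) * h ^+ k.
  by rewrite /psum -sumrB; apply: eq_bigr => k _; rewrite mulrBl.
apply: le_trans (ler_norm_sum _ _ _) _.
apply: le_trans (_ : \sum_(k < K) (2 * M * 2^-1 ^+ N) <= _); last first.
  by rewrite sumr_const card_ord -[X in X <= _]mulr_natl mulrA.
apply: ler_sum => k _; rewrite normrM normrX distrC.
apply: le_trans (ler_wpM2r _ (hb k N)) _; first by rewrite exprn_ge0.
have -> : 2 * (M * (4 * c) ^+ k) * 2^-1 ^+ N * `|h| ^+ k = 2 * M * 2^-1 ^+ N * (`|h| * (4 * c)) ^+ k.
  by rewrite [in RHS]exprMn; ring.
rewrite ler_piMr ?mulr_ge0 ?exprn_ge0 //.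
by apply: exprn_ile1; rewrite ?mulr_ge0 //; lra.
Qed.

Lemma quad_derive f t (l C e : R) : 0 < e ->
  (forall h, `|h| <= e -> `|f (t + h) - f t - l * h| <= C * h ^+ 2) -> is_derive t (1 : R) f l.
Proof.
move=> e0 H.
suff cv : (fun h : R => h^-1 *: (f (h *: (1 : R) + t) - f t)) @ 0^' --> l.
  split; first by apply/cvg_ex; exists l; exact: cv.
  by apply: cvg_lim.
have C0 : 0 <= C.
  have := H e; rewrite ger0_norm ?(ltW e0) // lexx => /(_ isT) /(le_trans (normr_ge0 _)).
  by rewrite pmulr_lge0 // exprn_gt0.
apply/cvgrPdist_le => eps eps0; near=> h.
have hn0 : h != 0 by near: h; exact: nbhs_dnbhs_neq.
have he : `|h| <= e by near: h; apply: dnbhs0_le.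
have hC : `|h| <= eps / (C + 1) by near: h; apply: dnbhs0_le; rewrite divr_gt0 // ltr_wpDl.
rewrite [_ *: 1]mulr1 [h + t]addrC.
have -> : l - h^-1 *: (f (t + h) - f t) = - ((f (t + h) - f t - l * h) / h).
  by rewrite /GRing.scale /=; field.
rewrite normrN normrM normfV ler_pdivrMr ?normr_gt0 //.
apply: le_trans (H h he) _.
rewrite -[h ^+ 2]ger0_norm ?sqr_ge0 // normrX expr2 mulrA ler_wpM2r //.
rewrite ler_pdivlMr in hC; last by rewrite ltr_wpDl.
by have := normr_ge0 h; lra.
Unshelve. all: by end_near. Qed.

Lemma pexp_is_derive f t a M c : pexp f t a M c -> is_derive t (1 : R) f (a 1%N).
Proof.
move=> hf; have a0 := pexp_coef0 hf; case: hf => M0 c0 _ hf.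
apply: (@quad_derive _ _ _ (2 * M * c ^+ 2) (2 * c)^-1); first by rewrite invr_gt0 mulr_gt0.
move=> h hh; have := hf h 2%N.
have hh' : `|h| * c <= 2^-1 by rewrite invfM ler_pdivlMr in hh.
rewrite !psumS psum0 add0r expr0 mulr1 expr1 a0 opprD addrA exprMn real_normK ?num_real // => /(_ hh') H.
by apply: le_trans H _; rewrite le_eqVlt; apply/orP; left; apply/eqP; ring.
Qed.

End PowerSeries.

(** * Counting zeros *)

Section Analytic.
Context {R : realType}.
Implicit Types (f : R -> R) (t h c M : R) (a : nat -> R).

(** Convergence at [r / 2] bounds the terms [a n * (r / 2) ^+ n]; this is the geometric bound with
    [c = 2 / r]. *)
Lemma real_analytic_pexp f t : real_analytic f -> exists a M c, pexp f t a M c.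
Proof.
move=> /(_ t)[r r0 [a ha]].
have r2 : `|r / 2| < r by rewrite gtr0_norm ?divr_gt0 //; lra.
have bd : exists2 M, 0 <= M & forall n, `|a n * (r / 2) ^+ n| <= M.
  have : cvgn (pseries a (r / 2)) by apply/cvg_ex; eexists; exact: ha.
  move=> /cvg_series_bounded [M [Mr HM]].
  exists (`|M| + 1) => // n; apply: (HM (`|M| + 1)) => //.
  by rewrite (le_lt_trans (ler_norm _)) // ltrDl.
have [M M0 HM] := bd.
have r20 : 0 < r / 2 by rewrite divr_gt0.
exists a, M, (r / 2)^-1; split=> // [|n|h N hh]; first by rewrite invr_gt0.
  by rewrite exprVn -ler_pdivrMr ?invr_gt0 ?exprn_gt0 // invrK -[X in _ * X <= _]gtr0_norm ?exprn_gt0 // -normrM.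
have hr : `|h| < r by rewrite ler_pdivrMr // in hh; lra.
have han n : `|a n| <= M * (r / 2)^-1 ^+ n.
  by rewrite exprVn -ler_pdivrMr ?invr_gt0 ?exprn_gt0 // invrK -[X in _ * X <= _]gtr0_norm ?exprn_gt0 // -normrM.
have cv := ha h hr.
have {}cv : (fun K => `|pseries a h K - psum a N h|) @ \oo --> `|f (t + h) - psum a N h|.
  by apply: cvg_norm; apply: cvgB => //; apply: cvg_cst.
rewrite -(cvg_lim _ cv) //; apply: limr_le; first by apply/cvg_ex; eexists; exact: cv.
near=> K.
have NK : (N <= K)%N by near: K; exists N.
have -> : pseries a h K = psum a K h by rewrite /pseries /series /psum /= big_mkord.
by apply: psum_tail => //; rewrite invr_ge0 ltW.
Unshelve. all: by end_near. Qed.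

Lemma pexp_shift f t (s : R) a M c : pexp f (t + s) a M c -> pexp (fun x => f (x + s)) t a M c.
Proof.
by case=> M0 c0 ha hf; split=> // h N hh; rewrite addrAC; exact: hf.
Qed.

Lemma periodic_nat f t (n : nat) : (forall t, f (t + 1) = f t) -> f (t + n%:R) = f t.
Proof. by move=> fp; elim: n => [|n IH]; rewrite ?addr0 // -natr1 addrA fp. Qed.

Lemma periodic_int f t (n : int) : (forall t, f (t + 1) = f t) -> f (t + n%:~R) = f t.
Proof.
move=> fp; case: n => n; first exact: periodic_nat.
rewrite NegzE mulrNz; set x := t - _.
by rewrite -(periodic_nat x n.+1 fp) /x pmulrn subrK.
Qed.

Lemma periodic_window (P : R -> Prop) (w : R) :
  (forall t, P (t + 1) <-> P t) -> (forall t, w <= t <= w + 1 -> P t) -> forall t, P t.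
Proof.
move=> Pp H t.
have Pn (n : nat) x : P (x + n%:R) <-> P x.
  elim: n => [|n IH]; first by rewrite addr0.
  by rewrite -natr1 addrA; split=> [/Pp/IH//|/IH/Pp].
have Pz (n : int) x : P (x + n%:~R) <-> P x.
  case: n => n; first exact: Pn.
  rewrite NegzE mulrNz; set y := x - _.
  by have := Pn n.+1 y; rewrite /y subrK => q; split=> /q.
apply/(Pz (- Num.floor (t - w))); apply: H.
have := floor_le (t - w); have := floorD1_gt (t - w).
rewrite mulrNz intrD; lra.
Qed.

(** Heine-Borel, with the filter of large [B] in place of a finite maximum. The constants that are
    uniform along the curve come from here. *)
Lemma segment_uniform (P : R -> R -> Prop) (u v : R) :
  (forall x, u <= x <= v -> exists e B : R, 0 < e /\
     forall x' B', `|x' - x| <= e -> B <= B' -> P B' x') ->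
  exists B, forall x, u <= x <= v -> P B x.
Proof.
move=> H.
have /compact_near_coveringP cpt := @segment_compact R u v.
have cov : forall x, `[u, v]%classic x -> \forall x' \near x & B \near +oo, P B x'.
  move=> x /=; rewrite in_itv /= => /H [e [B0 [e0 HP]]].
  exists ([set x' | `|x' - x| < e], [set B | B0 < B]) => /=.
    split; last by exists B0; rewrite num_real.
    by apply/nbhs_ballP; exists e => //= y; rewrite /ball /= distrC.
  by move=> [x' B] /= [h1 h2]; apply: HP; exact: ltW.
have := cpt R (pinfty_nbhs R) P _ cov.
case=> B0 [_ HB]; exists (B0 + 1) => x xuv; apply: (HB (B0 + 1)); rewrite ?ltrDl //=.
Qed.

Lemma real_analytic_uniform f : real_analytic f -> (forall t, f (t + 1) = f t) ->
  exists B, forall t, exists a, pexp f t a B B.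
Proof.
move=> fa fp.
have [B HB] : exists B, forall t, 0 <= t <= 1 -> exists a, pexp f t a B B.
  apply: (@segment_uniform (fun B t => exists a, pexp f t a B B)) => t _.
  have [a [M [c hf]]] := real_analytic_pexp t fa.
  have c0 : 0 < c by case: hf.
  exists (4 * c)^-1, (Num.max (2 * M) (2 * c)); rewrite invr_gt0 mulr_gt0 //; split=> // x B hx.
  rewrite ge_max => /andP[h1 h2].
  have [|b hb] := pexp_recenter (d := x - t) hf.
    by rewrite invfM ler_pdivlMr in hx.
  by exists b; rewrite addrC subrK in hb; exact: pexp_le hb _ _.
exists B; apply: (@periodic_window _ 0).
  move=> t; split=> -[a ha]; exists a.
    by apply: pexp_eq (pexp_shift ha) _ => h _; rewrite fp.
  case: ha => M0 c0 ha hf; split=> // h N hh; rewrite addrAC fp; exact: hf.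
by rewrite add0r.
Qed.

(** The zeros are divided out one at a time by [pexp_div]. With the radius relaxed from [c] to
    [4 * c], the relation [a k = b (k - 1) - z * b k] gains the factor [1 / 2 + 1 / 8 = 5 / 8] per
    zero: the first summand from [2 * c / (4 * c)], the second from [2 * |z| * c <= 1 / 8]. *)
Lemma pexp_zeros (zs : seq R) f t a M c : pexp f t a M c -> uniq zs ->
  (forall z, z \in zs -> `|z| * c <= 16^-1 /\ f (t + z) = 0) ->
  forall k, `|a k| <= M * (5 / 8) ^+ size zs * (4 * c) ^+ k.
Proof.
elim: zs f a M => [|z zs IH] f a M hf.
  move=> _ _ k; rewrite expr0 mulr1; case: hf => M0 c0 ha _.
  apply: le_trans (ha k) _; rewrite ler_wpM2l //.
  by apply: lerXn2r; rewrite ?nnegrE ?mulr_ge0 ?ltW //; lra.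
rewrite cons_uniq => /andP[zzs uzs] H.
have [z16 fz] := H z (mem_head _ _).
have z4 : `|z| * c <= 4^-1 by lra.
have [g [b [hg fg ab]]] := pexp_div hf z4 fz.
have [M0 c0 _ _] := hf; have c0' := ltW c0.
have {}IH := IH g b _ hg uzs.
have bk : forall k, `|b k| <= (2 * M * c) * (5 / 8) ^+ size zs * (4 * c) ^+ k.
  apply: IH => y yzs; have [y16 fy] := H y (mem_behead (s := z :: zs) yzs).
  split=> //; have yc : `|y| * c <= 2^-1 by lra.
  move: fy; rewrite fg // => /eqP; rewrite mulf_eq0 subr_eq0 => /orP[/eqP yz|/eqP //].
  by rewrite -yz yzs in zzs.
have p8 : 0 <= (5 / 8 : R) ^+ size zs by rewrite exprn_ge0 // divr_ge0.
move=> k; rewrite ab /= exprS; set w := _ ^+ size zs in p8 bk *.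
have zb : `|z * b k| <= (8^-1 * M) * w * (4 * c) ^+ k.
  rewrite normrM; apply: le_trans (ler_wpM2l (normr_ge0 z) (bk k)) _.
  have -> : `|z| * (2 * M * c * w * (4 * c) ^+ k) = (`|z| * c) * (2 * M * w * (4 * c) ^+ k) by ring.
  have -> : 8^-1 * M * w * (4 * c) ^+ k = 16^-1 * (2 * M * w * (4 * c) ^+ k) by field.
  by rewrite ler_wpM2r // !mulr_ge0 ?exprn_ge0 ?mulr_ge0.
apply: le_trans (ler_normB _ _) _.
have h1 : `|if k is j.+1 then b j else 0| <= 2^-1 * M * w * (4 * c) ^+ k.
  case: k {zb} => [|k]; first by rewrite normr0 !mulr_ge0 ?exprn_ge0 ?mulr_ge0 ?invr_ge0.
  apply: le_trans (bk k) _; rewrite [(4 * c) ^+ k.+1]exprS le_eqVlt; apply/orP; left; apply/eqP.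
  by field.
apply: le_trans (lerD h1 zb) _; by rewrite le_eqVlt; apply/orP; left; apply/eqP; field.
Qed.

(** Propagation of smallness, in the role of the three circles theorem. Recentering bounds the new
    coefficients by [2 * e * (8 * c) ^+ k], the a priori bound is [M * c ^+ k], and the geometric
    mean of the two is at most [e' * (4 * c) ^+ k]. The amplitude degrades to a square root but the
    radius does not shrink, so the step can be repeated. *)
Lemma pexp_smooth_step f t a b d M c (e e' : R) : pexp f t a M c ->
  pexp f (t + d) b M c -> (forall k, `|a k| <= e * (4 * c) ^+ k) ->
  `|d| * c <= 16^-1 -> 0 <= e' -> 2 * e * M <= e' ^+ 2 ->
  forall k, `|b k| <= e' * (4 * c) ^+ k.
Proof.
move=> ha hb ae d16 e'0 ee' k.
have [M0 c0 _ hf] := ha; have c0' := ltW c0.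
have e0 : 0 <= e by have := ae 0%N; rewrite expr0 mulr1; apply: le_trans.
pose m := Num.max 1 (M / 1).
have : exists b', pexp f (t + d) b' (2 * e) (8 * c).
  have -> : 8 * c = 2 * (4 * c) by ring.
  apply: (@pexp_recenter _ f t a e (4 * c) d); last by lra.
  split=> // [|h N hh]; first by rewrite mulr_gt0.
  have hc : `|h| * c <= 2^-1 by have : 0 <= `|h| * c by [rewrite mulr_ge0]; lra.
  apply: (@le_add_pow_from _ 2^-1 _ _ (2 * M) N); rewrite ?invr_ge0 // => K NK.
  have -> : f (t + h) - psum a N h = (psum a K h - psum a N h) + (f (t + h) - psum a K h) by ring.
  apply: le_trans (ler_normD _ _) _; apply: lerD.
    by apply: psum_tail => //; rewrite mulr_ge0.
  apply: le_trans (hf _ _ hc) _; rewrite ler_wpM2l ?mulr_ge0 //.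
  by apply: lerXn2r; rewrite ?nnegrE ?mulr_ge0 ?invr_ge0.
case=> b' hb'; have bb' := pexp_uniq hb hb'.
have h1 : `|b k| <= 2 * e * (8 * c) ^+ k by rewrite bb'; case: hb'.
have h2 : `|b k| <= M * c ^+ k by case: hb.
rewrite -(@ler_pXn2r _ 2) ?nnegrE ?mulr_ge0 ?exprn_ge0 ?mulr_ge0 // expr2.
apply: le_trans (ler_pM _ _ h1 h2) _ => //.
apply: le_trans (_ : (2 * e * M) * ((4 * c) ^+ k) ^+ 2 <= _); last first.
  by rewrite [X in _ <= X]exprMn ler_wpM2r ?sqr_ge0.
have -> : 2 * e * (8 * c) ^+ k * (M * c ^+ k) = (2 * e * M) * (8 * c * c) ^+ k by rewrite [(8 * c * c) ^+ k]exprMn; ring.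
rewrite -exprM mulnC exprM ler_wpM2l ?mulr_ge0 //.
by apply: lerXn2r; rewrite ?nnegrE ?sqr_ge0 ?mulr_ge0 // exprMn expr2; nra.
Qed.

(** The amplitude [2 * M * y ^+ (2 ^ J)] is adapted to the step: [2 * (2 * M * y ^+ (2 * n)) * M =
    (2 * M * y ^+ n) ^+ 2], so each step halves the exponent exactly. *)
Lemma pexp_chain (J : nat) f t a d M c (y : R) : (forall t, exists a, pexp f t a M c) ->
  pexp f t a M c -> `|d| * c <= 16^-1 -> 0 <= y ->
  (forall k, `|a k| <= 2 * M * y ^+ (2 ^ J) * (4 * c) ^+ k) -> `|f (t + d *+ J)| <= 2 * M * y.
Proof.
move=> hf + hd y0; elim: J t a => [|J IH] t a ha ay.
  by rewrite addr0 -(pexp_coef0 ha); have := ay 0%N; rewrite expr1 expr0 mulr1.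
have [b hb] := hf (t + d).
have M0 : 0 <= M by case: ha.
rewrite mulrS addrA; apply: (IH _ _ hb).
apply: (pexp_smooth_step ha hb ay hd); first by rewrite !mulr_ge0 // exprn_ge0.
rewrite expnS mulnC exprM expr2 [X in _ <= X]expr2 le_eqVlt; apply/orP; left; apply/eqP; ring.
Qed.

Lemma size_fibers (T : Type) (zs : seq T) (g : T -> nat) (J : nat) : all (fun z => g z < J)%N zs ->
  size zs = (\sum_(i < J) size [seq z <- zs | g z == i])%N.
Proof.
elim: zs => [|z zs IH] /=; first by rewrite big1.
case/andP => gz /IH ->.
rewrite (eq_bigr (fun i : 'I_J => (i == Ordinal gz) + size [seq z <- zs | g z == i]))%N.
  have E : (\sum_(i < J) (i == Ordinal gz) = 1)%N.
    by rewrite (bigD1 (Ordinal gz)) //= eqxx big1 // => i /negbTE ->.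
  by rewrite big_split /= E add1n.
by move=> i _; rewrite -val_eqE /= eq_sym; case: eqP.
Qed.

Lemma ln_pow_le (y b : R) m n : 0 < y -> 0 < b -> y ^+ m <= b ^+ n -> n%:R * - ln b <= m%:R * - ln y.
Proof.
move=> y0 b0 h; rewrite !mulrN lerN2 !mulr_natl -!lnXn //.
by rewrite ler_ln // posrE exprn_gt0.
Qed.

(** The zeros are distributed over the grid points [i / J], with [1 / J <= 1 / (16 * c)]. If [n] of
    them belong to one grid point, the Taylor coefficients there carry a factor [(5 / 8) ^+ n], and
    [J] steps of [pexp_chain] lead from that point to [s], where [f] is not small. As [J] depends on
    [c] only, so does [C]. *)
Lemma zero_count c : 0 < c -> exists2 C : R, 0 < C &
  forall f M (d s : R) (zs : seq R), (forall t, exists a, pexp f t a M c) ->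
  0 < d -> 0 <= s <= 1 -> d <= `|f s| -> uniq zs ->
  (forall z, z \in zs -> 0 <= z <= 1 /\ f z = 0) -> (size zs)%:R <= C * ln (4 * M / d).
Proof.
move=> c0.
pose J := (Num.truncn (16 * c)).+1.
have J0 : 0 < J%:R :> R by rewrite ltr0n.
have Jc : 16 * c <= J%:R by apply: ltW; exact: truncnS_gt.
have J16 : J%:R^-1 * c <= 16^-1 by rewrite mulrC ler_pdivrMr // mulrC -ler_pdivrMr ?invr_gt0 // invrK mulrC.
have l0 : 0 < ln (8 / 5 : R) by apply: ln_gt0; lra.
exists (J.+1%:R * (2 ^+ J / ln (8 / 5))); first by rewrite !mulr_gt0 ?ltr0n ?invr_gt0 // exprn_gt0.
move=> f M d s zs hf d0 /andP[s0 s1] ds uzs hz.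
have M0 : 0 < M.
  have [a ha] := hf s; have as_ := pexp_coef0 ha; case: ha => M0 _ ha _.
  by have := ha 0%N; rewrite as_ expr0 mulr1; lra.
pose g (z : R) := Num.truncn (z * J%:R).
have gP (z : R) : 0 <= z <= 1 -> (g z <= J)%N /\ `|z - (g z)%:R / J%:R| <= J%:R^-1.
  move=> /andP[z0 z1]; have zJ : 0 <= z * J%:R by rewrite mulr_ge0.
  have /andP[h1 h2] := truncn_itv zJ; rewrite -/(g z) in h1 h2; split.
    by rewrite -(ler_nat R); apply: le_trans h1 _; rewrite ler_piMl.
  have -> : z - (g z)%:R / J%:R = (z * J%:R - (g z)%:R) / J%:R by field; rewrite gt_eqF.
  rewrite normrM normfV (gtr0_norm J0) ler_piMl ?invr_ge0 ?ltW // ger0_norm ?subr_ge0 //.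
  by move: h2; rewrite -natr1; lra.
have Hi (i : 'I_J.+1) : (size [seq z <- zs | g z == i])%:R <= 2 ^+ J / ln (8 / 5) * ln (4 * M / d).
  set zi := [seq z <- zs | g z == i]; set n := size zi.
  pose t : R := i%:R / J%:R.
  have [a ha] := hf t.
  have t01 : 0 <= t <= 1.
    rewrite divr_ge0 //= ler_pdivrMr // mul1r ler_nat -ltnS //.
  have ak : forall k, `|a k| <= M * (5 / 8) ^+ n * (4 * c) ^+ k.
    rewrite /n -(size_map (fun z => z - t)); apply: (pexp_zeros ha).
      by rewrite map_inj_uniq ?filter_uniq // => x y /addIr.
    move=> _ /mapP[z + ->]; rewrite mem_filter => /andP[/eqP gz /hz [z01 fz]].
    have -> : t + (z - t) = z by ring.
    split=> //.
    have [_] := gP z z01; rewrite gz -/t => h.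
    by apply: le_trans J16; rewrite ler_wpM2r // ltW.
  (* With this [y] the chain would end in [2 * M * y = d / 2], below the lower bound [d] at [s]. *)
  pose y := d / (4 * M).
  have y0 : 0 < y by rewrite divr_gt0 // mulr_gt0.
  have key : y ^+ (2 ^ J) <= (5 / 8) ^+ n.
    rewrite leNgt; apply/negP => lt.
    have : `|f (t + ((s - t) / J%:R) *+ J)| <= 2 * M * y.
      apply: (pexp_chain hf ha) => //; last 2 first.
      - exact: ltW.
      - move=> k; apply: le_trans (ak k) _; rewrite ler_wpM2r ?exprn_ge0 ?mulr_ge0 ?(ltW c0) //.
        have p : 0 <= y ^+ (2 ^ J) by rewrite exprn_ge0 // ltW.
        have -> : 2 * M * y ^+ (2 ^ J) = M * (2 * y ^+ (2 ^ J)) by ring.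
        by rewrite ler_wpM2l ?(ltW M0) //; lra.
      apply: le_trans J16; rewrite ler_wpM2r ?(ltW c0) // normrM normfV (gtr0_norm J0).
      rewrite ler_piMl ?invr_ge0 ?(ltW J0) // ler_norml; lra.
    rewrite -mulr_natr divfK ?gt_eqF // addrC subrK.
    have -> : 2 * M * y = d / 2 by rewrite /y; field; rewrite gt_eqF.
    lra.
  have p58 : 0 < (5 / 8 : R) by rewrite divr_gt0.
  have := ln_pow_le y0 p58 key.
  have -> : - ln y = ln (4 * M / d) by rewrite /y -lnV ?posrE ?invf_div // divr_gt0 // mulr_gt0.
  have -> : - ln (5 / 8 : R) = ln (8 / 5) by rewrite -lnV ?posrE ?invf_div // divr_gt0.
  rewrite natrX [X in _ -> _ <= X]mulrAC ler_pdivlMr //.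
rewrite (@size_fibers _ zs g J.+1); last by apply/allP => z /hz [/gP[]].
rewrite natr_sum -[X in _ <= X]mulrA; apply: le_trans (ler_sum _ (fun i _ => Hi i)) _.
by rewrite sumr_const card_ord -[X in X <= _]mulr_natl.
Qed.

End Analytic.

(** * Integrals over a period *)

Section Integral.
Context {R : realType}.
Local Notation mu := (@lebesgue_measure R).

Definition int01 (f : R -> R) : R := (\int[mu]_(t in `[0%R, 1%R]) f t)%R.

(** Boundedness and measurability are demanded on the whole space: the class is then stable under
    algebra, sections and products, and all integrability and Fubini conditions reduce to it. *)
Definition bm d (T : measurableType d) (f : T -> R) : Prop :=
  measurable_fun setT f /\ exists M, forall x, `|f x| <= M.

Lemma bm_cst d (T : measurableType d) (k : R) : bm (fun _ : T => k).
Proof. by split; [exact: measurable_cst|exists `|k|]. Qed.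

Lemma bmD d (T : measurableType d) (f g : T -> R) : bm f -> bm g -> bm (fun x => f x + g x).
Proof.
move=> [mf [M hM]] [mg [M' hM']]; split; first exact: measurable_funD.
by exists (M + M') => x; rewrite (le_trans (ler_normD _ _)) // lerD.
Qed.

Lemma bmM d (T : measurableType d) (f g : T -> R) : bm f -> bm g -> bm (fun x => f x * g x).
Proof.
move=> [mf [M hM]] [mg [M' hM']]; split; first exact: measurable_funM.
by exists (M * M') => x; rewrite normrM ler_pM.
Qed.

Lemma bmZ d (T : measurableType d) (k : R) (f : T -> R) : bm f -> bm (fun x => k * f x).
Proof. by move=> bf; apply: bmM => //; exact: bm_cst. Qed.

Lemma bmN d (T : measurableType d) (f : T -> R) : bm f -> bm (fun x => - f x).
Proof. by move=> /(bmZ (-1)); under eq_fun do rewrite mulN1r. Qed.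

Lemma bmB d (T : measurableType d) (f g : T -> R) : bm f -> bm g -> bm (fun x => f x - g x).
Proof. by move=> bf bg; apply: bmD => //; exact: bmN. Qed.

Lemma bm_comp d d' (T : measurableType d) (T' : measurableType d') (f : T -> R) (g : T' -> T) :
  bm f -> measurable_fun setT g -> bm (fun x => f (g x)).
Proof.
move=> [mf [M hM]] mg; split; first exact: measurableT_comp.
by exists M.
Qed.

Lemma bm_fst d d' (T : measurableType d) (T' : measurableType d') (f : T -> R) :
  bm f -> bm (fun x : T * T' => f x.1).
Proof. by move=> bf; apply: bm_comp => //; exact: measurable_fst. Qed.

Lemma bm_snd d d' (T : measurableType d) (T' : measurableType d') (f : T' -> R) :
  bm f -> bm (fun x : T * T' => f x.2).
Proof. by move=> bf; apply: bm_comp => //; exact: measurable_snd. Qed.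

Lemma bm_sect1 d d' (T : measurableType d) (T' : measurableType d') (f : T * T' -> R) x :
  bm f -> bm (fun y => f (x, y)).
Proof. by move=> bf; apply: bm_comp => //; exact: pair1_measurable. Qed.

Lemma bm_sect2 d d' (T : measurableType d) (T' : measurableType d') (f : T * T' -> R) y :
  bm f -> bm (fun x => f (x, y)).
Proof. by move=> bf; apply: bm_comp => //; exact: pair2_measurable. Qed.

Lemma bm_swap d d' (T : measurableType d) (T' : measurableType d') (f : T * T' -> R) :
  bm f -> bm (fun p : T' * T => f (p.2, p.1)).
Proof. by move=> bf; apply: (bm_comp bf); exact: measurable_swap. Qed.

Lemma bm_cont (f : R -> R) : continuous f -> (exists M, forall x, `|f x| <= M) -> bm f.
Proof. by move=> cf bf; split => //; exact: continuous_measurable_fun. Qed.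

Lemma bm_integrable (f : R -> R) : bm f -> mu.-integrable `[0%R, 1%R]%classic (EFin \o f).
Proof.
move=> [mf [M hM]]; apply: measurable_bounded_integrable => //=.
- by rewrite lebesgue_measure_itv /= lte_fin ltr01 -EFinB ltry.
- exact: measurable_funTS.
- exists M; split; rewrite ?num_real // => x xM y _.
  by apply: le_trans (hM y) _; exact: ltW.
Qed.

Lemma mu01 : fine (mu `[0%R, 1%R]%classic) = 1.
Proof. by rewrite lebesgue_measure_itv /= lte_fin ltr01 /= oppr0 addr0. Qed.

Lemma int01_eq (f g : R -> R) : (forall t, 0 <= t <= 1 -> f t = g t) -> int01 f = int01 g.
Proof. by move=> fg; apply: eq_Rintegral => t; rewrite inE /= in_itv /= => /fg. Qed.

Lemma int01_except (f g : R -> R) (p q : R) : bm f -> bm g ->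
  (forall t, 0 <= t <= 1 -> t != p -> t != q -> f t = g t) -> int01 f = int01 g.
Proof.
move=> [mf _] [mg _] fg; congr fine; apply: ae_eq_integral => //=.
- by apply/measurable_EFinP; exact: measurable_funTS.
- by apply/measurable_EFinP; exact: measurable_funTS.
exists [set p; q]; split.
- by apply: measurableU; exact: measurable_set1.
- by apply: countable_lebesgue_measure0; apply: finite_set_countable; exact: finite_set2.
move=> t /=; apply: contra_notP => /not_orP[tp tq]; rewrite in_itv /= => t01.
by congr EFin; apply: fg => //; apply/eqP.
Qed.

Lemma int01D (f g : R -> R) : bm f -> bm g -> int01 (fun t => f t + g t) = int01 f + int01 g.
Proof. by move=> bf bg; apply: RintegralD => //; exact: bm_integrable. Qed.

Lemma int01B (f g : R -> R) : bm f -> bm g -> int01 (fun t => f t - g t) = int01 f - int01 g.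
Proof. by move=> bf bg; apply: RintegralB => //; exact: bm_integrable. Qed.

Lemma int01Z (k : R) (f : R -> R) : bm f -> int01 (fun t => k * f t) = k * int01 f.
Proof. by move=> bf; apply: RintegralZl => //; exact: bm_integrable. Qed.

Lemma int01N (f : R -> R) : bm f -> int01 (fun t => - f t) = - int01 f.
Proof. by move=> bf; rewrite -mulN1r -int01Z //; apply: int01_eq => t _; rewrite mulN1r. Qed.

Lemma int01_cst (k : R) : int01 (fun=> k) = k.
Proof. by rewrite /int01 Rintegral_cst // mu01 mulr1. Qed.

Lemma int01_le (f g : R -> R) : bm f -> bm g ->
  (forall t, 0 <= t <= 1 -> f t <= g t) -> int01 f <= int01 g.
Proof.
move=> bf bg fg; apply: le_Rintegral => //; try exact: bm_integrable.
Qed.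

Lemma int01_bnd (f : R -> R) M : bm f -> (forall t, 0 <= t <= 1 -> `|f t| <= M) -> `|int01 f| <= M.
Proof.
move=> bf fM; rewrite ler_norml; apply/andP; split.
  rewrite -(int01_cst (- M)); apply: int01_le => //; first exact: bm_cst.
  by move=> t /fM; rewrite ler_norml => /andP[].
rewrite -(int01_cst M); apply: int01_le => //; first exact: bm_cst.
by move=> t /fM; rewrite ler_norml => /andP[].
Qed.

Lemma int01_dct (F : nat -> R -> R) (f : R -> R) M :
  (forall n, bm (F n)) -> bm f -> (forall n t, 0 <= t <= 1 -> `|F n t| <= M) ->
  (forall t, 0 <= t <= 1 -> (fun n => F n t) @ \oo --> f t) ->
  (fun n => int01 (F n)) @ \oo --> int01 f.
Proof.
move=> bF bf FM Ff.
have [] := @dominated_convergence _ _ R mu `[0%R, 1%R]%classic _ (fun n t => (F n t)%:E)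
  (fun t => (f t)%:E) (fun=> M%:E).
- by [].
- by move=> n; apply/measurable_EFinP; apply: measurable_funTS; case: (bF n).
- by apply/measurable_EFinP; apply: measurable_funTS; case: bf.
- apply: aeW => t /=; rewrite in_itv /= => t01.
  by apply: cvg_EFin; [exact: nearW|exact: Ff].
- exact: (bm_integrable (bm_cst _ M)).
- by apply: aeW => t /= n; rewrite in_itv /= => t01; rewrite lee_fin FM.
move=> _ _ cv; apply: fine_cvg.
rewrite /int01 /Rintegral fineK //.
exact: (@integrable_fin_num _ _ _ mu `[0%R, 1%R]%classic _ _ (bm_integrable bf)).
Qed.

Lemma int01_E (f : R -> R) : bm f -> (\int[mu]_(t in `[0%R, 1%R]) (f t)%:E)%E = (int01 f)%:E.
Proof.
move=> bf; rewrite /int01 /Rintegral fineK //.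
exact: (@integrable_fin_num _ _ _ mu `[0%R, 1%R]%classic _ _ (bm_integrable bf)).
Qed.

Let D1 : set R := `[0%R, 1%R]%classic.

Lemma int01_indic (f : R -> R) : bm f -> (\int[mu]_t (f t * \1_D1 t)%:E)%E = (int01 f)%:E.
Proof.
move=> bf; rewrite -int01_E // [RHS]integral_mkcond; apply: eq_integral => t _.
by rewrite /patch indicE; case: ifP => _; rewrite ?mulr1 ?mulr0.
Qed.

Lemma bm_indic01 : bm (\1_D1 : R -> R).
Proof.
split; first by apply/measurable_indicP; exact: measurable_itv.
by exists 1 => x; rewrite indicE; case: (_ \in _); rewrite ?normr1 ?normr0.
Qed.

Let ind2 (F : R * R -> R) (p : R * R) : R := F p * \1_D1 p.1 * \1_D1 p.2.

Let ind2_integrable (F : R * R -> R) : bm F -> (mu \x mu)%E.-integrable setT (EFin \o ind2 F).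
Proof.
move=> [mF [M hM]].
have mD : measurable (D1 `*` D1) by apply: measurableX; exact: measurable_itv.
have -> : EFin \o ind2 F = (EFin \o F) \_ (D1 `*` D1).
  apply/funext => -[x y]; rewrite /patch in_setX /= /ind2 !indicE /=.
  by case: (x \in _); case: (y \in _); rewrite /= ?mulr1 ?mulr0.
have Q := @integrable_mkcond _ _ R (mu \x mu)%E (D1 `*` D1) (EFin \o F) mD.
apply/Q.
apply: measurable_bounded_integrable.
- exact: mD.
- have e : ((mu \x mu) (D1 `*` D1) = 1%:E)%E.
    rewrite (product_measure1E mu mu (measurable_itv _) (measurable_itv _)).
    have m1 : mu D1 = 1%:E by rewrite /D1 lebesgue_measure_itv /= lte_fin ltr01 -EFinB subr0.
    transitivity (1%:E * 1%:E : \bar R)%E; last by rewrite -EFinM mulr1.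
    exact: (f_equal2 (fun a b : \bar R => a * b)%E m1 m1).
  exact: (eq_ind_r (fun z : \bar R => (z < +oo)%E) (ltry 1) e).
- exact: measurable_funTS.
- exists M; split; rewrite ?num_real // => x xM y _.
  by apply: le_trans (hM y) _; exact: ltW.
Qed.

Lemma bm_int01 (F : R * R -> R) : bm F -> bm (fun x => int01 (fun y => F (x, y))).
Proof.
move=> bF; case: (bF) => _ [M hM]; split; last first.
  by exists M => x; apply: int01_bnd => //; exact: bm_sect1.
(* Tonelli's measurability statement is for nonnegative integrands, hence the shift by [M]. *)
have bFM : bm (fun p => F p + M) by apply: bmD => //; exact: bm_cst.
have E x : int01 (fun y => F (x, y)) = fine (\int[mu]_y ((F (x, y) + M) * \1_D1 y)%:E)%E - M.
  rewrite int01_indic; last exact: (bm_sect1 x bFM).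
  rewrite /= int01D ?int01_cst ?addrK //; [exact: bm_sect1|exact: bm_cst].
under eq_fun do rewrite E.
apply: measurable_funB => //; apply: measurableT_comp => //.
apply: (@measurable_fun_fubini_tonelli_F _ _ _ _ R mu (fun p => ((F p + M) * \1_D1 p.2)%:E)).
  apply/measurable_EFinP.
  have [] // : bm (fun p : R * R => (F p + M) * \1_D1 p.2).
  by apply: bmM => //; apply: bm_snd; exact: bm_indic01.
move=> p; rewrite lee_fin mulr_ge0 //.
by have := hM p; rewrite ler_norml => /andP[]; lra.
Qed.

Lemma int01_fubini (F : R * R -> R) : bm F ->
  int01 (fun x => int01 (fun y => F (x, y))) = int01 (fun y => int01 (fun x => F (x, y))).
Proof.
move=> bF.
have e1 : (\int[mu]_x \int[mu]_y (ind2 F (x, y))%:E)%E = (int01 (fun x => int01 (fun y => F (x, y))))%:E.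
  rewrite -(int01_indic (bm_int01 bF)); apply: eq_integral => x _.
  transitivity (\int[mu]_y ((F (x, y) * \1_D1 x) * \1_D1 y)%:E)%E => //.
  rewrite int01_indic; last by apply: bmM; [exact: bm_sect1|exact: bm_cst].
  congr EFin; rewrite [RHS]mulrC -int01Z; last exact: bm_sect1.
  by apply: int01_eq => t _; exact: mulrC.
have e2 : (\int[mu]_y \int[mu]_x (ind2 F (x, y))%:E)%E = (int01 (fun y => int01 (fun x => F (x, y))))%:E.
  rewrite -(int01_indic (bm_int01 (bm_swap bF))); apply: eq_integral => y _.
  transitivity (\int[mu]_x ((F (x, y) * \1_D1 y) * \1_D1 x)%:E)%E.
    by apply: eq_integral => x _; rewrite /ind2 /= mulrAC.
  rewrite int01_indic; last by apply: bmM; [exact: bm_sect2|exact: bm_cst].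
  congr EFin; rewrite [RHS]mulrC -int01Z; last exact: (bm_sect2 y bF).
  by apply: int01_eq => t _; exact: mulrC.
have h := @Fubini _ _ _ _ R mu mu _ (ind2_integrable bF).
have : (int01 (fun x => int01 (fun y => F (x, y))))%:E = (int01 (fun y => int01 (fun x => F (x, y))))%:E.
  by rewrite -e1 -e2; exact: h.
by move=> [].
Qed.

(** The total inverse, with value 0 at 0, is the pointwise limit of the continuous functions
    [x / (x ^+ 2 + n.+1%:R^-1)]. Quotients are thus measurable together with their default values on
    the diagonal. *)
Lemma measurable_fun_inv d (T : measurableType d) (f : T -> R) : measurable_fun setT f ->
  measurable_fun setT (fun x => (f x)^-1).
Proof.
move=> mf; apply: (@measurableT_comp _ _ _ _ _ _ (fun x : R => x^-1)) => //.
apply: (@measurable_fun_cvg _ R R setT (fun n (x : R) => x / (x ^+ 2 + n.+1%:R^-1)) (fun x => x^-1)).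
  move=> n; apply: continuous_measurable_fun => x.
  apply: cvgM; first exact: cvg_id.
  apply: cvgV; first by rewrite gt_eqF // ltr_wpDl ?sqr_ge0 // invr_gt0 ltr0n.
  by apply: cvgD; [exact: exprn_continuous|exact: cvg_cst].
move=> x _; have [->|x0] := eqVneq x 0.
  by rewrite invr0; under eq_fun do rewrite mul0r; exact: cvg_cst.
rewrite (_ : x^-1 = x / (x ^+ 2 + 0)); last by field.
apply: cvgM; first exact: cvg_cst.
apply: cvgV; first by rewrite addr0 sqrf_eq0.
by apply: cvgD; [exact: cvg_cst|exact: cvg_harmonic].
Qed.

Lemma FTC_itv (F f : R -> R) (a b : R) : a < b -> (forall x, is_derive x (1 : R) F (f x)) ->
  continuous f -> (\int[mu]_(t in `[a, b]) f t)%R = F b - F a.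
Proof.
move=> ab dF cf.
have dF' x : derivable F x 1 by have := dF x; case.
rewrite /Rintegral (@continuous_FTC2 _ f F a b ab) //.
- by apply: continuous_subspaceT => x; exact: cf.
- split.
  + by move=> x _; exact: dF'.
  + by apply: cvg_at_right_filter; apply: differentiable_continuous; apply/derivable1_diffP.
  + by apply: cvg_at_left_filter; apply: differentiable_continuous; apply/derivable1_diffP.
- by move=> x _; rewrite derive1E; apply: derive_val.
Qed.

Lemma FTC01 (F f : R -> R) : (forall x, is_derive x (1 : R) F (f x)) ->
  continuous f -> int01 f = F 1 - F 0.
Proof. by move=> dF cf; apply: FTC_itv. Qed.

End Integral.

(** * Analytic closed curves and the double layer kernel *)

Ltac pos := repeat first
  [ done | exact: normr_ge0 | exact: sqr_ge0 | apply: mulr_ge0 | apply: addr_ge0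
  | apply: exprn_ge0 | (rewrite invr_ge0) | lra | (apply: ltW; assumption) ].

Lemma norm_sqr_le (R : realType) (a b : R) : `|a| <= b -> a ^+ 2 <= b ^+ 2.
Proof.
by move=> h; rewrite -[a ^+ 2]real_normK ?num_real // lerXn2r ?nnegrE // (le_trans _ h).
Qed.

Section UniformAnalytic.
Context {R : realType}.
Implicit Types (f g : R -> R) (t h B : R).

(* One constant serves as the bound and as the inverse radius. *)
Definition uan f B : Prop := 1 <= B /\ forall t, exists a, pexp f t a B B.

Lemma uan_le f B B' : uan f B -> B <= B' -> uan f B'.
Proof.
move=> [B1 hf] BB; split; first lra.
by move=> t; have [a ha] := hf t; exists a; exact: pexp_le ha _ _.
Qed.

Lemma uan_bnd f B t : uan f B -> `|f t| <= B.
Proof.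
move=> [B1 /(_ t)[a ha]]; rewrite -(pexp_coef0 ha); case: ha => _ _ /(_ 0%N) + _.
by rewrite expr0 mulr1.
Qed.

(** Valid for all [h]: outside the radius the trivial bound [2 * B] suffices, because
    [|h| * B > 1 / 2] there. *)
Lemma uan_lip f B t h : uan f B -> `|f (t + h) - f t| <= 12 * B ^+ 2 * `|h|.
Proof.
move=> uf; have [B1 /(_ t)[a ha]] := uf.
have [hB|hB] := leP (`|h| * B) 2^-1.
  have := pexp_lip (h' := 0) ha hB; rewrite normr0 mul0r addr0 subr0 => H.
  by apply: le_trans (H _) _; [lra|rewrite le_eqVlt; apply/orP; left; apply/eqP; ring].
apply: le_trans (ler_normB _ _) _.
have := uan_bnd (t + h) uf; have := uan_bnd t uf.
have -> : 12 * B ^+ 2 * `|h| = 12 * B * (`|h| * B) by ring.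
have : 12 * B * 2^-1 <= 12 * B * (`|h| * B) by rewrite ler_wpM2l ?mulr_ge0 //; lra.
lra.
Qed.

Lemma uan_derive f B t : uan f B -> is_derive t (1 : R) f (derive1 f t).
Proof.
move=> [B1 /(_ t)[a ha]]; have D := pexp_is_derive ha.
by rewrite derive1E (@derive_val _ _ _ _ _ _ _ D).
Qed.

Lemma uan_coef1 f t a M c : pexp f t a M c -> derive1 f t = a 1%N.
Proof. by move=> /pexp_is_derive D; rewrite derive1E; apply: derive_val. Qed.

Lemma uan_dbnd f B t : uan f B -> `|derive1 f t| <= B ^+ 2.
Proof.
by move=> [B1 /(_ t)[a ha]]; rewrite (uan_coef1 ha); case: ha => _ _ /(_ 1%N).
Qed.

Lemma uan_taylor f B t h : uan f B -> `|f (t + h) - f t - h * derive1 f t| <= 10 * B ^+ 3 * h ^+ 2.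
Proof.
move=> uf; have [B1 /(_ t)[a ha]] := uf.
have B0 : 0 <= B by lra.
have h2 : `|h| ^+ 2 = h ^+ 2 by rewrite real_normK ?num_real.
have [hB|hB] := leP (`|h| * B) 2^-1.
  rewrite (uan_coef1 ha) -(pexp_coef0 ha); have := ha => -[_ _ _ /(_ h 2%N hB)].
  rewrite !psumS psum0 add0r expr0 mulr1 expr1 opprD addrA [h * _]mulrC => H.
  apply: le_trans H _; rewrite exprMn h2.
  have -> : 2 * B * (h ^+ 2 * B ^+ 2) = 2 * (B ^+ 3 * h ^+ 2) by ring.
  have : 0 <= B ^+ 3 * h ^+ 2 by rewrite mulr_ge0 ?sqr_ge0 // exprn_ge0.
  lra.
have h1 := uan_bnd (t + h) uf; have h3 := uan_bnd t uf; have h4 := uan_dbnd t uf.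
apply: le_trans (ler_normB _ _) _; rewrite normrM.
have h5 := ler_normB (f (t + h)) (f t).
have h6 : `|h| * `|derive1 f t| <= `|h| * B ^+ 2 by rewrite ler_wpM2l.
rewrite -h2; set u := `|h| * B in hB.
have -> : 10 * B ^+ 3 * `|h| ^+ 2 = 10 * B * u ^+ 2 by rewrite /u; ring.
have e6 : `|h| * B ^+ 2 = B * u by rewrite /u; ring.
rewrite e6 in h6.
apply: le_trans (_ : 2 * B + B * u <= _); first lra.
have -> : 2 * B + B * u = B * (2 + u) by ring.
have -> : 10 * B * u ^+ 2 = B * (10 * u ^+ 2) by ring.
by rewrite ler_wpM2l //; nra.
Qed.

(** Add the Taylor estimates from [t] to [t + h] and back. *)
Lemma uan_dlip f B t h : uan f B -> `|derive1 f (t + h) - derive1 f t| <= 20 * B ^+ 3 * `|h|.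
Proof.
move=> uf; have h1 := uan_taylor t h uf; have h2 := uan_taylor (t + h) (- h) uf.
rewrite addrK sqrrN in h2.
have [->|h0] := eqVneq h 0; first by rewrite addr0 subrr normr0 mulr0.
have hp : 0 < `|h| by rewrite normr_gt0.
rewrite -(ler_pM2l hp) -normrM.
have -> : h * (derive1 f (t + h) - derive1 f t) =
  (f t - f (t + h) - - h * derive1 f (t + h)) + (f (t + h) - f t - h * derive1 f t) by ring.
apply: le_trans (ler_normD _ _) _.
have -> : `|h| * (20 * B ^+ 3 * `|h|) = 20 * B ^+ 3 * h ^+ 2.
  by rewrite -[h ^+ 2]real_normK ?num_real //; ring.
lra.
Qed.

Lemma lip_continuous f (L : R) : (forall t h, `|f (t + h) - f t| <= L * `|h|) -> continuous f.
Proof.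
move=> H t; apply/cvgrPdist_le => e e0.
have L0 : 0 < `|L| + 1 by have := normr_ge0 L; lra.
near=> x.
have -> : x = t + (x - t) by ring.
rewrite distrC; apply: le_trans (H _ _) _.
apply: le_trans (_ : (`|L| + 1) * `|x - t| <= _).
  by rewrite ler_wpM2r //; have := ler_norm L; lra.
rewrite mulrC -ler_pdivlMr // distrC.
near: x; apply: cvgr_dist_le; rewrite ?divr_gt0 //; exact: cvg_id.
Unshelve. all: by end_near. Qed.

Lemma uan_continuous f B : uan f B -> continuous f.
Proof. by move=> uf; apply: lip_continuous => t h; exact: uan_lip uf. Qed.

Lemma uan_dcontinuous f B : uan f B -> continuous (derive1 f).
Proof. by move=> uf; apply: lip_continuous => t h; exact: uan_dlip uf. Qed.

Lemma uan_bm f B : uan f B -> bm f.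
Proof.
move=> uf; apply: bm_cont; first exact: uan_continuous uf.
by exists B => t; exact: uan_bnd uf.
Qed.

Lemma uan_dbm f B : uan f B -> bm (derive1 f).
Proof.
move=> uf; apply: bm_cont; first exact: uan_dcontinuous uf.
by exists (B ^+ 2) => t; exact: uan_dbnd uf.
Qed.

Lemma uan_dperiodic f B : uan f B -> (forall t, f (t + 1) = f t) -> forall t, derive1 f (t + 1) = derive1 f t.
Proof.
move=> [B1 uf] fp t; have [a ha] := uf (t + 1).
rewrite (uan_coef1 ha) -(uan_coef1 (pexp_shift ha)).
by congr (derive1 _ t); apply/funext => z; rewrite fp.
Qed.

Lemma uan_intro f : real_analytic f -> (forall t, f (t + 1) = f t) -> exists B, uan f B.
Proof.
move=> fa fp; have [B hB] := real_analytic_uniform fa fp.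
exists (Num.max 1 B); split; first by rewrite le_max lexx.
by move=> t; have [a ha] := hB t; exists a; apply: pexp_le ha _ _; rewrite le_max lexx orbT.
Qed.

End UniformAnalytic.

(** * Closed curves with a chord-arc bound, and local expansions of the kernel *)

Section Curve.
Context {R : realType}.
Implicit Types (x y : R -> R) (t h B m : R).

(** The field [cv_far] combines regularity, for small [h], with injectivity modulo the period;
    offsets with [|h| <= 1 / 2] reach every point of the curve. *)
Record curve x y B m : Prop := Curve {
  cv_x : uan x B;
  cv_y : uan y B;
  cv_px : forall t, x (t + 1) = x t;
  cv_py : forall t, y (t + 1) = y t;
  cv_m : 0 < m;
  cv_far : forall t h, `|h| <= 2^-1 -> m * h ^+ 2 <= (x (t + h) - x t) ^+ 2 + (y (t + h) - y t) ^+ 2 }.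

Lemma sqr_dist_le (a b e : R) : `|a - b| <= e -> b ^+ 2 / 2 - e ^+ 2 <= a ^+ 2.
Proof.
move=> h; have e0 : 0 <= e by apply: le_trans h.
have : (a - b) ^+ 2 <= e ^+ 2.
  by rewrite -[(a - b) ^+ 2]real_normK ?num_real // lerXn2r ?nnegrE.
have := sqr_ge0 (2 * a - b); nra.
Qed.

Lemma quad_bound (H p q V r r' F : R) : 0 <= H -> 0 <= V -> p / 2 - r' <= q -> r' <= 400 * (V / 6400) ->
  H * q / 2 - r <= F -> r <= H * (100 * (V / 6400)) -> H * (p / 4 - V / 16) <= F.
Proof.
move=> H0 V0 h1 h2 h3 h4.
have h5 : H * (p / 2 - V / 16) <= H * q by rewrite ler_wpM2l //; clear - h1 h2 V0; lra.
have h6 := mulr_ge0 H0 V0.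
clear - h3 h4 h5 h6; lra.
Qed.

Lemma circle_inj x y s t : (forall t, x (t + 1) = x t) -> (forall t, y (t + 1) = y t) ->
  (forall s t, 0 <= s < 1 -> 0 <= t < 1 -> x s = x t -> y s = y t -> s = t) ->
  `|s - t| < 1 -> x s = x t -> y s = y t -> s = t.
Proof.
move=> px py inj st xst yst.
have [n [n0 n1]] : exists n : int, 0 <= t - n%:~R /\ t - n%:~R < 1.
  exists (Num.floor t); have := floor_le t; have := floorD1_gt t; rewrite intrD; lra.
have E (f : R -> R) u : (forall t, f (t + 1) = f t) -> f (u - n%:~R) = f u.
  by move=> pf; rewrite -(periodic_int (u - n%:~R) n pf) subrK.
set t' := t - n%:~R in n0 n1; set s' := s - n%:~R.
suff: s' = t' by rewrite /s' /t' => /addIr.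
have st' : `|s' - t'| < 1 by rewrite (_ : s' - t' = s - t) // /s' /t'; ring.
have xs' : x s' = x t' by rewrite !E.
have ys' : y s' = y t' by rewrite !E.
move: st'; rewrite ltr_norml => /andP[h1 h2].
have [s0|s0] := ltP s' 0.
  have : s' + 1 = t' by apply: inj; [lra|lra|rewrite px|rewrite py].
  lra.
have [s1|s1] := leP 1 s'; last by apply: inj => //; lra.
have : s' - 1 = t'.
  by apply: inj; [lra|lra|rewrite -[LHS]px subrK|rewrite -[LHS]py subrK].
lra.
Qed.

(** Compactness applied to the ratio of [h ^+ 2] and the squared chord, in [h] near a fixed [t0] and
    then in [t]. Near [h = 0] the ratio is controlled by Taylor expansion and the nonzero speed,
    elsewhere by continuity of the positive chord. *)
Lemma curve_far x y B : uan x B -> uan y B -> (forall t, x (t + 1) = x t) -> (forall t, y (t + 1) = y t) ->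
  (forall t, 0 < derive1 x t ^+ 2 + derive1 y t ^+ 2) ->
  (forall s t, 0 <= s < 1 -> 0 <= t < 1 -> x s = x t -> y s = y t -> s = t) ->
  exists m, curve x y B m.
Proof.
move=> ux uy px py reg inj.
have [B1 _] := ux.
have B0 : 0 < B by lra.
pose D t h := (x (t + h) - x t) ^+ 2 + (y (t + h) - y t) ^+ 2.
have D0 t h : `|h| < 1 -> h != 0 -> 0 < D t h.
  move=> h1 h0; rewrite lt_neqAle addr_ge0 ?sqr_ge0 // andbT eq_sym.
  rewrite paddr_eq0 ?sqr_ge0 // !sqrf_eq0 !subr_eq0; apply/negP => /andP[/eqP xx /eqP yy].
  have : t + h = t by apply: (@circle_inj x y) => //; rewrite addrAC subrr add0r.
  by rewrite -[RHS]addr0 => /addrI /eqP; rewrite (negbTE h0).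
pose L := 12 * B ^+ 2.
have L0 : 0 < L by rewrite mulr_gt0 // exprn_gt0.
have [A hA] : exists A, forall t, 0 <= t <= 1 -> 0 < A /\ forall h, `|h| <= 2^-1 -> h ^+ 2 <= A * D t h.
  apply: (@segment_uniform _ (fun A t => 0 < A /\ forall h, `|h| <= 2^-1 -> h ^+ 2 <= A * D t h)) => t0 _.
  have [A hA] : exists A, forall h, - 2^-1 <= h <= 2^-1 -> 0 < A /\ forall t, `|t - t0| <= A^-1 -> h ^+ 2 <= A * D t h.
    apply: (@segment_uniform _ (fun A h => 0 < A /\ forall t, `|t - t0| <= A^-1 -> h ^+ 2 <= A * D t h)) => h0.
    move=> /andP[hl hr].
    have [->|h00] := eqVneq h0 0.
      pose V := derive1 x t0 ^+ 2 + derive1 y t0 ^+ 2.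
      have V0 : 0 < V by exact: reg.
      (* Within distance [e] the Taylor and Lipschitz errors, of order [B ^+ 3 * e], are small
         against the speed: [(B ^+ 3 * e) ^+ 2 = V / 6400]. *)
      pose e := Num.sqrt V / (80 * B ^+ 3).
      have B3 : 0 < B ^+ 3 by rewrite exprn_gt0.
      have e0 : 0 < e by rewrite divr_gt0 ?sqrtr_gt0 // mulr_gt0.
      have e2 : (B ^+ 3 * e) ^+ 2 = V / 6400.
        have -> : B ^+ 3 * e = Num.sqrt V / 80 by rewrite /e; field; rewrite gt_eqF.
        by rewrite expr_div_n sqr_sqrtr ?ltW //; field.
      exists e, (Num.max e^-1 (8 / V)); split=> // h A hh; rewrite ge_max => /andP[A1 A2].
      have A0 : 0 < A by apply: lt_le_trans A1; rewrite invr_gt0.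
      split=> // t ht.
      have te : `|t - t0| <= e.
        by apply: le_trans ht _; rewrite -[e]invrK lef_pV2 // posrE ?invr_gt0.
      rewrite subr0 in hh.
      have key f : uan f B -> h ^+ 2 * (derive1 f t0 ^+ 2 / 4 - V / 16) <= (f (t + h) - f t) ^+ 2.
        move=> uf.
        have h1 := uan_taylor t h uf; have h2 := uan_dlip t0 (t - t0) uf.
        rewrite (_ : t0 + (t - t0) = t) in h2; last by ring.
        have h3 := sqr_dist_le h1; have h4 := sqr_dist_le h2.
        have h5 : (20 * B ^+ 3 * `|t - t0|) ^+ 2 <= 400 * (V / 6400).
          rewrite -e2 -[400](_ : 20 ^+ 2 = _); last by ring.
          have q : 20 * B ^+ 3 * `|t - t0| <= 20 * (B ^+ 3 * e).
            by rewrite -mulrA ler_wpM2l // ler_wpM2l // ltW.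
          by rewrite -exprMn; apply: norm_sqr_le; rewrite ger0_norm // mulr_ge0 // mulr_ge0 // ltW.
        have h6 : (10 * B ^+ 3 * h ^+ 2) ^+ 2 <= h ^+ 2 * (100 * (V / 6400)).
          have -> : (10 * B ^+ 3 * h ^+ 2) ^+ 2 = h ^+ 2 * (100 * (B ^+ 3 * `|h|) ^+ 2).
            by rewrite [(B ^+ 3 * `|h|) ^+ 2]exprMn real_normK ?num_real //; ring.
          rewrite ler_wpM2l ?sqr_ge0 // ler_wpM2l // -e2; apply: norm_sqr_le.
          by rewrite ger0_norm; [rewrite ler_wpM2l // ltW|exact: mulr_ge0 (ltW B3) (normr_ge0 h)].
        rewrite exprMn in h3.
        exact: (quad_bound (sqr_ge0 h) (ltW V0) h4 h5 h3 h6).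
      have kx := key x ux; have ky := key y uy.
      have kD : h ^+ 2 * (V / 8) <= D t h.
        have -> : h ^+ 2 * (V / 8) = h ^+ 2 * (derive1 x t0 ^+ 2 / 4 - V / 16) + h ^+ 2 * (derive1 y t0 ^+ 2 / 4 - V / 16).
          by rewrite /V; field.
        exact: lerD.
      apply: le_trans (_ : (8 / V) * D t h <= _).
        have := ler_wpM2l (ltW (divr_gt0 (ltr0n R 8) V0)) kD.
        suff -> : 8 / V * (h ^+ 2 * (V / 8)) = h ^+ 2 by [].
        by field; rewrite gt_eqF.
      by rewrite ler_wpM2r // addr_ge0 ?sqr_ge0.
    have d0 : 0 < D t0 h0 by apply: D0 => //; rewrite ltr_norml; lra.
    (* Moving [t] and [h] by at most [e] changes each coordinate difference by at most [3 * L * e],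
       a third of the chord at [(t0, h0)]. *)
    pose e := Num.sqrt (D t0 h0) / (9 * L).
    have e0 : 0 < e by rewrite divr_gt0 ?sqrtr_gt0 // mulr_gt0.
    have e2 : (3 * L * e) ^+ 2 = D t0 h0 / 9.
      have -> : 3 * L * e = Num.sqrt (D t0 h0) / 3 by rewrite /e; field; rewrite gt_eqF.
      by rewrite expr_div_n sqr_sqrtr ?ltW //; field.
    exists e, (Num.max e^-1 (4 * (`|h0| + e) ^+ 2 / D t0 h0)); split=> // h A hh.
    rewrite ge_max => /andP[A1 A2].
    have A0 : 0 < A by apply: lt_le_trans A1; rewrite invr_gt0.
    split=> // t ht.
    have te : `|t - t0| <= e.
      by apply: le_trans ht _; rewrite -[e]invrK lef_pV2 // posrE ?invr_gt0.
    have key f : uan f B -> (f (t0 + h0) - f t0) ^+ 2 / 2 - (3 * L * e) ^+ 2 <= (f (t + h) - f t) ^+ 2.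
      move=> uf; apply: sqr_dist_le.
      have h1 := uan_lip (t0 + h0) ((t - t0) + (h - h0)) uf; have h2 := uan_lip t0 (t - t0) uf.
      rewrite (_ : t0 + h0 + (t - t0 + (h - h0)) = t + h) in h1; last by ring.
      rewrite (_ : t0 + (t - t0) = t) in h2; last by ring.
      have -> : f (t + h) - f t - (f (t0 + h0) - f t0) = (f (t + h) - f (t0 + h0)) - (f t - f t0) by ring.
      apply: le_trans (ler_normB _ _) _; apply: le_trans (lerD h1 h2) _.
      rewrite -/L -mulrDr -mulrA [3 * _](_ : _ = L * (3 * e)); last by ring.
      rewrite ler_wpM2l ?(ltW L0) //; have := ler_normD (t - t0) (h - h0); lra.
    have kD : D t0 h0 / 4 <= D t h.
      have := key x ux; have := key y uy; rewrite e2 /D; rewrite /D in d0; lra.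
    apply: le_trans (_ : (4 * (`|h0| + e) ^+ 2 / D t0 h0) * D t h <= _); last first.
      by rewrite ler_wpM2r // addr_ge0 ?sqr_ge0.
    have p4 : 0 <= 4 * (`|h0| + e) ^+ 2 / D t0 h0.
      by apply: divr_ge0; [pos|exact: ltW].
    apply: le_trans (ler_wpM2l p4 kD).
    have -> : 4 * (`|h0| + e) ^+ 2 / D t0 h0 * (D t0 h0 / 4) = (`|h0| + e) ^+ 2 by field; rewrite gt_eqF.
    rewrite -[h ^+ 2]real_normK ?num_real // lerXn2r ?nnegrE ?addr_ge0 ?(ltW e0) //.
    by have := ler_normD h0 (h - h0); rewrite addrC subrK; lra.
  have A0 : 0 < A by have [] := hA 0; rewrite ?invr_ge0 ?oppr_le0 ?invr_ge0 // ler0n.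
  exists A^-1, A; rewrite invr_gt0; split=> // t A' ht AA'; split; first exact: lt_le_trans AA'.
  move=> h hh; apply: le_trans (_ : A * D t h <= _).
    have hh' : - 2^-1 <= h <= 2^-1 by rewrite -ler_norml.
    by have [_] := hA h hh'; apply.
  by rewrite ler_wpM2r // addr_ge0 ?sqr_ge0.
have A0 : 0 < A by have [] := hA 0; rewrite ?lexx ?ler01.
exists A^-1; split=> //; first by rewrite invr_gt0.
apply: (@periodic_window _ (fun t => forall h, `|h| <= 2^-1 -> A^-1 * h ^+ 2 <= D t h) 0) => [t|t].
  by rewrite /D; split=> H h h2; have := H h h2; rewrite addrAC !px !py.
rewrite add0r => /hA [_ H] h h2.
by rewrite mulrC ler_pdivrMr // mulrC; exact: H.
Qed.

Definition kden x y t s : R := (x s - x t) ^+ 2 + (y s - y t) ^+ 2.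
Definition knum x y t s : R := (x s - x t) * derive1 y s - (y s - y t) * derive1 x s.
(* [Im (Z'(s) / (Z(s) - Z(t)))] for [Z = x + i y], with value [0] on the diagonal. *)
Definition kr x y t s : R := knum x y t s / kden x y t s.

(** The chord-arc bound as [h] tends to 0; one constant [m] thus serves on and off the diagonal. *)
Lemma curve_speed x y B m t : curve x y B m -> m <= derive1 x t ^+ 2 + derive1 y t ^+ 2.
Proof.
move=> [ux uy _ _ m0 far]; have [B1 _] := ux.
have B3 : 0 < B ^+ 3 by rewrite exprn_gt0 //; lra.
have dx := uan_dbnd t ux; have dy := uan_dbnd t uy.
rewrite -subr_le0.
apply: (@le_add_lin _ _ (2 * (2 * B ^+ 2 * (10 * B ^+ 3) + (10 * B ^+ 3) ^+ 2)) 2^-1); first by rewrite invr_gt0.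
move=> h h0 h2.
have key f : uan f B -> (f (t + h) - f t) ^+ 2 <= h ^+ 2 * (derive1 f t ^+ 2 + (2 * B ^+ 2 * (10 * B ^+ 3) + (10 * B ^+ 3) ^+ 2) * h).
  move=> uf; have := uan_taylor t h uf; have := uan_dbnd t uf.
  set d := derive1 f t; set E := f (t + h) - f t - h * d => hd hE.
  have -> : f (t + h) - f t = h * d + E by rewrite /E; ring.
    apply: le_trans (_ : (h * `|d| + 10 * B ^+ 3 * h ^+ 2) ^+ 2 <= _).
    apply: norm_sqr_le.
    apply: le_trans (ler_normD _ _) _; rewrite normrM (gtr0_norm h0) lerD2l //.
  have -> : (h * `|d| + 10 * B ^+ 3 * h ^+ 2) ^+ 2 = h ^+ 2 * (`|d| ^+ 2 + (2 * `|d| * (10 * B ^+ 3) + (10 * B ^+ 3) ^+ 2 * h) * h) by ring.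
  rewrite real_normK ?num_real // ler_wpM2l ?sqr_ge0 // lerD2l ler_wpM2r ?(ltW h0) //.
  apply: lerD; first by apply: ler_wpM2r; [pos|rewrite ler_wpM2l].
  by rewrite ler_piMr ?sqr_ge0 //; lra.
have hh : `|h| <= 2^-1 by rewrite gtr0_norm.
have h3 := le_trans (far t h hh) (lerD (key x ux) (key y uy)).
rewrite mulrC -mulrDr ler_pM2l ?exprn_gt0 // in h3; lra.
Qed.

Lemma kden_ge0 x y t s : 0 <= kden x y t s.
Proof. by rewrite addr_ge0 ?sqr_ge0. Qed.

Lemma kden_eq0 x y B m t s : curve x y B m -> kden x y t s = 0 -> exists n : int, s = t + n%:~R.
Proof.
move=> [_ _ px py m0 far] /eqP; rewrite paddr_eq0 ?sqr_ge0 // !sqrf_eq0 !subr_eq0 => /andP[/eqP xx /eqP yy].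
pose n := Num.floor (s - t + 2^-1); exists n.
have h1 := floor_le (s - t + 2^-1); have h2 := floorD1_gt (s - t + 2^-1).
rewrite -/n in h1 h2; rewrite intrD in h2.
have := far t (s - t - n%:~R).
have -> : t + (s - t - n%:~R) = s - n%:~R by ring.
have E (f : R -> R) u : (forall t, f (t + 1) = f t) -> f (u - n%:~R) = f u.
  by move=> pf; rewrite -(periodic_int (u - n%:~R) n pf) subrK.
rewrite (E x) // (E y) // xx yy !subrr !expr0n /= addr0 => H.
have {}H : m * (s - t - n%:~R) ^+ 2 <= 0 by apply: H; rewrite ler_norml; lra.
have : (s - t - n%:~R) ^+ 2 <= 0 by rewrite -(ler_pM2l m0) mulr0.
by rewrite le_eqVlt ltNge sqr_ge0 orbF sqrf_eq0 => /eqP; lra.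
Qed.

Lemma pexp_inv_sqr (f g : R -> R) t (a b : nat -> R) (M c m0 : R) : 0 < m0 -> m0 <= (f t) ^+ 2 + (g t) ^+ 2 ->
  pexp f t a M c -> pexp g t b M c ->
  exists d, pexp (fun z => ((f z) ^+ 2 + (g z) ^+ 2)^-1) t d
    (2 * (4 * M * M) / m0 ^+ 2) (2 * ((2 * c) * (1 + (4 * M * M) / m0))).
Proof.
move=> m0p hm hf hg.
have h := pexp_add (pexp_mul hf hf) (pexp_mul hg hg).
apply: (@pexp_inv _ _ t _ (4 * M * M) (2 * c) m0 m0p); last first.
  apply: pexp_eq (pexp_le h _ (lexx _)) _.
    by rewrite le_eqVlt; apply/orP; left; apply/eqP; ring.
  by move=> k _; rewrite !expr2.
by rewrite ger0_norm ?addr_ge0 ?sqr_ge0.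
Qed.

Lemma pexp_div_deriv (f g : R -> R) t (b : nat -> R) (M c s : R) : pexp g t b M c -> `|s| * c <= 4^-1 ->
  (forall h, `|h| * c <= 2^-1 -> f (t + h) = (h - s) * g (t + h)) -> derive1 f (t + s) = g (t + s).
Proof.
move=> hg s4 fg; have [M0 c0 _ _] := hg.
suff D : is_derive (t + s) (1 : R) f (g (t + s)) by rewrite derive1E; apply: derive_val.
apply: (@quad_derive _ _ _ _ (12 * M * c) (4 * c)^-1); first by rewrite invr_gt0 mulr_gt0.
move=> h hh; rewrite invfM ler_pdivlMr // in hh.
have hs : `|s + h| * c <= 2^-1.
  by have := ler_wpM2r (ltW c0) (ler_normD s h); rewrite mulrDl; lra.
have s2 : `|s| * c <= 2^-1 by lra.
rewrite -[t + s + h]addrA (fg _ hs) (fg _ s2).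
have -> : (s + h - s) * g (t + (s + h)) - (s - s) * g (t + s) - g (t + s) * h = h * (g (t + (s + h)) - g (t + s)) by ring.
rewrite normrM; apply: le_trans (ler_wpM2l (normr_ge0 h) (pexp_lip hg hs s4)) _.
rewrite (_ : s + h - s = h); last by ring.
by rewrite -[h ^+ 2]real_normK ?num_real // le_eqVlt; apply/orP; left; apply/eqP; ring.
Qed.

Lemma kernel_shift x y B m t s (n : int) : curve x y B m -> kr x y t (s + n%:~R) = kr x y t s.
Proof.
move=> [ux uy px py _ _]; rewrite /kr /knum /kden.
by rewrite !(periodic_int _ _ px) !(periodic_int _ _ py) !(periodic_int _ _ (uan_dperiodic ux px)) !(periodic_int _ _ (uan_dperiodic uy py)).
Qed.

Lemma kden_shift x y B m t s (n : int) : curve x y B m -> kden x y t (s + n%:~R) = kden x y t s.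
Proof.
by move=> [ux uy px py _ _]; rewrite /kden !(periodic_int _ _ px) !(periodic_int _ _ py).
Qed.

(** With [d = s - t], both coordinate differences carry a factor [h - d]. The numerator carries a
    second one, since the chord becomes tangent: the combination [q] of the quotients vanishes at
    [s]. The factors [(h - d) ^+ 2] cancel, and what remains of the denominator is at least [m] at
    [t] by the chord-arc bound. *)
Lemma kernel_pexp_near x y B m : curve x y B m -> exists M c, forall t s, `|s - t| * B <= 4^-1 ->
  exists k a, pexp k t a M c /\
    forall h, `|h| * c <= 2^-1 -> kden x y (t + h) s != 0 -> kr x y (t + h) s = k (t + h).
Proof.
move=> cv; have [ux uy px py m0 far] := cv; have [B1 _] := ux.
have B0 : 0 < B by lra.
pose M1 := 2 * (2 * B) * B.
pose M2 := 2 * (2 * B ^+ 2 * M1) * B.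
pose c2 := 2 * ((2 * B) * (1 + (4 * M1 * M1) / m)).
pose M3 := 2 * (4 * M1 * M1) / m ^+ 2.
pose c3 := Num.max c2 B.
exists (2 * M2 * M3), (2 * c3) => t s.
set d := s - t => hd.
have sE : s = t + d by rewrite /d; ring.
have mk f : uan f B -> exists g b, [/\ pexp g t b M1 B,
    forall h, `|h| * B <= 2^-1 -> f (t + h) - f s = (h - d) * g (t + h),
    g s = derive1 f s & d != 0 -> g t = (f s - f t) / d].
  move=> uf; have [_ /(_ t)[a ha]] := uf.
  have hf : pexp (fun z => f z + - f s) t (fun n => a n + (if n is 0%N then - f s else 0)) (2 * B) B.
    apply: pexp_le (pexp_add ha (pexp_cst (- f s) t B0)) _ (lexx _).
    by rewrite normrN; have := uan_bnd s uf; lra.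
  have [|g [b [hg fg _]]] := pexp_div hf hd; first by rewrite sE subrr.
  exists g, b; split=> //.
    have := @pexp_div_deriv (fun z => f z + - f s) _ _ _ _ _ _ hg hd fg; rewrite -sE => <-.
    have [_ /(_ s)[a' ha']] := uf.
    by have hc := pexp_add ha' (pexp_cst (- f s) s B0); rewrite (uan_coef1 hc) (uan_coef1 ha') addr0.
  move=> d0; have := fg 0; rewrite normr0 mul0r invr_ge0 ler0n => /(_ isT).
  by rewrite addr0 sub0r => E; rewrite (_ : f s - f t = d * g t) ?[d * _]mulrC ?mulfK //; lra.
have [gx [bx [hgx xgx gxs gxt]]] := mk x ux.
have [gy [by_ [hgy ygy gys gyt]]] := mk y uy.
have dxs := uan_dbnd s ux; have dys := uan_dbnd s uy.
pose q z := derive1 y s * gx z + (- derive1 x s) * gy z.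
have [bq hq] : exists bq, pexp q t bq (2 * B ^+ 2 * M1) B.
  have h := pexp_add (pexp_scale (derive1 y s) hgx) (pexp_scale (- derive1 x s) hgy).
  eexists; apply: pexp_le h _ (lexx _).
  rewrite normrN -mulrDl; apply: ler_wpM2r; last lra.
  by rewrite /M1; pos.
have [|r [br [hr qr _]]] := pexp_div hq hd.
  by rewrite /q -sE gxs gys; ring.
have em : m <= (gx t) ^+ 2 + (gy t) ^+ 2.
  have [d0|d0] := eqVneq d 0.
    by rewrite (_ : t = s) ?gxs ?gys; [exact: curve_speed cv|rewrite sE d0 addr0].
  rewrite gxt // gyt // !expr_div_n -mulrDl ler_pdivlMr; last by rewrite exprn_even_gt0.
  rewrite sE; apply: far; apply: le_trans (_ : `|d| * B <= _); last lra.
  by rewrite ler_peMr.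
have [e he] := pexp_inv_sqr m0 em hgx hgy.
have hr3 : pexp (fun z => - 1 * r z) t (fun n => - 1 * br n) M2 c3.
  apply: pexp_le (pexp_scale (- 1) hr) _ _; last by rewrite le_max lexx orbT.
  by rewrite normrN normr1 mul1r.
have he3 : pexp (fun z => ((gx z) ^+ 2 + (gy z) ^+ 2)^-1) t e M3 c3.
  by apply: pexp_le he _ _ => //; rewrite le_max lexx.
exists (fun z => (- 1 * r z) * ((gx z) ^+ 2 + (gy z) ^+ 2)^-1), (conv (fun n => - 1 * br n) e); split.
  exact: pexp_mul.
move=> h hh D0.
have hB : `|h| * B <= 2^-1.
  apply: le_trans hh; rewrite ler_wpM2l //.
  have : B <= c3 by rewrite le_max lexx orbT.
  lra.
have E1 := xgx h hB; have E2 := ygy h hB; have E3 := qr h hB.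
have DE : kden x y (t + h) s = (h - d) ^+ 2 * ((gx (t + h)) ^+ 2 + (gy (t + h)) ^+ 2).
  rewrite /kden -[x s - _]opprB E1 -[y s - _]opprB E2; ring.
have NE : knum x y (t + h) s = (h - d) ^+ 2 * (- 1 * r (t + h)).
  rewrite /knum -[x s - _]opprB E1 -[y s - _]opprB E2.
  transitivity (- (h - d) * q (t + h)); first by rewrite /q; ring.
  by rewrite E3; ring.
rewrite /kr NE DE; rewrite DE mulf_eq0 negb_or in D0; case/andP: D0 => d0 g0.
by rewrite sqrf_eq0 in d0; field; rewrite g0 d0.
Qed.

Lemma kernel_pexp_far x y B m : curve x y B m -> exists M c, forall t s, `|s - t| <= 2^-1 -> 4^-1 <= `|s - t| * B ->
  exists k a, pexp k t a M c /\
    forall h, `|h| * c <= 2^-1 -> kden x y (t + h) s != 0 -> kr x y (t + h) s = k (t + h).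
Proof.
move=> cv; have [ux uy px py m0 far] := cv; have [B1 _] := ux.
have B0 : 0 < B by lra.
(* Here [|s - t| >= 1 / (4 * B)], so [m1] bounds the squared chord from below. *)
pose m1 := m / (16 * B ^+ 2).
have m10 : 0 < m1 by rewrite divr_gt0 // mulr_gt0 // exprn_gt0.
pose c2 := 2 * ((2 * B) * (1 + (4 * (2 * B) * (2 * B)) / m1)).
pose M3 := 2 * (4 * (2 * B) * (2 * B)) / m1 ^+ 2.
pose c3 := Num.max c2 B.
exists (2 * (2 * B ^+ 2 * (2 * B)) * M3), (2 * c3) => t s h1 h2.
have mk f : uan f B -> exists a, pexp (fun z => f z + - f s) t a (2 * B) B.
  move=> uf; have [_ /(_ t)[a ha]] := uf.
  eexists; apply: pexp_le (pexp_add ha (pexp_cst (- f s) t B0)) _ (lexx _).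
  by rewrite normrN; have := uan_bnd s uf; lra.
have [ax hx] := mk x ux; have [ay hy] := mk y uy.
have em : m1 <= (x t + - x s) ^+ 2 + (y t + - y s) ^+ 2.
  have := far t (s - t) h1; rewrite (_ : t + (s - t) = s); last by ring.
  rewrite -[(x s - x t) ^+ 2]sqrrN opprB -[(y s - y t) ^+ 2]sqrrN opprB; apply: le_trans.
  rewrite /m1 ler_pdivrMr ?mulr_gt0 ?exprn_gt0 //.
  have : (4^-1) ^+ 2 <= (`|s - t| * B) ^+ 2 by apply: norm_sqr_le; rewrite ger0_norm // invr_ge0.
  rewrite exprMn real_normK ?num_real // => q.
  have -> : m * (s - t) ^+ 2 * (16 * B ^+ 2) = m * (16 * ((s - t) ^+ 2 * B ^+ 2)) by ring.
  by rewrite ler_peMr ?(ltW m0) //; lra.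
have [e he] := @pexp_inv_sqr (fun z => x z + - x s) (fun z => y z + - y s) _ _ _ _ _ _ m10 em hx hy.
have dxs := uan_dbnd s ux; have dys := uan_dbnd s uy.
pose q z := (- derive1 y s) * (x z + - x s) + derive1 x s * (y z + - y s).
have [bq hq] : exists bq, pexp q t bq (2 * B ^+ 2 * (2 * B)) c3.
  have h := pexp_add (pexp_scale (- derive1 y s) hx) (pexp_scale (derive1 x s) hy).
  eexists; apply: pexp_le h _ _; last by rewrite le_max lexx orbT.
  by rewrite normrN -mulrDl; apply: ler_wpM2r; [pos|lra].
have he3 : pexp (fun z => ((x z + - x s) ^+ 2 + (y z + - y s) ^+ 2)^-1) t e M3 c3.
  by apply: pexp_le he _ _ => //; rewrite le_max lexx.
exists (fun z => q z * ((x z + - x s) ^+ 2 + (y z + - y s) ^+ 2)^-1), (conv bq e); split.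
  exact: pexp_mul.
move=> h hh D0; rewrite /kr; congr (_ / _); first by rewrite /knum /q; ring.
by rewrite /kden; ring.
Qed.

Lemma kernel_pexp x y B m : curve x y B m -> exists M c, forall t s,
  exists k a, pexp k t a M c /\
    forall h, `|h| * c <= 2^-1 -> kden x y (t + h) s != 0 -> kr x y (t + h) s = k (t + h).
Proof.
move=> cv; have [M1 [c1 H1]] := kernel_pexp_near cv; have [M2 [c2 H2]] := kernel_pexp_far cv.
exists (Num.max M1 M2), (Num.max c1 c2) => t s.
(* An integer shift brings [s] to within [1 / 2] of [t], where one of the two cases applies. *)
pose n := - Num.floor (s - t + 2^-1).
have hs : `|s + n%:~R - t| <= 2^-1.
  have h1 := floor_le (s - t + 2^-1); have h2 := floorD1_gt (s - t + 2^-1).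
  by rewrite /n mulrNz ler_norml; rewrite intrD in h2; lra.
have [k [a [hk ka]]] : exists k a, pexp k t a (Num.max M1 M2) (Num.max c1 c2) /\
    forall h, `|h| * (Num.max c1 c2) <= 2^-1 -> kden x y (t + h) (s + n%:~R) != 0 -> kr x y (t + h) (s + n%:~R) = k (t + h).
  have mono (h c c' : R) : c <= c' -> `|h| * c' <= 2^-1 -> `|h| * c <= 2^-1.
    by move=> cc; apply: le_trans; rewrite ler_wpM2l.
  have [near|/ltW fr] := leP (`|s + n%:~R - t| * B) 4^-1.
    have [k [a [hk ka]]] := H1 t _ near; exists k, a; split.
      by apply: pexp_le hk _ _; rewrite le_max lexx.
    by move=> h hh; apply: ka; apply: mono hh; rewrite le_max lexx.
  have [k [a [hk ka]]] := H2 t _ hs fr; exists k, a; split.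
    by apply: pexp_le hk _ _; rewrite le_max lexx orbT.
  by move=> h hh; apply: ka; apply: mono hh; rewrite le_max lexx orbT.
exists k, a; split=> // h hh; rewrite -(kden_shift (t + h) s n cv) -(kernel_shift (t + h) s n cv).
exact: ka.
Qed.

End Curve.

(** * Analyticity of the double layer operator in the parameter *)

Section Kernel.
Context {R : realType}.
Variables (x y : R -> R) (B m : R).
Hypothesis cv : curve x y B m.
Implicit Types (t s h : R) (u : R -> R).

Let ux : uan x B := cv_x cv.
Let uy : uan y B := cv_y cv.

Lemma kden_neq0_near t s h : kden x y t s = 0 -> h != 0 -> `|h| < 1 -> kden x y (t + h) s != 0.
Proof.
move=> /(kden_eq0 cv)[n sn] h0 h1; apply/negP => /eqP /(kden_eq0 cv)[n' sn'].
have hz : h = (n - n')%:~R.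
  by rewrite intrB; lra.
move: h1 h0; rewrite hz -intr_norm -[1]/(1%:~R) ltr_int => h1 /negP; apply.
by rewrite intr_eq0; move: h1; case: (n - n') => [[|k]|k].
Qed.

Lemma measurable_kr : measurable_fun setT (fun p : R * R => kr x y p.1 p.2).
Proof.
have [mx _] := uan_bm ux; have [my _] := uan_bm uy.
have [mdx _] := uan_dbm ux; have [mdy _] := uan_dbm uy.
have M1 (f : R -> R) : measurable_fun setT f -> measurable_fun setT (fun p : R * R => f p.1).
  by move=> mf; apply: measurableT_comp => //; exact: measurable_fst.
have M2 (f : R -> R) : measurable_fun setT f -> measurable_fun setT (fun p : R * R => f p.2).
  by move=> mf; apply: measurableT_comp => //; exact: measurable_snd.
have Md (f : R -> R) : measurable_fun setT f -> measurable_fun setT (fun p : R * R => f p.2 - f p.1).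
  by move=> mf; apply: measurable_funB; [exact: M2|exact: M1].
apply: measurable_funM.
  by apply: measurable_funB; apply: measurable_funM; [exact: Md|exact: M2|exact: Md|exact: M2].
apply: measurable_fun_inv; apply: measurable_funD; apply: measurable_funX; exact: Md.
Qed.

Lemma bm_kr : bm (fun p : R * R => kr x y p.1 p.2).
Proof.
split; first exact: measurable_kr.
have [M [c H]] := kernel_pexp cv; exists (2 * M) => -[t s] /=.
have [k [a [hk ka]]] := H t s.
have [M0 c0 _ _] := hk.
have [D0|D0] := eqVneq (kden x y t s) 0; first by rewrite /kr D0 invr0 mulr0 normr0 mulr_ge0.
have := ka 0; rewrite normr0 mul0r invr_ge0 ler0n addr0 => -> //.
by have := pexp_bnd (h := 0) hk; rewrite normr0 mul0r invr_ge0 ler0n addr0; apply.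
Qed.

Lemma bm_kr1 t : bm (fun s => kr x y t s).
Proof. exact: (bm_sect1 t bm_kr). Qed.

Lemma kernel_coefs : exists M c (ka : R -> R -> nat -> R),
  [/\ forall t s, pexp (fun z => ka z s 0%N) t (ka t s) M c,
      forall t s, kden x y t s != 0 -> kr x y t s = ka t s 0%N &
      forall t n, bm (fun s => ka t s n)].
Proof.
have [M [c H]] := kernel_pexp cv.
have /choice[q hq] : forall p : R * R, exists q : (R -> R) * (nat -> R), pexp q.1 p.1 q.2 M c /\
    forall h, `|h| * c <= 2^-1 -> kden x y (p.1 + h) p.2 != 0 -> kr x y (p.1 + h) p.2 = q.1 (p.1 + h).
  by move=> [t s]; have [k [a ka]] := H t s; exists (k, a).
pose k t s := (q (t, s)).1; pose a t s := (q (t, s)).2.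
have hk t s : pexp (k t s) t (a t s) M c /\
    forall h, `|h| * c <= 2^-1 -> kden x y (t + h) s != 0 -> kr x y (t + h) s = k t s (t + h) := hq (t, s).
have [M0 c0] : 0 <= M /\ 0 < c by have [[]] := hk 0 0.
have kr0 t s : kden x y t s != 0 -> kr x y t s = a t s 0%N.
  move=> D0; have [pk] := hk t s; rewrite (pexp_coef0 pk) => /(_ 0).
  by rewrite normr0 mul0r invr_ge0 ler0n addr0; apply.
(* Extensions chosen at two base points agree off the diagonal, where both equal the kernel, and at
   a diagonal point by the Lipschitz bound along nearby parameters. *)
have kk t s h : `|h| * c <= 4^-1 -> k t s (t + h) = a (t + h) s 0%N.
  move=> hc; have [pk kE] := hk t s; have [pk' kE'] := hk (t + h) s.
  have hc2 : `|h| * c <= 2^-1 by lra.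
  have [D0|D0] := eqVneq (kden x y (t + h) s) 0; last by rewrite -kE // kr0.
  apply/eqP; rewrite -subr_eq0 -normr_le0 (pexp_coef0 pk').
  apply: (@le_add_lin _ _ (24 * M * c) (Num.min 2^-1 (4 * c)^-1)).
    by rewrite lt_min !invr_gt0 mulr_gt0 // ltr0n.
  move=> v v0; rewrite le_min => /andP[v2]; rewrite invfM ler_pdivlMr // => vc.
  have nv : `|v| = v by rewrite gtr0_norm.
  have v1 : `|v| < 1 by rewrite nv; lra.
  have hv : `|h + v| * c <= 2^-1.
    by have := ler_wpM2r (ltW c0) (ler_normD h v); rewrite mulrDl nv; lra.
  have hv2 : `|v| * c <= 2^-1 by rewrite nv; lra.
  have D1 := kden_neq0_near D0 (lt0r_neq0 v0) v1.
  have e1 := kE' v hv2 D1; rewrite -addrA in e1 D1; have e2 := kE _ hv D1.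
  have l1 := pexp_lip pk hv hc.
  have c00 : `|0 : R| * c <= 4^-1 by rewrite normr0 mul0r invr_ge0.
  have l2 := pexp_lip pk' hv2 c00; rewrite addr0 subr0 -addrA in l2.
  rewrite (_ : h + v - h = v) in l1; last by ring.
  rewrite -e1 e2 in l2; rewrite nv in l1 l2.
  have -> : k t s (t + h) - k (t + h) s (t + h) = (k t s (t + (h + v)) - k (t + h) s (t + h)) - (k t s (t + (h + v)) - k t s (t + h)) by ring.
  apply: le_trans (ler_normB _ _) _; lra.
have pa t s : pexp (fun z => a z s 0%N) t (a t s) M (2 * c).
  have [pk _] := hk t s.
  apply: pexp_eq (pexp_le pk (lexx _) _) _; first lra.
  by move=> h hh; apply: kk; lra.
exists M, (2 * c), a; split=> // t n.
split; last first.
  by exists (M * (2 * c) ^+ n) => s; have [_ _ + _] := pa t s; apply.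
elim/ltn_ind: n => n IH.
(* The coefficient of order [n] is the limit of divided remainders of the measurable kernel along
   [hm i]. Parameters of one point of the curve differ by integers, so the kernel agrees with its
   extension at all but finitely many [t + hm i]. *)
pose hm (i : nat) : R := (4 * c)^-1 / i.+1%:R.
have hm0 i : 0 < hm i by rewrite divr_gt0 ?invr_gt0 ?mulr_gt0 ?ltr0n.
apply: (@measurable_fun_cvg _ R R setT (fun i s => (kr x y (t + hm i) s - psum (a t s) n (hm i)) / hm i ^+ n)).
  move=> i; apply: measurable_funM; last exact: measurable_cst.
  apply: measurable_funB; first by have [] := bm_kr1 (t + hm i).
  rewrite /psum; apply: measurable_sum => j.
  by apply: measurable_funM; [apply: IH; exact: ltn_ord|exact: measurable_cst].
move=> s _.
have hmc i : `|hm i| * (2 * c) <= 2^-1.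
  rewrite gtr0_norm // /hm.
  have -> : (4 * c)^-1 / i.+1%:R * (2 * c) = 2^-1 / i.+1%:R :> R.
    have z0 : i.+1%:R != 0 :> R by rewrite pnatr_eq0.
    have c1 : c != 0 by rewrite gt_eqF.
    by move: (i.+1%:R) z0 => z z0; field; rewrite z0 c1.
  by rewrite ler_piMr ?invr_ge0 // invf_le1 ?ltr0n // ler1n.
have key i : kden x y (t + hm i) s != 0 ->
    `|a t s n - (kr x y (t + hm i) s - psum (a t s) n (hm i)) / hm i ^+ n| <= 2 * M * (2 * c) ^+ n.+1 * hm i.
  move=> D0; have [_ _ _ /(_ (hm i) n.+1 (hmc i))] := pa t s.
  rewrite -kr0 // psumS.
  have hn : 0 < hm i ^+ n by rewrite exprn_gt0.
  set K := kr _ _ _ _; set P := psum _ _ _ => h.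
  have -> : a t s n - (K - P) / hm i ^+ n = - ((K - (P + a t s n * hm i ^+ n)) / hm i ^+ n).
    by field; rewrite gt_eqF.
  rewrite normrN normrM normfV (gtr0_norm hn) ler_pdivrMr //.
  apply: le_trans h _; rewrite (gtr0_norm (hm0 i)) exprMn !exprS le_eqVlt; apply/orP; left; apply/eqP; ring.
have [i0 hi0] : exists i0, forall i, (i0 <= i)%N -> kden x y (t + hm i) s != 0.
  have [[i Di]|nD] := pselect (exists i, kden x y (t + hm i) s = 0 /\ hm i < 1); last first.
    exists (Num.truncn (4 * c)^-1).+1 => i ii; apply/eqP => Di; apply: nD; exists i; split=> //.
    rewrite /hm ltr_pdivrMr ?ltr0n // mul1r.
    apply: lt_le_trans (truncnS_gt _) _; rewrite ler_nat; exact: leqW.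
  case: Di => Di h1; exists i.+1 => j ij.
  have lt : hm j < hm i by rewrite /hm ltr_pM2l ?invr_gt0 ?mulr_gt0 // ltf_pV2 ?posrE ?ltr0n // ltr_nat ltnS.
  have -> : t + hm j = t + hm i + (hm j - hm i) by ring.
  apply: kden_neq0_near => //; first by rewrite subr_eq0 lt_eqF.
  by have := hm0 j; rewrite ltr_norml; lra.
apply/cvgrPdist_le => e e0.
pose A := 2 * M * (2 * c) ^+ n.+1 * (4 * c)^-1.
near=> i.
have ii : (i0 <= i)%N by near: i; exists i0.
apply: le_trans (key i (hi0 i ii)) _.
rewrite /hm mulrA -/A ler_pdivrMr ?ltr0n //.
have : (Num.truncn (A / e) <= i)%N by near: i; exists (Num.truncn (A / e)).
move=> Ai; have := truncnS_gt (A / e); rewrite ltr_pdivrMr // => /ltW h.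
by apply: le_trans h _; rewrite mulrC ler_wpM2l ?(ltW e0) // ler_nat ltnS.
Unshelve. all: by end_near. Qed.

(* [- pi] times the double layer potential, read in the parameter; see [dlp_real_curve]. *)
Definition dlpA u t : R := int01 (fun s => kr x y t s * u s).

(** The endpoint 1 is listed apart because the point of parameter [t] can be met at both ends of the
    period. *)
Lemma kden_eq0_01 t : exists p, forall s, 0 <= s <= 1 -> s != p -> s != 1 -> kden x y t s != 0.
Proof.
exists (t - (Num.floor t)%:~R) => s /andP[s0 s1] sp s1'; apply/negP => /eqP /(kden_eq0 cv)[n sn].
have h1 := floor_le t; have h2 := floorD1_gt t; rewrite intrD in h2.
have s2 : s < 1 by rewrite lt_neqAle s1'.
have nf : n = - Num.floor t.
  have a1 : (- 1)%:~R < (n + Num.floor t)%:~R :> R by rewrite intrD mulrNz; lra.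
  have a2 : (n + Num.floor t)%:~R < 1%:~R :> R by rewrite intrD; lra.
  rewrite ltr_int in a1; rewrite ltr_int in a2.
  by apply/eqP; rewrite -addr_eq0; move: a1 a2; case: (n + Num.floor t) => [[|k]|[|k]].
by case/eqP: sp; rewrite sn nf mulrNz.
Qed.

Lemma int01_bnd_except (F : R -> R) (E p q : R) : bm F ->
  (forall s, 0 <= s <= 1 -> s != p -> s != q -> `|F s| <= E) -> 0 <= E -> `|int01 F| <= E.
Proof.
move=> bF H E0; pose G s := F s * (1 - \1_([set p; q]) s).
have mpq : measurable [set p; q] by apply: measurableU; exact: measurable_set1.
have bG : bm G.
  apply: bmM => //; apply: bmB; first exact: bm_cst.
  split; first by apply/measurable_indicP.
  by exists 1 => s; rewrite indicE; case: (_ \in _); rewrite ?normr1 ?normr0.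
rewrite (@int01_except _ F G p q bF bG); last first.
  move=> s _ sp sq; rewrite /G indicE memNset ?subr0 ?mulr1 //= => -[e|e].
    by rewrite e eqxx in sp.
  by rewrite e eqxx in sq.
apply: int01_bnd => // s s01; rewrite /G indicE.
have [sp|sp] := eqVneq s p.
  by rewrite mem_set; [rewrite subrr mulr0 normr0|left].
have [sq|sq] := eqVneq s q.
  by rewrite mem_set; [rewrite subrr mulr0 normr0|right].
rewrite memNset ?subr0 ?mulr1; first exact: H.
by move=> /= -[e|e]; [rewrite e eqxx in sp|rewrite e eqxx in sq].
Qed.

Lemma psum_bm t (ka : R -> nat -> R) N h : (forall n, bm (fun s => ka s n)) -> bm (fun s => psum (ka s) N h).
Proof.
move=> bk; elim: N => [|N IH].
  by under eq_fun do rewrite psum0; exact: bm_cst.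
under eq_fun do rewrite psumS.
by apply: bmD => //; apply: bmM => //; exact: bm_cst.
Qed.

Lemma dlpA_pexp_coefs (M c E : R) (ka : R -> R -> nat -> R) u t :
  (forall t s, pexp (fun z => ka z s 0%N) t (ka t s) M c) ->
  (forall t s, kden x y t s != 0 -> kr x y t s = ka t s 0%N) ->
  (forall t n, bm (fun s => ka t s n)) -> bm u -> (forall s, `|u s| <= E) ->
  pexp (dlpA u) t (fun n => int01 (fun s => ka t s n * u s)) (M * E) c.
Proof.
move=> pk kE bk bu uE.
have E0 : 0 <= E by exact: le_trans (uE 0).
have [M0 c0 _ _] := pk 0 0.
split=> // [|n|h N hh]; first by rewrite mulr_ge0.
  apply: int01_bnd; first exact: bmM.
  move=> s _; rewrite normrM mulrAC; apply: ler_pM => //.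
  by have [_ _ + _] := pk t s; apply.
have -> : psum (fun n => int01 (fun s => ka t s n * u s)) N h = int01 (fun s => psum (ka t s) N h * u s).
  elim: N => [|N IH].
    by rewrite psum0; under [RHS]int01_eq do rewrite psum0 mul0r; rewrite ?int01_cst.
  rewrite psumS IH.
  transitivity (int01 (fun s => psum (ka t s) N h * u s + h ^+ N * (ka t s N * u s))); last first.
    by apply: int01_eq => s _; rewrite psumS; ring.
  rewrite int01D; [|by apply: bmM => //; exact: psum_bm|by apply: bmZ; exact: bmM].
  by rewrite int01Z; [rewrite [h ^+ N * _]mulrC|exact: bmM].
have b1 : bm (fun s => kr x y (t + h) s * u s) by apply: bmM => //; exact: bm_kr1.
have b2 : bm (fun s => psum (ka t s) N h * u s) by apply: bmM => //; exact: psum_bm.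
rewrite /dlpA -int01B //.
have [p hp] := kden_eq0_01 (t + h).
apply: (@int01_bnd_except _ _ p 1); first exact: bmB.
  move=> s s01 sp s1; rewrite -mulrBl normrM kE; last exact: hp.
  have [_ _ _ /(_ h N hh) H] := pk t s.
  apply: le_trans (ler_pM _ _ H (uE s)) _ => //.
  by rewrite le_eqVlt; apply/orP; left; apply/eqP; ring.
by rewrite !mulr_ge0 // exprn_ge0 // mulr_ge0 // ltW.
Qed.

(** The independence of [c] from [u] is the source of the common radius of all eigenfunctions. *)
Lemma dlpA_pexp : exists M c, 0 < c /\ forall u E, bm u -> (forall s, `|u s| <= E) ->
  forall t, exists b, pexp (dlpA u) t b (M * E) c.
Proof.
have [M [c [ka [pk kE bk]]]] := kernel_coefs.
have [M0 c0 _ _] := pk 0 0.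
exists M, c; split=> // u E bu uE t.
by eexists; exact: (dlpA_pexp_coefs t pk kE bk bu uE).
Qed.

Lemma dlpA_periodic u t : dlpA u (t + 1) = dlpA u t.
Proof.
apply: int01_eq => s _; congr (_ * _).
by rewrite /kr /knum /kden (cv_px cv) (cv_py cv).
Qed.

Lemma dlpA_uan u : bm u -> exists B', uan (dlpA u) B'.
Proof.
move=> bu; have [M [c [c0 H]]] := dlpA_pexp.
have [E hE] := bu.2.
exists (Num.max 1 (Num.max (M * E) c)); split; first by rewrite le_max lexx.
move=> t; have [b hb] := H u E bu hE t; exists b.
by apply: pexp_le hb _ _; rewrite !le_max lexx ?orbT.
Qed.

End Kernel.

Section Tools.
Context {R : realType}.
Implicit Types (f g u : R -> R) (t h : R).

Lemma local_pexp_uan f : (forall t, f (t + 1) = f t) -> (forall t, exists a M c, pexp f t a M c) ->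
  exists B, uan f B.
Proof.
move=> fp fa.
have [B HB] : exists B, forall t, 0 <= t <= 1 -> exists a, pexp f t a B B.
  apply: (@segment_uniform _ (fun B t => exists a, pexp f t a B B)) => t _.
  have [a [M [c hf]]] := fa t.
  have c0 : 0 < c by case: hf.
  exists (4 * c)^-1, (Num.max (2 * M) (2 * c)); rewrite invr_gt0 mulr_gt0 //; split=> // z B hz.
  rewrite ge_max => /andP[h1 h2].
  have [|b hb] := pexp_recenter (d := z - t) hf.
    by rewrite invfM ler_pdivlMr in hz.
  by exists b; rewrite addrC subrK in hb; exact: pexp_le hb _ _.
have {}HB : forall t, exists a, pexp f t a B B.
  apply: (@periodic_window _ _ 0) => [t|t]; last by rewrite add0r => /HB.
  split=> -[a ha]; exists a.
    by apply: pexp_eq (pexp_shift ha) _ => h _; rewrite fp.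
  case: ha => M0 c0 ha hf; split=> // h N hh; rewrite addrAC fp; exact: hf.
exists (Num.max 1 B); split; first by rewrite le_max lexx.
by move=> t; have [a ha] := HB t; exists a; apply: pexp_le ha _ _; rewrite le_max lexx orbT.
Qed.

Lemma uanM f g B B' : uan f B -> uan g B' -> exists B2, uan (fun z => f z * g z) B2.
Proof.
move=> uf ug.
have {}uf : uan f (Num.max B B') by apply: uan_le uf _; rewrite le_max lexx.
have {}ug : uan g (Num.max B B') by apply: uan_le ug _; rewrite le_max lexx orbT.
set D := Num.max B B' in uf ug.
exists (2 * D * D + 2 * D); have [D1 hf] := uf; have [_ hg] := ug.
have DD : 0 <= D * D by rewrite mulr_ge0 //; lra.
split; first lra.
move=> t; have [a ha] := hf t; have [b hb] := hg t.
by exists (conv a b); apply: pexp_le (pexp_mul ha hb) _ _; lra.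
Qed.

Lemma uan_cst (k : R) : uan (fun=> k) (1 + `|k|).
Proof.
have k0 := normr_ge0 k; split; first lra.
move=> t; eexists; apply: pexp_le (pexp_cst k t (ltr01 : 0 < 1)) _ _; lra.
Qed.

Lemma uan_scale (k : R) f B : uan f B -> exists B', uan (fun z => k * f z) B'.
Proof. by move=> uf; exact: uanM (uan_cst k) uf. Qed.

Lemma uan_int0 f B : uan f B -> (forall t, f (t + 1) = f t) -> int01 (derive1 f) = 0.
Proof.
move=> uf fp; have dF t : is_derive t (1 : R) f (derive1 f t) by exact: uan_derive uf.
have -> := FTC01 dF (uan_dcontinuous uf).
by rewrite -[1]add0r fp subrr.
Qed.

Lemma uan_deriveM f g B B' t : uan f B -> uan g B' ->
  derive1 (fun z => f z * g z) t = f t * derive1 g t + g t * derive1 f t.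
Proof.
move=> uf ug; have Df := uan_derive t uf; have Dg := uan_derive t ug.
have D := is_deriveM Df Dg.
by rewrite derive1E; apply: (@derive_val _ _ _ _ _ _ _ D).
Qed.

Lemma derive0_cst f : (forall t, is_derive t (1 : R) f 0) -> forall s t, f s = f t.
Proof.
move=> D s t; exact: is_derive_0_is_cst.
Qed.

Lemma uan_derive0_cst f B : uan f B -> (forall t, derive1 f t = 0) -> forall s t, f s = f t.
Proof.
by move=> uf f0; apply: derive0_cst => t; rewrite -(f0 t); exact: uan_derive uf.
Qed.

Lemma bm_set1 (z k : R) : bm (fun t : R => k * \1_[set z] t).
Proof.
apply: bmZ; split; first by apply/measurable_indicP; exact: measurable_set1.
by exists 1 => s; rewrite indicE; case: (_ \in _); rewrite ?normr1 ?normr0.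
Qed.

(** [g] is modified at the listed points, one at a time, until it equals [f], which may be any
    function. *)
Lemma int01_exceptl (ps : seq R) (f g : R -> R) : bm g ->
  (forall t, 0 <= t <= 1 -> t \notin ps -> f t = g t) -> int01 f = int01 g.
Proof.
elim: ps g => [|p ps IH] g bg fg; first by apply: int01_eq => t t01; exact: fg.
pose g' t := g t + (f p - g p) * \1_[set p] t.
have bg' : bm g' by apply: bmD => //; exact: bm_set1.
have i1 t : \1_[set p] t = (t == p)%:R :> R.
  rewrite indicE; have [->|n] := eqVneq t p; first by rewrite mem_set.
  by rewrite memNset //=; apply/eqP.
have -> : int01 g = int01 g'.
  apply: (@int01_except _ _ _ p p) => // t _ /negbTE tp _.
  by rewrite /g' i1 tp mulr0 addr0.
apply: IH => // t t01 tps; rewrite /g' i1.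
have [->|tp] := eqVneq t p; first by rewrite mulr1; ring.
by rewrite mulr0 addr0; apply: fg => //; rewrite inE negb_or tp.
Qed.

Lemma int01_except1 (f g : R -> R) (p q : R) : bm g ->
  (forall t, 0 <= t <= 1 -> t != p -> t != q -> f t = g t) -> int01 f = int01 g.
Proof.
move=> bg fg; apply: (@int01_exceptl [:: p; q]) => // t t01.
by rewrite !inE negb_or => /andP[]; exact: fg.
Qed.

End Tools.

(** * The adjoint relation between the operator and differentiation *)

Section Adjoint.
Context {R : realType}.
Variables (x y : R -> R) (B m : R).
Hypothesis cv : curve x y B m.
Implicit Types (t s h : R) (u V : R -> R).

Let ux : uan x B := cv_x cv.
Let uy : uan y B := cv_y cv.

(** This is [Im (Z'(s) * Z'(t) / (Z(s) - Z(t)) ^+ 2)], the derivative in [t] of the kernel. Its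
    symmetry in [s] and [t] is the source of the adjoint relation. *)
Definition kr1 t s : R :=
  ((- derive1 x t * derive1 y s + derive1 y t * derive1 x s) * kden x y t s
   + 2 * knum x y t s * ((x s - x t) * derive1 x t + (y s - y t) * derive1 y t)) / kden x y t s ^+ 2.

Lemma kr1_sym t s : kr1 t s = kr1 s t.
Proof.
rewrite /kr1; have -> : kden x y s t = kden x y t s by rewrite /kden; ring.
rewrite /kden /knum; move: (derive1 x t) (derive1 x s) (derive1 y t) (derive1 y s) => a b c d.
by congr (_ / _); ring.
Qed.

Lemma is_derive_kr t s : kden x y t s != 0 -> is_derive t (1 : R) (fun z => kr x y z s) (kr1 t s).
Proof.
move=> D0.
have Dx := uan_derive t ux; have Dy := uan_derive t uy.
have Dn : is_derive t (1 : R) (fun z => knum x y z s) (- derive1 x t * derive1 y s + derive1 y t * derive1 x s).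
  rewrite /knum; apply: is_derive_eq.
  rewrite /GRing.scale /=; ring.
have Dd : is_derive t (1 : R) (fun z => kden x y z s) (- 2 * ((x s - x t) * derive1 x t + (y s - y t) * derive1 y t)).
  rewrite /kden; apply: is_derive_eq.
  rewrite /GRing.scale /=; ring.
have Di := @is_deriveV _ (fun z => kden x y z s) t _ 1 D0 Dd.
have := is_deriveM Dn Di.
set E := (X in is_derive _ _ _ X).
have -> : E = kr1 t s.
  rewrite /E /kr1 /kr /GRing.scale /= -exprVn; field.
  by [].
by [].
Qed.


(** Differentiate the kernel, exchange its two variables by the symmetry of [kr1], and integrate by
    parts over the period. *)
Lemma derive_dlpA u B' s : uan u B' -> (forall t, u (t + 1) = u t) ->
  derive1 (dlpA x y u) s = - int01 (fun t => kr x y t s * derive1 u t).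
Proof.
move=> uu up; have [M [c [ka [pk kE bk]]]] := kernel_coefs cv.
have bu := uan_bm uu; have [E hE] := bu.2.
have [p hp] := kden_eq0_01 cv s.
have sym t : kden x y t s = kden x y s t by rewrite /kden; ring.
have ka1 t z : kden x y t z != 0 -> ka t z 1%N = kr1 t z.
  move=> D0; have Dk := is_derive_kr D0.
  have Dka := pexp_is_derive (pk t z).
  have e1 : derive1 (fun v => ka v z 0%N) t = derive1 (fun v => kr x y v z) t.
    rewrite !derive1E; apply: near_eq_derive.
    have cd : {for t, continuous (fun v => kden x y v z)}.
      rewrite /kden; apply: cvgD.
        by apply: (@cvg_comp _ _ _ (fun v => x z - x v) (fun w => w ^+ 2)); [apply: cvgB; [exact: cvg_cst|exact: (uan_continuous ux)]|exact: exprn_continuous].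
      by apply: (@cvg_comp _ _ _ (fun v => y z - y v) (fun w => w ^+ 2)); [apply: cvgB; [exact: cvg_cst|exact: (uan_continuous uy)]|exact: exprn_continuous].
    have : \forall v \near t, kden x y v z != 0 by exact: cvgr_neq0 cd D0.
    by apply: filterS => v v0; rewrite kE.
  move: e1; rewrite !derive1E (@derive_val _ _ _ _ _ _ _ Dka) (@derive_val _ _ _ _ _ _ _ Dk).
  by [].
rewrite (uan_coef1 (dlpA_pexp_coefs cv s pk kE bk bu hE)).
transitivity (int01 (fun t => ka t s 1%N * u t)).
  have bsym : bm (fun t => ka s t 1%N * u t) by apply: bmM.
  apply/esym; apply: (@int01_except1 _ _ _ p 1) => // t t01 tp t1.
  have D1 := hp t t01 tp t1; have D2 : kden x y t s != 0 by rewrite sym.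
  by rewrite (ka1 _ _ D2) (ka1 _ _ D1) kr1_sym.
(* The boundary terms cancel once the extended kernel is known to be periodic; at a diagonal point
   this again follows from the Lipschitz bounds. *)
have kp t : ka (t + 1) s 0%N = ka t s 0%N.
  apply/eqP; rewrite -subr_eq0 -normr_le0.
  have pk1 := pexp_shift (pk (t + 1) s).
  have [M0 c0 _ _] := pk t s.
  apply: (@le_add_lin _ _ (24 * M * c) (Num.min 2^-1 (4 * c)^-1)).
    by rewrite lt_min !invr_gt0 mulr_gt0 // ltr0n.
  move=> v v0; rewrite le_min => /andP[v2]; rewrite invfM ler_pdivlMr // => vc.
  have nv : `|v| = v by rewrite gtr0_norm.
  have hv2 : `|v| * c <= 2^-1 by rewrite nv; lra.
  have c00 : `|0 : R| * c <= 4^-1 by rewrite normr0 mul0r invr_ge0.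
  have l1 := pexp_lip pk1 hv2 c00; have l2 := pexp_lip (pk t s) hv2 c00.
  rewrite !addr0 subr0 nv in l1 l2.
  have [D0|D0] := eqVneq (kden x y t s) 0.
    have D1 : kden x y (t + v) s != 0 by apply: kden_neq0_near; rewrite ?nv ?gt_eqF //; [exact: cv|lra].
    have D2 : kden x y (t + v + 1) s != 0 by move: D1; rewrite /kden (cv_px cv) (cv_py cv).
    have e : ka (t + v + 1) s 0%N = ka (t + v) s 0%N.
      by rewrite -!kE // /kr /knum /kden (cv_px cv) (cv_py cv).
    rewrite e in l1.
    have -> : ka (t + 1) s 0%N - ka t s 0%N = (ka (t + v) s 0%N - ka t s 0%N) - (ka (t + v) s 0%N - ka (t + 1) s 0%N) by ring.
    by apply: le_trans (ler_normB _ _) _; lra.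
  rewrite -!kE //; last by move: D0; rewrite /kden (cv_px cv) (cv_py cv).
  rewrite /kr /knum /kden (cv_px cv) (cv_py cv) subrr normr0.
  by rewrite !mulr_ge0 // ltW.
have [Bk uk] : exists Bk, uan (fun t => ka t s 0%N) Bk.
  by apply: local_pexp_uan => // t; exists (ka t s), M, c.
have [B2 uku] := uanM uk uu.
have := uan_int0 uku (fun t => f_equal2 _ (kp t) (up t)).
have dk t : derive1 (fun t => ka t s 0%N) t = ka t s 1%N by exact: uan_coef1 (pk t s).
have b1 : bm (fun t => ka t s 0%N * derive1 u t) by apply: bmM; [exact: uan_bm uk|exact: uan_dbm uu].
have b2 : bm (fun t => ka t s 1%N * u t).
  by under eq_fun do rewrite -dk; apply: bmM => //; exact: uan_dbm uk.
rewrite (@int01_eq _ _ (fun t => ka t s 0%N * derive1 u t + ka t s 1%N * u t)); last first.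
  by move=> t _; rewrite (uan_deriveM t uk uu) dk [u t * _]mulrC.
rewrite int01D // => /eqP; rewrite addrC addr_eq0 => /eqP ->; congr (- _).
apply/esym; apply: (@int01_except1 _ _ _ p 1) => // t t01 tp t1.
by rewrite kE // sym hp.
Qed.

(** Symmetry of the operator, up to sign, for the pairing of [u'] with [V]: in [complex_rigidity] it
    takes the role of self-adjointness. *)
Lemma dlpA_adjoint u V B' : uan u B' -> (forall t, u (t + 1) = u t) -> bm V ->
  int01 (fun t => derive1 u t * dlpA x y V t) = - int01 (fun s => V s * derive1 (dlpA x y u) s).
Proof.
move=> uu up bV; have bk := bm_kr cv.
have bdu := uan_dbm uu.
pose F (p : R * R) := derive1 u p.1 * (kr x y p.1 p.2 * V p.2).
have bF : bm F by apply: bmM; [exact: bm_fst|apply: bmM => //; exact: bm_snd].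
transitivity (int01 (fun t => int01 (fun s => F (t, s)))).
  apply: int01_eq => t _; rewrite /F /= int01Z //.
  by apply: bmM => //; exact: (bm_sect1 t bk).
rewrite int01_fubini // -int01N; last first.
  have [B2 u2] := dlpA_uan cv (uan_bm uu).
  by apply: bmM => //; exact: uan_dbm u2.
apply: int01_eq => s _; rewrite (derive_dlpA s uu up) mulrN opprK -int01Z; last first.
  by apply: bmM => //; exact: (bm_sect2 s bk).
by apply: int01_eq => t _; rewrite /F /=; ring.
Qed.

Lemma winding_cst s t : dlpA x y (fun=> 1) s = dlpA x y (fun=> 1) t.
Proof.
have [B2 u2] := dlpA_uan cv (bm_cst _ 1).
apply: (uan_derive0_cst u2) => z.
rewrite (derive_dlpA z (uan_cst 1)) //.
rewrite (@int01_eq _ _ (fun=> 0)) ?int01_cst ?oppr0 // => v _.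
by rewrite derive1_cst mulr0.
Qed.

End Adjoint.

(** * The winding integral *)

Section Winding.
Context {R : realType}.
Implicit Types (f x y : R -> R) (t s h B m : R).
Local Notation mu := (@lebesgue_measure R).

Lemma int01_inner (f : R -> R) (E d : R) : bm f -> (forall t, `|f t| <= E) -> 0 < d -> d <= 2^-1 ->
  `|int01 f - (\int[mu]_(t in `[d, 1 - d]) f t)%R| <= E * (2 * d).
Proof.
move=> bf fE d0 d2; have E0 : 0 <= E by exact: le_trans (fE 0).
pose P : set R := `[d, 1 - d]%classic.
have mP : measurable P by exact: measurable_itv.
have bP : bm (\1_P : R -> R).
  split; first by apply/measurable_indicP.
  by exists 1 => s; rewrite indicE; case: (_ \in _); rewrite ?normr1 ?normr0.
have DP : `[0%R, 1%R]%classic `&` P = P.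
  apply/seteqP; split=> t /=; first by case.
  by rewrite /P /= !in_itv /= => /andP[h1 h2]; split; apply/andP; split; lra.
have I (g : R -> R) : (\int[mu]_(t in P) g t)%R = int01 (fun t => g t * \1_P t).
  rewrite -{1}DP Rintegral_mkcondr; apply: eq_Rintegral => t _.
  by rewrite /patch indicE; case: ifP => _; rewrite ?mulr1 ?mulr0.
have i1 : int01 (\1_P : R -> R) = 1 - 2 * d.
  transitivity (int01 (fun t => 1 * \1_P t)); first by apply: int01_eq => t _; rewrite mul1r.
  have muP : mu P = (1 - 2 * d)%:E.
    rewrite /P lebesgue_measure_itv /= lte_fin; case: ltP => h.
      by rewrite -EFinB; congr EFin; ring.
    by congr EFin; lra.
  by rewrite -(I (fun=> 1)) Rintegral_cst // mul1r; exact: (congr1 fine muP).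
rewrite -/P I -int01B //; last exact: bmM.
have b1 : bm (fun t : R => 1 - \1_P t : R) by exact: (bmB (bm_cst _ 1) bP).
rewrite (@int01_eq _ _ (fun t => f t * (1 - \1_P t))); last by move=> t _; ring.
have P01 t : 0 <= 1 - \1_P t :> R by rewrite indicE; case: (_ \in _); rewrite ?subrr ?subr0.
have bE : bm (fun t => E * (1 - \1_P t)) by exact: bmZ.
have eE : int01 (fun t => E * (1 - \1_P t)) = E * (2 * d).
  rewrite int01Z // int01B ?int01_cst ?i1 //; [ring|exact: bm_cst].
have fle t : `|f t * (1 - \1_P t)| <= E * (1 - \1_P t).
  by rewrite normrM (ger0_norm (P01 t)) ler_wpM2r.
rewrite ler_norml -eE -int01N //; apply/andP; split; apply: int01_le => //.
- exact: bmN.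
- exact: bmM.
- by move=> t _; have := fle t; rewrite ler_norml => /andP[].
- exact: bmM.
- by move=> t _; have := fle t; rewrite ler_norml => /andP[].
Qed.

Lemma uan_min_derive0 f B : uan f B -> (forall t, f 0 <= f t) -> derive1 f 0 = 0.
Proof.
move=> uf fmin; have [B1 _] := uf.
pose C := 10 * B ^+ 3.
have T h : h * derive1 f 0 <= f h - f 0 + C * h ^+ 2 /\ f h - f 0 - C * h ^+ 2 <= h * derive1 f 0.
  by have := uan_taylor 0 h uf; rewrite add0r ler_norml -/C => /andP[h1 h2]; split; lra.
have T' h : - (C * h ^+ 2) <= h * derive1 f 0.
  by have [_] := T h; have := fmin h; lra.
apply/eqP; rewrite eq_le; apply/andP; split.
  apply: (@le_add_lin _ _ C 1) => // h h0 _.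
  have q := T' (- h); rewrite sqrrN mulNr lerN2 in q.
  rewrite -(ler_pM2l h0); apply: le_trans q _.
  by rewrite le_eqVlt; apply/orP; left; apply/eqP; ring.
rewrite -oppr_le0; apply: (@le_add_lin _ _ C 1) => // h h0 _.
have q := T' h; rewrite -lerN2 opprK -mulrN in q.
rewrite -(ler_pM2l h0); apply: le_trans q _.
by rewrite le_eqVlt; apply/orP; left; apply/eqP; ring.
Qed.

(** The integral is the variation of the argument of [Z(s) - Z(0)], seen from a lowest point of the
    curve. Lowering the base point by [e = d ^+ 3] makes the vertical difference positive, so that
    [F e] is a primitive on [[d, 1 - d]]. The exponent 3 serves two purposes: the kernel changes by
    [O(e / d ^+ 2) = O(d)], while at the ends the vertical difference is [O(d ^+ 2)] against a
    horizontal one of order [d], so that [atan] tends to [pi / 2] and [- pi / 2]. *)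
Lemma winding_pos x y B m : curve x y B m -> (forall t, y 0 <= y t) -> 0 < derive1 x 0 ->
  dlpA x y (fun=> 1) 0 = pi.
Proof.
move=> cv ymin v0; have [ux uy px py m0 far] := cv; have [B1 _] := ux.
set v := derive1 x 0 in v0.
pose C := 10 * B ^+ 3.
have C0 : 0 < C by rewrite mulr_gt0 // exprn_gt0 //; lra.
have dy0 := uan_min_derive0 uy ymin.
have XP d : 0 < d -> d <= v / (2 * C) -> v * d / 2 <= x d - x 0 /\ x (- d) - x 0 <= - (v * d / 2).
  move=> d0 hd.
  have Cd : C * d ^+ 2 <= v * d / 2.
    rewrite expr2 mulrA [v * d / 2](_ : _ = (v / (2 * C) * C) * d); last by field; rewrite gt_eqF.
    by rewrite ler_pM2r // mulrC ler_pM2r.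
  have := uan_taylor 0 d ux; have := uan_taylor 0 (- d) ux.
  rewrite !add0r sqrrN -/C -/v !ler_norml => /andP[h1 h2] /andP[h3 h4]; split; lra.
have YP d : 0 <= y d - y 0 /\ y d - y 0 <= C * d ^+ 2.
  split; first by rewrite subr_ge0.
  by have := uan_taylor 0 d uy; rewrite add0r dy0 mulr0 subr0 ler_norml => /andP[].
clearbody v C.
have [K hK] := (bm_kr1 cv 0).2.
have K0 : 0 <= K by exact: le_trans (hK 0).
set w := dlpA x y (fun=> 1) 0.
have wE : w = int01 (kr x y 0) by apply: int01_eq => s _; rewrite mulr1.
pose L := K * 2 + (K * (4 * B + 1) + B ^+ 2) / m.
pose F e u := - atan ((x u - x 0) / (y u - y 0 + e)).
have key d : 0 < d -> d <= 4^-1 -> `|w - (F (d ^+ 3) (1 - d) - F (d ^+ 3) d)| <= L * d.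
  move=> d0 d4; set e := d ^+ 3; have e0 : 0 < e by rewrite exprn_gt0.
  have e1 : e <= d ^+ 2 * 1 by rewrite /e exprSr ler_wpM2l ?sqr_ge0 //; lra.
  pose g u := (knum x y 0 u - e * derive1 x u) / ((x u - x 0) ^+ 2 + (y u - y 0 + e) ^+ 2).
  have den u : 0 < (x u - x 0) ^+ 2 + (y u - y 0 + e) ^+ 2.
    by rewrite ltr_wpDl ?sqr_ge0 // exprn_gt0 //; have [] := YP u; lra.
  have dF u : is_derive u (1 : R) (F e) (g u).
    have Ye : y u - y 0 + e != 0 by rewrite gt_eqF //; have [] := YP u; lra.
    have Dx := uan_derive u ux; have Dy := uan_derive u uy.
    have Dn : is_derive u (1 : R) (fun z => x z - x 0) (derive1 x u).
      by apply: is_derive_eq; rewrite subr0.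
    have Dd : is_derive u (1 : R) (fun z => y z - y 0 + e) (derive1 y u).
      by apply: is_derive_eq; rewrite subr0 addr0.
    have Di := @is_deriveV _ (fun z => y z - y 0 + e) u _ 1 Ye Dd.
    have Dq : is_derive u (1 : R) (fun z => (x z - x 0) / (y z - y 0 + e))
        ((x u - x 0) * (- (y u - y 0 + e) ^- 2 * derive1 y u) + (y u - y 0 + e)^-1 * derive1 x u).
      exact: is_deriveM Dn Di.
    have Da := @is_derive1_comp _ atan (fun z => (x z - x 0) / (y z - y 0 + e)) _ _ _ (is_derive1_atan _) Dq.
    have := is_deriveN Da.
    suff -> : g u = - ((1 + ((x u - x 0) / (y u - y 0 + e)) ^+ 2)^-1 *
        ((x u - x 0) * (- (y u - y 0 + e) ^- 2 * derive1 y u) + (y u - y 0 + e)^-1 * derive1 x u)) by [].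
    rewrite /g /knum.
    have D1 := lt0r_neq0 (den u).
    move: D1 Ye; set X := x u - x 0; set Y := y u - y 0 => D1 Ye.
    have D2 : (Y + e) ^+ 2 + X ^+ 2 != 0 by rewrite addrC.
    field; rewrite Ye /= ?D1 ?D2 //.
  have cg : continuous g.
    move=> u; have cx := uan_continuous ux; have cy := uan_continuous uy.
    have cdx := uan_dcontinuous ux; have cdy := uan_dcontinuous uy.
    have c1 : {for u, continuous (fun z => x z - x 0)} by apply: cvgB; [exact: cx|exact: cvg_cst].
    have c2 : {for u, continuous (fun z => y z - y 0)} by apply: cvgB; [exact: cy|exact: cvg_cst].
    have c3 : {for u, continuous (fun z => y z - y 0 + e)} by apply: cvgD; [exact: c2|exact: cvg_cst].
    apply: cvgM.
      apply: cvgB; last by apply: cvgM; [exact: cvg_cst|exact: cdx].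
      by apply: cvgB; apply: cvgM => //; [exact: cdy|exact: cdx].
    apply: cvgV; first exact: lt0r_neq0.
    by apply: cvgD; rewrite /= expr2; under eq_fun do rewrite expr2; apply: cvgM.
  have d1 : d < 1 - d by lra.
  rewrite -(FTC_itv d1 dF cg).
  have bk := bm_kr1 cv 0.
  have d2 : d <= 2^-1 by lra.
  have h1 := int01_inner bk hK d0 d2.
  have ig : mu.-integrable `[d, 1 - d]%classic (EFin \o g).
    by apply: continuous_compact_integrable; [exact: segment_compact|exact: continuous_subspaceT].
  have ik : mu.-integrable `[d, 1 - d]%classic (EFin \o kr x y 0).
    apply: (integrableS _ _ _ (bm_integrable bk)); [exact: measurable_itv|exact: measurable_itv|].
    by move=> t /=; rewrite !in_itv /=; lra.
  have h2 : `|(\int[mu]_(t in `[d, 1 - d]) kr x y 0 t)%R - (\int[mu]_(t in `[d, 1 - d]) g t)%R| <= (K * (4 * B + 1) + B ^+ 2) / m * d.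
    rewrite -RintegralB //.
    apply: le_trans (le_normr_Rintegral _ _) _ => //.
      by apply: (eq_integrable _ _ _ _ (integrableB _ ik ig)) => //.
    apply: le_trans (_ : (\int[mu]_(t in `[d, (1 - d)%R]) ((K * (4 * B + 1) + B ^+ 2) / m * d))%R <= _); last first.
      have L0 : 0 <= (K * (4 * B + 1) + B ^+ 2) / m * d.
        by rewrite mulr_ge0 ?divr_ge0 ?(ltW m0) ?(ltW d0) // addr_ge0 ?sqr_ge0 // mulr_ge0 //; clear - B1; lra.
      rewrite Rintegral_cst //= lebesgue_measure_itv /= lte_fin d1 -EFinB /= ler_piMr //; clear - d0; lra.
    apply: le_Rintegral => //.
    - by apply: integrable_norm; apply: (eq_integrable _ _ _ _ (integrableB _ ik ig)).
    - apply: continuous_compact_integrable; first exact: segment_compact.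
      by apply: continuous_subspaceT => ?; exact: cvg_cst.
    move=> u /=; rewrite in_itv /= => /andP[u0 u1].
    have D0 : m * d ^+ 2 <= kden x y 0 u.
      have [u2|u2] := leP u 2^-1.
        have := far 0 u; rewrite add0r ger0_norm; last by clear - d0 u0; lra.
        move=> /(_ u2); apply: le_trans; rewrite ler_pM2l // lerXn2r ?nnegrE //; clear - d0 u0; lra.
      have := far 0 (u - 1); rewrite add0r ler0_norm; last by clear - d0 u1; lra.
      have e1' : x (u - 1) = x u by rewrite -[LHS]px subrK.
      have e2' : y (u - 1) = y u by rewrite -[LHS]py subrK.
      rewrite e1' e2' opprB => H; apply: le_trans (H _); last by clear - u2; lra.
      by rewrite ler_pM2l // -[(u - 1) ^+ 2]sqrrN opprB lerXn2r ?nnegrE //; clear - d0 u1; lra.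
    have D1 : 0 < kden x y 0 u by apply: lt_le_trans D0; rewrite mulr_gt0 // exprn_gt0.
    set De := (x u - x 0) ^+ 2 + (y u - y 0 + e) ^+ 2.
    have DeE : De = kden x y 0 u + (2 * e * (y u - y 0) + e ^+ 2) by rewrite /De /kden; ring.
    have Y0 : 0 <= y u - y 0 by have [] := YP u.
    have De0 : m * d ^+ 2 <= De.
      apply: le_trans D0 _; rewrite DeE lerDl; apply: addr_ge0; last exact: sqr_ge0.
      by apply: mulr_ge0 => //; apply: mulr_ge0 => //; exact: ltW.
    have Dep : 0 < De by exact: den.
    have -> : kr x y 0 u - g u = (kr x y 0 u * (2 * e * (y u - y 0) + e ^+ 2) + e * derive1 x u) / De.
      have E (n k q z : R) : k != 0 -> k + q != 0 -> n / k - (n - z) / (k + q) = (n / k * q + z) / (k + q).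
        by move=> k0 kq; field; rewrite k0 kq.
      by rewrite /g -/De /kr DeE; apply: E; rewrite -?DeE gt_eqF.
    rewrite normrM normfV (gtr0_norm Dep) ler_pdivrMr //.
    have Yb : y u - y 0 <= 2 * B by have := uan_bnd u uy; have := uan_bnd 0 uy; clear; rewrite !ler_norml; lra.
    have dxb := uan_dbnd u ux.
    have num : `|kr x y 0 u * (2 * e * (y u - y 0) + e ^+ 2) + e * derive1 x u| <= e * (K * (4 * B + 1) + B ^+ 2).
      apply: le_trans (ler_normD _ _) _; rewrite [X in _ <= X]mulrDr; apply: lerD; last first.
        by rewrite normrM (gtr0_norm e0) ler_pM2l.
      have -> : kr x y 0 u * (2 * e * (y u - y 0) + e ^+ 2) = e * (kr x y 0 u * (2 * (y u - y 0) + e)) by ring.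
      rewrite normrM (gtr0_norm e0) ler_pM2l // normrM.
      apply: ler_pM => //; rewrite ger0_norm; last by rewrite addr_ge0 ?mulr_ge0 // ltW.
      have : d ^+ 2 <= 1 by rewrite -(expr1n _ 2) lerXn2r ?nnegrE //; clear - d0 d4; lra.
      by clear - Yb e1; lra.
    apply: le_trans num _.
    have q0 : 0 <= K * (4 * B + 1) + B ^+ 2 by rewrite addr_ge0 ?sqr_ge0 // mulr_ge0 //; clear - B1; lra.
    have -> : (K * (4 * B + 1) + B ^+ 2) / m * d * De = (K * (4 * B + 1) + B ^+ 2) * (d / m * De) by ring.
    rewrite [e * _]mulrC ler_wpM2l //.
    apply: le_trans (_ : d / m * (m * d ^+ 2) <= _); last by rewrite ler_wpM2l // divr_ge0 ?ltW.
    rewrite (_ : d / m * (m * d ^+ 2) = d ^+ 3) //.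
    by field; rewrite gt_eqF.
  rewrite wE; move: h1 h2; set I1 := int01 _; set I2 := Rintegral _ _ _; set I3 := Rintegral _ _ _ => h1 h2.
  have -> : I1 - I3 = (I1 - I2) + (I2 - I3) by ring.
  apply: le_trans (ler_normD _ _) _; rewrite /L mulrDl -mulrA; exact: lerD.
have up : w <= pi.
  rewrite -subr_le0; apply: (@le_add_lin _ _ L 4^-1); first by rewrite invr_gt0.
  move=> d d0 d4; have := key d d0 d4; rewrite /F ler_norml => /andP[_].
  set a := (_ / _); set b := (_ / _).
  have := atan_gtNpi2 a; have := atan_ltpi2 b; lra.
have L0 : 0 <= L.
  apply: addr_ge0; first by rewrite mulr_ge0.
  apply: divr_ge0; last exact: ltW.
  by apply: addr_ge0; [apply: mulr_ge0 => //; lra|exact: sqr_ge0].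
apply/eqP; rewrite eq_le up /=.
clearbody w; rewrite /F in key; clearbody L; clear wE hK F cv ymin dy0 ux uy m0 far B1.
rewrite leNgt; apply/negP => lt.
pose eta := (pi - w) / 8.
have eta0 : 0 < eta by rewrite divr_gt0 // subr_gt0.
have etaE : 8 * eta = pi - w by rewrite /eta; field.
clearbody eta.
have [T [T0 HT]] : exists T, 0 < T /\ forall z, T <= z -> pi / 2 - eta <= atan z.
  have /cvgrPdist_le /(_ eta eta0) [M [_ HM]] := @cvgy_atan R.
  exists (`|M| + 1); have := normr_ge0 M; split; first lra.
  move=> z Tz; have := HM z; have := ler_norm M; move=> h2 /(_ _); rewrite /= ler_norml => h3.
  by have /andP[] := h3 ltac:(lra); lra.
(* The four bounds serve, in this order, the kernel estimate, the horizontal difference, the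
   quotient being at least [T], and the error [L * d <= eta]. *)
pose d := Num.min (Num.min 4^-1 (v / (2 * C))) (Num.min (v / (2 * (C + 1) * T)) (eta / (L + 1))).
have d0 : 0 < d.
  rewrite !lt_min invr_gt0 ltr0n !divr_gt0 //= ?mulr_gt0 //; clear - C0 L0; lra.
have [d1 d2 d3 d4] : [/\ d <= 4^-1, d <= v / (2 * C), d <= v / (2 * (C + 1) * T) & d <= eta / (L + 1)].
  by rewrite /d; split; rewrite !ge_min lexx ?orbT.
clearbody d.
have := key d d0 d1.
have e0 : 0 < d ^+ 3 by rewrite exprn_gt0.
have [X1 X2] := XP d d0 d2.
have [Y1 Y1'] := YP d; have [Y2 Y2'] := YP (- d); rewrite sqrrN in Y2'.
have xm : x (1 - d) = x (- d) by rewrite addrC px.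
have ym : y (1 - d) = y (- d) by rewrite addrC py.
rewrite xm ym.
have den z : 0 <= z -> z <= C * d ^+ 2 -> 0 < z + d ^+ 3 /\ T * (z + d ^+ 3) <= v * d / 2.
  move=> z0 z1; split; first by clear - e0 z0; lra.
  have : z + d ^+ 3 <= (C + 1) * d ^+ 2.
    by rewrite mulrDl mul1r lerD // exprS ler_piMl ?sqr_ge0 //; clear - d1; lra.
  move=> h; apply: le_trans (ler_wpM2l (ltW T0) h) _.
  have -> : T * ((C + 1) * d ^+ 2) = d * (2 * (C + 1) * T) * (d / 2) by field.
  have -> : v * d / 2 = v * (d / 2) by ring.
  rewrite ler_pM2r ?divr_gt0 // -ler_pdivlMr // mulr_gt0 // mulr_gt0 //; clear - C0; lra.
have [p1 q1] := den _ Y1 Y1'; have [p2 q2] := den _ Y2 Y2'.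
have A1 : pi / 2 - eta <= atan ((x d - x 0) / (y d - y 0 + d ^+ 3)).
  by apply: HT; rewrite ler_pdivlMr //; clear - q1 X1; lra.
have A2 : pi / 2 - eta <= - atan ((x (- d) - x 0) / (y (- d) - y 0 + d ^+ 3)).
  by rewrite -atanN; apply: HT; rewrite -mulNr ler_pdivlMr //; clear - q2 X2; lra.
have Ld : L * d <= eta.
  rewrite ler_pdivlMr in d4; last by clear - L0; lra.
  by have := ltW d0; clear - d4; lra.
rewrite ler_norml => /andP[h1 h2].
clear - Ld A1 A2 h1 h2 eta0 etaE; lra.
Qed.

Lemma curve_opp x y B m : curve x y B m -> exists B', curve (fun t => - x t) y B' m.
Proof.
move=> [ux uy px py m0 far].
have [B' u'] := uan_scale (-1) ux.
exists (Num.max B B'); split=> //.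
- have -> : (fun t => - x t) = (fun z => -1 * x z) by apply/funext => t; rewrite mulN1r.
  by apply: uan_le u' _; rewrite le_max lexx orbT.
- by apply: uan_le uy _; rewrite le_max lexx.
- by move=> t; rewrite px.
- move=> t h hh; have := far t h hh; congr (_ <= _); ring.
Qed.

Lemma derive1_opp x B t : uan x B -> derive1 (fun t => - x t) t = - derive1 x t.
Proof.
by move=> ux; have D := is_deriveN (uan_derive t ux); rewrite derive1E; apply: (@derive_val _ _ _ _ _ _ _ D).
Qed.

Lemma kr_opp x y B t s : uan x B -> kr (fun t => - x t) y t s = - kr x y t s.
Proof.
move=> ux; rewrite /kr /knum /kden (derive1_opp s ux) -[RHS]mulNr; congr (_ * _); last by congr (_^-1); ring.
ring.
Qed.

(** At a lowest point [y'] vanishes, so [x'] does not; if it is negative, the reflection of [x] into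
    [- x] changes the sign of the integral. The square removes the dependence on the orientation. *)
Lemma winding_sq x y B m : curve x y B m -> (forall t, y 0 <= y t) ->
  exists2 w, w ^+ 2 = pi ^+ 2 & forall t, dlpA x y (fun=> 1) t = w.
Proof.
move=> cv ymin; have [ux uy _ _ m0 _] := cv.
suff h : dlpA x y (fun=> 1) 0 ^+ 2 = pi ^+ 2.
  by exists (dlpA x y (fun=> 1) 0) => // t; exact: winding_cst cv t 0.
have dy0 := uan_min_derive0 uy ymin.
have [dx|dx] := ltP 0 (derive1 x 0); first by rewrite (winding_pos cv ymin dx).
have := curve_speed 0 cv; rewrite dy0 expr0n addr0 => sp.
have {}dx : derive1 x 0 < 0.
  by rewrite lt_neqAle dx andbT; apply/negP => /eqP e; rewrite e expr0n /= in sp; lra.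
have [B' cv'] := curve_opp cv.
have := winding_pos cv' ymin; rewrite (derive1_opp 0 ux) oppr_gt0 => /(_ dx) <-.
rewrite -[LHS]sqrrN; congr (_ ^+ 2); rewrite /dlpA -int01N.
  by apply: int01_eq => s _; rewrite (kr_opp _ _ _ ux) mulNr.
by apply: bmM; [exact: bm_kr1 cv 0|exact: bm_cst].
Qed.

End Winding.

(** * The Cauchy transform *)

Section ComplexIntegral.
Context {R : realType}.
Local Notation C := (R[i]).
Implicit Types (a b c : C) (t s : R).

Lemma ReM a b : complex.Re (a * b) = complex.Re a * complex.Re b - complex.Im a * complex.Im b.
Proof. by case: a; case: b. Qed.

Lemma ImM a b : complex.Im (a * b) = complex.Re a * complex.Im b + complex.Im a * complex.Re b.
Proof. by case: a; case: b. Qed.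

Lemma ReD a b : complex.Re (a + b) = complex.Re a + complex.Re b.
Proof. by case: a; case: b. Qed.

Lemma ImD a b : complex.Im (a + b) = complex.Im a + complex.Im b.
Proof. by case: a; case: b. Qed.

Lemma ReN a : complex.Re (- a) = - complex.Re a.
Proof. by case: a. Qed.

Lemma ImN a : complex.Im (- a) = - complex.Im a.
Proof. by case: a. Qed.

Lemma ReV a : complex.Re a^-1 = complex.Re a / (complex.Re a ^+ 2 + complex.Im a ^+ 2).
Proof. by case: a. Qed.

Lemma ImV a : complex.Im a^-1 = - complex.Im a / (complex.Re a ^+ 2 + complex.Im a ^+ 2).
Proof. by case: a => a b; rewrite mulNr. Qed.

Lemma complex_eq a b : complex.Re a = complex.Re b -> complex.Im a = complex.Im b -> a = b.
Proof. by case: a; case: b => /= ? ? ? ? -> ->. Qed.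

Definition cint (f : R -> C) : C := Complex (int01 (fun t => complex.Re (f t))) (int01 (fun t => complex.Im (f t))).

Definition cbm d (T : measurableType d) (f : T -> C) : Prop :=
  bm (fun z => complex.Re (f z)) /\ bm (fun z => complex.Im (f z)).

Lemma cbmM d (T : measurableType d) (f g : T -> C) : cbm f -> cbm g -> cbm (fun z => f z * g z).
Proof.
move=> [f1 f2] [g1 g2]; split.
  by under eq_fun do rewrite ReM; apply: bmB; exact: bmM.
by under eq_fun do rewrite ImM; apply: bmD; exact: bmM.
Qed.

Lemma cbmN d (T : measurableType d) (f : T -> C) : cbm f -> cbm (fun z => - f z).
Proof.
move=> [f1 f2]; split.
  by under eq_fun do rewrite ReN; exact: bmN.
by under eq_fun do rewrite ImN; exact: bmN.
Qed.

Lemma cbm_cst d (T : measurableType d) c : cbm (fun _ : T => c).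
Proof. by split; exact: bm_cst. Qed.

Lemma cbm_comp d d' (T : measurableType d) (T' : measurableType d') (f : T -> C) (g : T' -> T) :
  cbm f -> measurable_fun setT g -> cbm (fun z => f (g z)).
Proof. by move=> [f1 f2] mg; split; [exact: bm_comp f1 mg|exact: bm_comp f2 mg]. Qed.

Lemma cint_exceptl (ps : seq R) (f g : R -> C) : cbm g ->
  (forall t, 0 <= t <= 1 -> t \notin ps -> f t = g t) -> cint f = cint g.
Proof.
move=> [g1 g2] fg; congr Complex; apply: (@int01_exceptl _ ps) => // t t01 tps; by rewrite fg.
Qed.

Lemma cint_eq (f g : R -> C) : (forall t, 0 <= t <= 1 -> f t = g t) -> cint f = cint g.
Proof. by move=> fg; congr Complex; apply: int01_eq => t t01; rewrite fg. Qed.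

Lemma cintD (f g : R -> C) : cbm f -> cbm g -> cint (fun t => f t + g t) = cint f + cint g.
Proof.
move=> [f1 f2] [g1 g2]; apply: complex_eq; rewrite ?ReD ?ImD /= -int01D //; apply: int01_eq => t _.
  by rewrite ReD.
by rewrite ImD.
Qed.

Lemma cintZ c (f : R -> C) : cbm f -> cint (fun t => c * f t) = c * cint f.
Proof.
move=> [f1 f2]; apply: complex_eq; rewrite ?ReM ?ImM /=.
  rewrite -!int01Z // -int01B; [|exact: bmZ|exact: bmZ].
  by apply: int01_eq => t _; rewrite ReM.
rewrite -!int01Z // -int01D; [|exact: bmZ|exact: bmZ].
by apply: int01_eq => t _; rewrite ImM.
Qed.

Lemma cintB (f g : R -> C) : cbm f -> cbm g -> cint (fun t => f t - g t) = cint f - cint g.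
Proof.
move=> bf bg; rewrite cintD; [|by []|exact: cbmN].
congr (_ + _); rewrite -mulN1r -cintZ //.
by apply: cint_eq => t _; rewrite mulN1r.
Qed.

Lemma cbm_cint (F : R * R -> C) : cbm F -> cbm (fun s => cint (fun u => F (s, u))).
Proof. by move=> [F1 F2]; split => /=; [exact: (bm_int01 F1)|exact: (bm_int01 F2)]. Qed.

Lemma cint_fubini (F : R * R -> C) : cbm F ->
  cint (fun s => cint (fun u => F (s, u))) = cint (fun u => cint (fun s => F (s, u))).
Proof. by move=> [F1 F2]; rewrite /cint /= (int01_fubini F1) (int01_fubini F2). Qed.

Lemma cbm_sect1 (F : R * R -> C) s : cbm F -> cbm (fun u => F (s, u)).
Proof. by move=> [F1 F2]; split; [exact: (bm_sect1 s F1)|exact: (bm_sect1 s F2)]. Qed.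

Lemma cbm_sect2 (F : R * R -> C) u : cbm F -> cbm (fun s => F (s, u)).
Proof. by move=> [F1 F2]; split; [exact: (bm_sect2 u F1)|exact: (bm_sect2 u F2)]. Qed.

Lemma cbm_fst (f : R -> C) : cbm f -> cbm (fun p : R * R => f p.1).
Proof. by move=> bf; apply: cbm_comp => //; exact: measurable_fst. Qed.

Lemma cbm_snd (f : R -> C) : cbm f -> cbm (fun p : R * R => f p.2).
Proof. by move=> bf; apply: cbm_comp => //; exact: measurable_snd. Qed.

Lemma cbm_swap (F : R * R -> C) : cbm F -> cbm (fun p : R * R => F (p.2, p.1)).
Proof. by move=> [F1 F2]; split; [exact: (bm_swap F1)|exact: (bm_swap F2)]. Qed.

End ComplexIntegral.

(** * Difference quotients along the curve *)

Section Quotients.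
Context {R : realType}.
Variables (x y : R -> R) (B m : R).
Hypothesis cv : curve x y B m.
Implicit Types (t s h : R) (f g : R -> R).

Let ux : uan x B := cv_x cv.
Let uy : uan y B := cv_y cv.

Lemma curve_lip f Bf : uan f Bf -> (forall t, f (t + 1) = f t) ->
  exists2 L, 0 <= L & forall s u, (f u - f s) ^+ 2 <= L * kden x y s u.
Proof.
move=> uf fp; have [B1 _] := uf; have [_ _ px py m0 far] := cv.
exists ((12 * Bf ^+ 2) ^+ 2 / m); first by rewrite divr_ge0 ?sqr_ge0 // ltW.
move=> s u.
pose n := Num.floor (u - s + 2^-1).
have h1 := floor_le (u - s + 2^-1); have h2 := floorD1_gt (u - s + 2^-1).
rewrite -/n in h1 h2; rewrite intrD in h2.
have E (g : R -> R) z : (forall t, g (t + 1) = g t) -> g (z - n%:~R) = g z.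
  by move=> pf; rewrite -(periodic_int (z - n%:~R) n pf) subrK.
set h := u - s - n%:~R.
have sh : s + h = u - n%:~R by rewrite /h; ring.
have hl : `|h| <= 2^-1 by rewrite /h ler_norml; lra.
have := far s h hl; rewrite sh (E x) // (E y) // => D.
have := uan_lip s h uf; rewrite sh (E f) // => F.
apply: le_trans (norm_sqr_le F) _.
have -> : (12 * Bf ^+ 2 * `|h|) ^+ 2 = (12 * Bf ^+ 2) ^+ 2 * h ^+ 2 by rewrite exprMn real_normK ?num_real.
have -> : (12 * Bf ^+ 2) ^+ 2 / m * kden x y s u = (12 * Bf ^+ 2) ^+ 2 * (kden x y s u / m) by ring.
by rewrite ler_wpM2l ?sqr_ge0 // ler_pdivlMr // mulrC.
Qed.

(* The diagonal value is the limit, which makes [quot f g t] analytic. *)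
Definition quot f g t s : R := if kden x y t s == 0
  then derive1 f t * derive1 g t / (derive1 x t ^+ 2 + derive1 y t ^+ 2)
  else (f s - f t) * (g s - g t) / kden x y t s.

(** At a parameter [s0] of the same point as [t], all four differences are divided by their linear
    factor and the remaining denominator is at least [m]. At other parameters the chord is nonzero
    in a neighbourhood. *)
Lemma quot_uan f g Bf t : uan f Bf -> uan g Bf -> (forall t, f (t + 1) = f t) -> (forall t, g (t + 1) = g t) ->
  exists B', uan (quot f g t) B'.
Proof.
move=> uf ug fp gp; have [Bf1 _] := uf; have [_ _ px py m0 far] := cv.
have [B1 _] := ux.
apply: local_pexp_uan => [s|s0]; first by rewrite /quot /kden px py fp gp.
pose b := Num.max B Bf.
have Bb : B <= b by rewrite le_max lexx.
have Bfb : Bf <= b by rewrite le_max lexx orbT.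
have b0 : 0 < b by lra.
have mk k : uan k b -> exists a, pexp (fun z => k z + - k t) s0 a (2 * b) b.
  move=> uk; have [_ /(_ s0)[a ha]] := uk.
  eexists; apply: pexp_le (pexp_add ha (pexp_cst (- k t) s0 b0)) _ (lexx _).
  by rewrite normrN; have := uan_bnd t uk; lra.
have [ax hx] := mk x (uan_le ux Bb); have [ay hy] := mk y (uan_le uy Bb).
have [af hf] := mk f (uan_le uf Bfb); have [ag hg] := mk g (uan_le ug Bfb).
have [D0|D0] := eqVneq (kden x y t s0) 0.
  have [n sn] := kden_eq0 cv D0.
  have z4 : `|0 : R| * b <= 4^-1 by rewrite normr0 mul0r invr_ge0.
  have dv k a : uan k b -> (forall t, k (t + 1) = k t) -> pexp (fun z => k z + - k t) s0 a (2 * b) b ->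
      exists q c, [/\ pexp q s0 c (2 * (2 * b) * b) b, forall h, `|h| * b <= 2^-1 -> k (s0 + h) - k t = h * q (s0 + h) & q s0 = derive1 k t].
    move=> uk kp hk.
    have [|q [c [hq kq _]]] := pexp_div hk z4.
      by rewrite addr0 sn (periodic_int t n kp) subrr.
    exists q, c; split=> //; first by move=> h hh; rewrite kq // subr0.
    have := @pexp_div_deriv _ (fun z => k z + - k t) _ _ _ _ _ _ hq z4 kq.
    rewrite addr0 => <-.
    have [_ /(_ s0)[a' ha']] := uk.
    rewrite (uan_coef1 (pexp_add ha' (pexp_cst (- k t) s0 b0))) addr0 -(uan_coef1 ha') sn.
    by rewrite (periodic_int t n (uan_dperiodic uk kp)).
  have [qx [cx [hqx xq xd]]] := dv x ax (uan_le ux Bb) px hx.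
  have [qy [cy [hqy yq yd]]] := dv y ay (uan_le uy Bb) py hy.
  have [qf [cf [hqf fq fd]]] := dv f af (uan_le uf Bfb) fp hf.
  have [qg [cg [hqg gq gd]]] := dv g ag (uan_le ug Bfb) gp hg.
  have em : m <= (qx s0) ^+ 2 + (qy s0) ^+ 2 by rewrite xd yd; exact: curve_speed cv.
  have [e he] := pexp_inv_sqr m0 em hqx hqy.
  have hfg := pexp_mul hqf hqg.
  set M1 := (X in pexp _ _ _ X _) in hfg; set c1 := (X in pexp _ _ _ _ X) in hfg.
  set M2 := (X in pexp _ _ _ X _) in he; set c2 := (X in pexp _ _ _ _ X) in he.
  pose c3 := Num.max 1 (Num.max c1 c2).
  have c13 : c1 <= c3 by rewrite /c3 !le_max lexx orbT.
  have c23 : c2 <= c3 by rewrite /c3 !le_max lexx !orbT.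
  have c03 : 1 <= c3 by rewrite /c3 le_max lexx.
  have hq := pexp_mul (pexp_le hfg (lexx _) c13) (pexp_le he (lexx _) c23).
  eexists; eexists; eexists; apply: pexp_eq hq _ => h hh.
  have hb : `|h| * b <= 2^-1.
    apply: le_trans hh; rewrite ler_wpM2l //; rewrite /c1 in c13; clear - ux uy c13 b0; lra.
  have h1 : `|h| < 1.
    apply: le_lt_trans (_ : 2^-1 < 1); last by clear - ux uy; lra.
    apply: le_trans hh; rewrite ler_peMr //; clear - ux uy c03; lra.
  have [h0|h0] := eqVneq h 0.
    by rewrite /quot h0 addr0 D0 eqxx fd gd xd yd.
  have Dn : kden x y t (s0 + h) != 0.
    have D0' : kden x y s0 t = 0 by rewrite -D0 /kden; ring.
    have := kden_neq0_near cv D0' h0 h1.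
    by rewrite (_ : kden x y (s0 + h) t = kden x y t (s0 + h)) // /kden; ring.
  rewrite /quot (negbTE Dn) fq // gq //.
  have DE : kden x y t (s0 + h) = h ^+ 2 * (qx (s0 + h) ^+ 2 + qy (s0 + h) ^+ 2).
    by rewrite /kden xq // yq //; ring.
  move: Dn; rewrite DE mulf_eq0 negb_or sqrf_eq0 => /andP[_ qn].
  by field; rewrite qn h0.
have Dp : 0 < kden x y t s0 by rewrite lt_neqAle eq_sym D0 kden_ge0.
have [e he] := @pexp_inv_sqr _ (fun z => x z + - x t) (fun z => y z + - y t) _ _ _ _ _ _ Dp (lexx _) hx hy.
have hfg := pexp_mul hf hg.
set M1 := (X in pexp _ _ _ X _) in hfg; set c1 := (X in pexp _ _ _ _ X) in hfg.
set M2 := (X in pexp _ _ _ X _) in he; set c2 := (X in pexp _ _ _ _ X) in he.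
have [d d0 hd] : exists2 d, 0 < d & forall h, `|h| < d -> kden x y t (s0 + h) != 0.
  have cd : {for s0, continuous (fun v => kden x y t v)}.
    rewrite /kden; apply: cvgD.
      by apply: (@cvg_comp _ _ _ (fun v => x v - x t) (fun w => w ^+ 2)); [apply: cvgB; [exact: (uan_continuous ux)|exact: cvg_cst]|exact: exprn_continuous].
    by apply: (@cvg_comp _ _ _ (fun v => y v - y t) (fun w => w ^+ 2)); [apply: cvgB; [exact: (uan_continuous uy)|exact: cvg_cst]|exact: exprn_continuous].
  have /nbhs_ballP[d d0 hd] : \forall v \near s0, kden x y t v != 0 by exact: cvgr_neq0 cd D0.
  exists d => // h hh; apply: hd; rewrite /ball /= opprD addrA subrr add0r normrN //.
pose c3 := Num.max d^-1 (Num.max c1 c2).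
have c13 : c1 <= c3 by rewrite /c3 !le_max lexx orbT.
have c23 : c2 <= c3 by rewrite /c3 !le_max lexx !orbT.
have c03 : d^-1 <= c3 by rewrite /c3 le_max lexx.
have hq := pexp_mul (pexp_le hfg (lexx _) c13) (pexp_le he (lexx _) c23).
eexists; eexists; eexists; apply: pexp_eq hq _ => h hh.
have hdd : `|h| < d.
  have : `|h| * d^-1 <= 4^-1 by apply: le_trans (_ : `|h| * c3 <= _); [rewrite ler_wpM2l|lra].
  rewrite ler_pdivrMr // => q; clear - ux uy q d0; lra.
by rewrite /quot (negbTE (hd _ hdd)) /kden.
Qed.

End Quotients.

(** * The Cauchy transform and the exchange of a singular double integral *)

Section CauchyTransform.
Context {R : realType}.
Variables (x y : R -> R) (B m w : R).
Hypothesis cv : curve x y B m.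
Hypothesis wE : forall t, dlpA x y (fun=> 1) t = w.
Local Notation C := (R[i]).
Implicit Types (t s u h : R) (e : R -> R) (f g q : R -> C).

Let ux : uan x B := cv_x cv.
Let uy : uan y B := cv_y cv.

Local Notation rC r := (Complex r 0 : C).

Definition cZ t : C := Complex (x t) (y t).
Definition cZ' t : C := Complex (derive1 x t) (derive1 y t).
Definition cG s t : C := (cZ s - cZ t)^-1.

Lemma cG_Re s t : complex.Re (cG s t) = (x s - x t) / kden x y t s.
Proof. by rewrite /cG ReV. Qed.

Lemma cG_Im s t : complex.Im (cG s t) = - (y s - y t) / kden x y t s.
Proof. by rewrite /cG ImV. Qed.

Lemma cZ_eq s t : cZ s = cZ t <-> kden x y t s = 0.
Proof.
split; first by case; rewrite /kden => -> ->; rewrite !subrr expr0n addr0.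
move/eqP; rewrite paddr_eq0 ?sqr_ge0 // !sqrf_eq0 !subr_eq0 => /andP[/eqP h1 /eqP h2].
by rewrite /cZ h1 h2.
Qed.

Lemma cG_inv s t : kden x y t s != 0 -> (cZ s - cZ t) * cG s t = 1.
Proof.
by move=> D0; rewrite /cG divff // subr_eq0; apply: contra_neq D0 => /cZ_eq.
Qed.

Lemma cG_anti s t : cG s t = - cG t s.
Proof. by rewrite /cG -invrN opprB. Qed.

Lemma cG0 s t : kden x y t s = 0 -> cG s t = 0.
Proof. by move/cZ_eq => E; rewrite /cG E subrr invr0. Qed.

Lemma cbmZ' : cbm cZ'.
Proof. by split; [exact: uan_dbm ux|exact: uan_dbm uy]. Qed.

Lemma bm_diff e : bm e -> bm (fun p : R * R => e p.2 - e p.1).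
Proof. by move=> be; apply: bmB; [exact: bm_snd|exact: bm_fst]. Qed.

Lemma bm_ext d (T : measurableType d) (e e' : T -> R) : bm e -> e =1 e' -> bm e'.
Proof. by move=> be /funext <-. Qed.

Lemma measurable_kden : measurable_fun setT (fun p : R * R => kden x y p.1 p.2).
Proof.
have mx : measurable_fun setT (fun p : R * R => x p.2 - x p.1).
  by have [] := bm_diff (uan_bm ux).
have my : measurable_fun setT (fun p : R * R => y p.2 - y p.1).
  by have [] := bm_diff (uan_bm uy).
by apply: measurable_funD; apply: measurable_funX.
Qed.

(** Lipschitz with respect to the chord, in squared form: difference quotients against [Z] are then
    bounded. *)
Definition clip e := bm e /\ exists2 L, 0 <= L & forall s u, (e u - e s) ^+ 2 <= L * kden x y s u.

Lemma uan_clip e Be : uan e Be -> (forall t, e (t + 1) = e t) -> clip e.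
Proof. by move=> ue pe; split; [exact: uan_bm ue|exact: curve_lip cv _ _ ue pe]. Qed.

Lemma clip_x : clip x. Proof. exact: uan_clip ux (cv_px cv). Qed.
Lemma clip_y : clip y. Proof. exact: uan_clip uy (cv_py cv). Qed.

Lemma div_le_sq (a b D L L' : R) : 0 <= D -> 0 <= L -> 0 <= L' -> a ^+ 2 <= L * D -> b ^+ 2 <= L' * D ->
  `|a * b / D| <= L + L'.
Proof.
move=> D0 L0 L0' ha hb; have [->|Dn] := eqVneq D 0.
  by rewrite invr0 mulr0 normr0 addr_ge0.
have Dp : 0 < D by rewrite lt_neqAle eq_sym Dn.
rewrite normrM normfV (gtr0_norm Dp) ler_pdivrMr //.
have h1 : 0 <= (a - b) ^+ 2 by exact: sqr_ge0.
have h2 : 0 <= (a + b) ^+ 2 by exact: sqr_ge0.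
by rewrite ler_norml; apply/andP; split; nra.
Qed.

Lemma bm_quot e e' : clip e -> clip e' ->
  bm (fun p : R * R => (e p.2 - e p.1) * (e' p.2 - e' p.1) / kden x y p.1 p.2).
Proof.
move=> [be [L L0 hL]] [be' [L' L0' hL']]; split.
  apply: measurable_funM; last exact: measurable_fun_inv measurable_kden.
  by have [] := bmM (bm_diff be) (bm_diff be').
by exists (L + L') => p; apply: div_le_sq => //; exact: kden_ge0.
Qed.

Lemma cbm_quot f : clip (fun t => complex.Re (f t)) -> clip (fun t => complex.Im (f t)) ->
  cbm (fun p : R * R => (f p.2 - f p.1) * cG p.2 p.1).
Proof.
move=> c1 c2; split.
  under eq_fun do rewrite ReM cG_Re cG_Im ReD ImD ReN ImN.
  by apply: bm_ext (bmD (bm_quot c1 clip_x) (bm_quot c2 clip_y)) _ => p; ring.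
under eq_fun do rewrite ImM cG_Re cG_Im ReD ImD ReN ImN.
by apply: bm_ext (bmB (bm_quot c2 clip_x) (bm_quot c1 clip_y)) _ => p; ring.
Qed.

(** The Cauchy transform with [f t] subtracted; for chord-Lipschitz [f] the integrand is bounded and
    no principal value is involved. *)
Definition TT f t : C := cint (fun s => cZ' s * ((f s - f t) * cG s t)).

Local Notation eps n := (n.+1%:R^-1 : R).

Let eps0 n : 0 < eps n. Proof. by rewrite invr_gt0 ltr0n. Qed.

(* A regularization of the indicator of [Z(s) <> Z(t)]. *)
Definition damp n t s : R := kden x y t s / (kden x y t s + eps n).

Let Dpos n t s : 0 < kden x y t s + eps n.
Proof. exact: ltr_wpDl (kden_ge0 _ _ _ _) (eps0 n). Qed.

Lemma damp_bnd n t s : `|damp n t s| <= 1.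
Proof.
have D := kden_ge0 x y t s; rewrite ger0_norm ?divr_ge0 ?(ltW (Dpos _ _ _)) //.
by rewrite ler_pdivrMr // mul1r lerDl ltW.
Qed.

Lemma bm_damp n : bm (fun p : R * R => damp n p.1 p.2).
Proof.
split; last by exists 1 => p; exact: damp_bnd.
apply: measurable_funM; first exact: measurable_kden.
by apply: measurable_fun_inv; apply: measurable_funD => //; exact: measurable_kden.
Qed.

Lemma damp_cvg t s : kden x y t s != 0 -> damp n t s @[n --> \oo] --> (1 : R).
Proof.
move=> D0; have -> : (1 : R) = kden x y t s / (kden x y t s + 0) by rewrite addr0 divff.
apply: cvgM; first exact: cvg_cst.
apply: cvgV; first by rewrite addr0.
by apply: cvgD; [exact: cvg_cst|exact: cvg_harmonic].
Qed.

Lemma cvg_ext (a b : nat -> R) (l : R) : a =1 b -> a n @[n --> \oo] --> l -> b n @[n --> \oo] --> l.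
Proof. by move=> /funext ->. Qed.

(** Splitting a difference [q u - q s] in a Cauchy integrand leaves two halves that need not be
    integrable. They are separated under the factor [damp], which this lemma removes afterwards. *)
Lemma regularize_cvg (F : R * R -> R) : bm F -> (forall s u, kden x y s u = 0 -> F (s, u) = 0) ->
  int01 (fun s => int01 (fun u => damp n s u * F (s, u))) @[n --> \oo] --> int01 (fun s => int01 (fun u => F (s, u))).
Proof.
move=> bF F0; have [_ [M hM]] := bF.
have bG n : bm (fun p : R * R => damp n p.1 p.2 * F p).
  exact: (bmM (bm_damp n) bF).
have bd n s u : `|damp n s u * F (s, u)| <= M.
  rewrite normrM; apply: le_trans (hM (s, u)); exact: ler_piMl (normr_ge0 _) (damp_bnd _ _ _).
apply: (@int01_dct _ _ _ M) => [n||n s _|s _].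
- exact: (bm_int01 (bG n)).
- exact: (bm_int01 bF).
- by apply: int01_bnd => // ; exact: (bm_sect1 s (bG n)).
apply: (@int01_dct _ _ _ M) => [n||n u _|u _].
- exact: (bm_sect1 s (bG n)).
- exact: (bm_sect1 s bF).
- exact: bd.
have [D0|D0] := eqVneq (kden x y s u) 0.
  by rewrite F0 //; under eq_fun do rewrite mulr0; exact: cvg_cst.
rewrite -[X in _ --> X]mul1r; apply: cvgM; [exact: damp_cvg|exact: cvg_cst].
Qed.

Definition ccvg (a : nat -> C) (l : C) : Prop :=
  (complex.Re (a n) @[n --> \oo] --> complex.Re l) /\ (complex.Im (a n) @[n --> \oo] --> complex.Im l).

Lemma ccvg_unique a l l' : ccvg a l -> ccvg a l' -> l = l'.
Proof.
move=> [a1 a2] [b1 b2].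
by apply: complex_eq; [exact: cvg_unique a1 b1|exact: cvg_unique a2 b2].
Qed.

Let ceps n u s : C := rC (damp n u s) * cG s u.

Let ceps_anti n u s : ceps n u s = - ceps n s u.
Proof.
by rewrite /ceps cG_anti mulrN /damp (_ : kden x y u s = kden x y s u) // /kden; ring.
Qed.

Let ceps_cbm n : cbm (fun p : R * R => ceps n p.1 p.2).
Proof.
have h (k : R -> R) : bm k -> bm (fun p : R * R => (k p.2 - k p.1) * (kden x y p.1 p.2 + eps n)^-1).
  move=> bk; apply: bmM; first by apply: bmB; [exact: bm_snd|exact: bm_fst].
  split.
    by apply: measurable_fun_inv; apply: measurable_funD => //; exact: measurable_kden.
  exists (eps n)^-1 => p; rewrite ger0_norm ?invr_ge0 ?(ltW (Dpos _ _ _)) //.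
  by rewrite lef_pV2 ?posrE // lerDr kden_ge0.
have E (D a : R) : (D = 0 -> a = 0) -> D / (D + eps n) * (a / D) = a * (D + eps n)^-1.
  move=> Da; have [D0|D0] := eqVneq D 0; first by rewrite D0 Da // !mul0r.
  by rewrite mulrC mulrA divfK.
split.
  apply: bm_ext (h x (uan_bm ux)) _ => p.
  rewrite /ceps ReM cG_Re cG_Im /= mul0r subr0 /damp E // => D0.
  by have [->] := (cZ_eq _ _).2 D0; rewrite subrr.
apply: bm_ext (bmN (h y (uan_bm uy))) _ => p.
rewrite /ceps ImM cG_Re cG_Im /= mul0r addr0 /damp E ?mulNr // => D0.
by have [_ ->] := (cZ_eq _ _).2 D0; rewrite subrr oppr0.
Qed.

Definition kreg n t : R := int01 (fun s => damp n t s * kr x y t s).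

Lemma kreg_cvg t : kreg n t @[n --> \oo] --> w.
Proof.
have [_ [M hM]] := bm_kr cv.
have -> : w = int01 (fun s => kr x y t s).
  by rewrite -(wE t); apply: int01_eq => s _; rewrite mulr1.
apply: (@int01_dct _ _ _ M) => [n||n s _|s _].
- apply: bmM; [exact: (bm_sect1 t (bm_damp n))|exact: (bm_kr1 cv)].
- exact: (bm_kr1 cv t).
- rewrite normrM; apply: le_trans (hM (t, s)); exact: ler_piMl (normr_ge0 _) (damp_bnd _ _ _).
have [D0|D0] := eqVneq (kden x y t s) 0.
  by rewrite /kr D0 invr0 mulr0; under eq_fun do rewrite mulr0; exact: cvg_cst.
rewrite -[X in _ --> X]mul1r; apply: cvgM; [exact: damp_cvg|exact: cvg_cst].
Qed.

Lemma is_derive_log_kden (e : R) t s : 0 < e ->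
  is_derive s (1 : R) (fun z => 2^-1 * ln (kden x y t z + e))
    (((x s - x t) * derive1 x s + (y s - y t) * derive1 y s) / (kden x y t s + e)).
Proof.
move=> e0; have D0 : 0 < kden x y t s + e by exact: ltr_wpDl (kden_ge0 _ _ _ _) e0.
have dx := uan_derive s ux; have dy := uan_derive s uy.
have dD : is_derive s (1 : R) (fun z => kden x y t z + e) (2 * ((x s - x t) * derive1 x s + (y s - y t) * derive1 y s)).
  rewrite /kden.
  apply: is_derive_eq.
  rewrite /GRing.scale /=; ring.
have dl := @is_derive1_comp _ (@ln R) (fun z => kden x y t z + e) s _ _ (is_derive1_ln D0) dD.
have dl' := is_deriveZ (2^-1 : R) dl.
apply: (is_derive_eq dl'); rewrite /GRing.scale /=.
by field; rewrite gt_eqF.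
Qed.

Lemma continuous_kden t : continuous (kden x y t).
Proof.
have cx := uan_continuous ux; have cy := uan_continuous uy.
move=> s; rewrite /kden; apply: cvgD.
  by apply: (@cvg_comp _ _ _ (fun v => x v - x t) (fun z => z ^+ 2)); [apply: cvgB; [exact: cx|exact: cvg_cst]|exact: exprn_continuous].
by apply: (@cvg_comp _ _ _ (fun v => y v - y t) (fun z => z ^+ 2)); [apply: cvgB; [exact: cy|exact: cvg_cst]|exact: exprn_continuous].
Qed.

Lemma continuous_dlog_kden (e : R) t : 0 < e ->
  continuous (fun s => ((x s - x t) * derive1 x s + (y s - y t) * derive1 y s) / (kden x y t s + e)).
Proof.
move=> e0 s.
have cx := uan_continuous ux; have cy := uan_continuous uy.
have cx' := uan_dcontinuous ux; have cy' := uan_dcontinuous uy.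
apply: cvgM.
  apply: cvgD; (apply: cvgM; [apply: cvgB; [|exact: cvg_cst]|]); [exact: cx|exact: cx'|exact: cy|exact: cy'].
apply: cvgV; first by rewrite gt_eqF // ltr_wpDl // kden_ge0.
by apply: cvgD; [exact: continuous_kden|exact: cvg_cst].
Qed.

(* The real part integrates the derivative of [1/2 ln (|Z(s) - Z(t)|^2 + eps)] over a period. *)
Lemma cint_ceps n t : cint (fun s => cZ' s * ceps n t s) = Complex 0 (kreg n t).
Proof.
have EE (a b c d e f : R) : a = c -> b = d -> Complex a b = Complex c d by move=> -> ->.
apply: EE => //.
  pose F' s := ((x s - x t) * derive1 x s + (y s - y t) * derive1 y s) / (kden x y t s + eps n).
  transitivity (int01 F').
    apply: int01_eq => s _; rewrite ReM /ceps ReM ImM cG_Re cG_Im /= /damp /F'.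
    have [D0|D0] := eqVneq (kden x y t s) 0.
      have [-> ->] := (cZ_eq _ _).2 D0; rewrite !subrr; ring.
    have := Dpos n t s; move: (kden x y t s + _) => E E0.
    by field; rewrite D0 gt_eqF.
  rewrite (FTC01 (fun s => is_derive_log_kden t s (eps0 n)) (continuous_dlog_kden (eps0 n))) /kden -[1]add0r (cv_px cv) (cv_py cv); ring.
apply: int01_eq => s _; rewrite ImM /ceps ReM ImM cG_Re cG_Im /= /damp /kr /knum.
rewrite /=; ring.
Qed.

(* The regularized double integral is twice an iterated one, because the Cauchy kernel is
   antisymmetric. *)
Lemma Cauchy_commutator q : clip (fun t => complex.Re (q t)) -> clip (fun t => complex.Im (q t)) ->
  cint (fun s => cint (fun u => cZ' s * cZ' u * ((q u - q s) * cG u s))) =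
  Complex 0 (- (2 * w)) * cint (fun u => cZ' u * q u).
Proof.
move=> c1 c2.
have bq : cbm q by split; [case: c1|case: c2].
pose H (p : R * R) := cZ' p.1 * cZ' p.2 * ((q p.2 - q p.1) * cG p.2 p.1).
have bH : cbm H.
  by apply: cbmM (cbm_quot c1 c2); apply: cbmM; [exact: cbm_fst cbmZ'|exact: cbm_snd cbmZ'].
pose X n (p : R * R) : C := cZ' p.1 * cZ' p.2 * q p.2 * ceps n p.1 p.2.
pose Y n (p : R * R) : C := cZ' p.1 * cZ' p.2 * q p.1 * ceps n p.1 p.2.
have bX n : cbm (X n).
  apply: cbmM (ceps_cbm n); apply: cbmM (cbm_snd bq).
  by apply: cbmM; [exact: cbm_fst cbmZ'|exact: cbm_snd cbmZ'].
have bY n : cbm (Y n).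
  apply: cbmM (ceps_cbm n); apply: cbmM (cbm_fst bq).
  by apply: cbmM; [exact: cbm_fst cbmZ'|exact: cbm_snd cbmZ'].
pose a n := cint (fun s => cint (fun u => rC (damp n s u) * H (s, u))).
have aX n : a n = 2 * cint (fun u => cint (fun s => X n (s, u))).
  have -> : a n = cint (fun s => cint (fun u => X n (s, u)) - cint (fun u => Y n (s, u))).
    apply: cint_eq => s _; rewrite -cintB; [|exact: (cbm_sect1 s (bX n))|exact: (cbm_sect1 s (bY n))].
    by apply: cint_eq => u _; rewrite /H /X /Y /ceps /=; ring.
  rewrite cintB; [|exact: (cbm_cint (bX n))|exact: (cbm_cint (bY n))].
  have -> : cint (fun s => cint (fun u => Y n (s, u))) = - cint (fun u => cint (fun s => X n (s, u))).
    rewrite -mulN1r -cintZ; last exact: (cbm_cint (cbm_swap (bX n))).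
    apply: cint_eq => s _; rewrite -cintZ; last exact: (cbm_sect2 s (bX n)).
    by apply: cint_eq => u _; rewrite /X /Y /= ceps_anti; ring.
  rewrite (cint_fubini (bX n)); ring.
have aE n : a n = 2 * cint (fun u => rC (kreg n u) * (Complex 0 (-1) * (cZ' u * q u))).
  rewrite aX; congr (_ * _); apply: cint_eq => u _.
  transitivity (- (cZ' u * q u) * cint (fun s => cZ' s * ceps n u s)).
    rewrite -cintZ; last by apply: cbmM cbmZ' (cbm_sect1 u (ceps_cbm n)).
    by apply: cint_eq => s _; rewrite /X /= ceps_anti; ring.
  rewrite cint_ceps; case: (cZ' u * q u) => r1 r2.
  by apply: complex_eq; rewrite !(ReM, ImM, ReN, ImN) /=; ring.
apply: (@ccvg_unique a).
  have F0 s u : kden x y s u = 0 -> H (s, u) = 0.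
    by move=> D0; rewrite /H /= cG0 // !mulr0.
  split.
    apply: (fun k => cvg_ext k (regularize_cvg bH.1 (fun s u k => congr1 (@complex.Re R) (F0 s u k)))) => n.
    by apply: int01_eq => s _; apply: int01_eq => u _; rewrite [RHS]ReM mul0r subr0.
  apply: (fun k => cvg_ext k (regularize_cvg bH.2 (fun s u k => congr1 (@complex.Im R) (F0 s u k)))) => n.
  by apply: int01_eq => s _; apply: int01_eq => u _; rewrite [RHS]ImM mul0r addr0.
have -> : Complex 0 (- (2 * w)) * cint (fun u => cZ' u * q u) =
    2 * cint (fun u => rC w * (Complex 0 (-1) * (cZ' u * q u))).
  have b1 : cbm (fun u => cZ' u * q u) by exact: cbmM cbmZ' bq.
  rewrite cintZ; last by apply: cbmM => //; exact: cbm_cst.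
  rewrite cintZ // !mulrA; congr (_ * _).
  by apply: complex_eq; rewrite !(ReM, ImM, ReN, ImN) /=; ring.
have [_ [M hM]] := bm_kr cv.
have b1 : cbm (fun u => Complex 0 (-1) * (cZ' u * q u)).
  by apply: cbmM; [exact: cbm_cst|exact: cbmM cbmZ' bq].
have key (h : R -> R) : bm h -> int01 (fun u => kreg n u * h u) @[n --> \oo] --> int01 (fun u => w * h u).
  move=> bh; have [_ [K hK]] := bh.
  have bk n : bm (kreg n) by exact: (bm_int01 (bmM (bm_damp n) (bm_kr cv))).
  apply: (@int01_dct _ _ _ (M * K)) => [n||n u _|u _].
  - exact: bmM.
  - exact: bmZ.
  - rewrite normrM ler_pM //; apply: int01_bnd => [|s _].
      by apply: bmM; [exact: (bm_sect1 u (bm_damp n))|exact: (bm_kr1 cv)].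
    rewrite normrM; apply: le_trans (hM (u, s)); exact: ler_piMl (normr_ge0 _) (damp_bnd _ _ _).
  by apply: cvgM; [exact: kreg_cvg|exact: cvg_cst].
have two (f : R -> C) : 2 * cint f = Complex (2 * complex.Re (cint f)) (2 * complex.Im (cint f)).
  by apply: complex_eq; rewrite !(ReM, ImM) /=; ring.
have lim2 (h : R -> R) (bh : bm h) (b : nat -> R) l : l = 2 * int01 (fun u => w * h u) ->
    (forall n, b n = 2 * int01 (fun u => kreg n u * h u)) -> b n @[n --> \oo] --> l.
  move=> -> bE; apply: (cvg_ext (fun n => esym (bE n))).
  by apply: cvgM; [exact: cvg_cst|exact: key].
split.
  apply: (lim2 _ b1.1) => [|n].
    by rewrite two; congr (2 * _); apply: int01_eq => u _; rewrite ReM mul0r subr0.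
  by rewrite aE two; congr (2 * _); apply: int01_eq => u _; rewrite ReM mul0r subr0.
apply: (lim2 _ b1.2) => [|n].
  by rewrite two; congr (2 * _); apply: int01_eq => u _; rewrite ImM mul0r addr0.
by rewrite aE two; congr (2 * _); apply: int01_eq => u _; rewrite ImM mul0r addr0.
Qed.

End CauchyTransform.

(** * The square of the Cauchy transform *)

Section CauchySquare.
Context {R : realType}.
Variables (x y : R -> R) (B m w : R).
Hypothesis cv : curve x y B m.
Hypothesis wE : forall t, dlpA x y (fun=> 1) t = w.
Local Notation C := (R[i]).
Implicit Types (t s u h : R) (e : R -> R) (f g q : R -> C).

Let ux : uan x B := cv_x cv.
Let uy : uan y B := cv_y cv.
Local Notation Z := (cZ x y).
Local Notation Z' := (cZ' x y).
Local Notation G := (cG x y).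
Local Notation A := (dlpA x y).
Local Notation rC r := (Complex r 0 : C).

(* On real functions the transform [TT] is [CC + i (dlpA - w)]; see [TT_ReIm]. *)
Definition crr t s : R := ((x s - x t) * derive1 x s + (y s - y t) * derive1 y s) / kden x y t s.
Definition CC e t : R := int01 (fun s => (e s - e t) * crr t s).

(** The chord-Lipschitz condition at the single point [t]: for the transform of a function the
    constant is obtained from a bound of [W t], which depends on [t]. *)
Definition ptlip t e := bm e /\ exists2 L, 0 <= L & forall s, (e s - e t) ^+ 2 <= L * kden x y t s.

Lemma clip_ptlip t e : clip x y e -> ptlip t e.
Proof. by move=> [be [L L0 hL]]; split=> //; exists L. Qed.

Lemma bm_pquot t e e' : ptlip t e -> ptlip t e' -> bm (fun s => (e s - e t) * (e' s - e' t) / kden x y t s).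
Proof.
move=> [be [L L0 hL]] [be' [L' L0' hL']]; split.
  have mk : measurable_fun setT (fun s => kden x y t s).
    by apply: measurableT_comp (measurable_kden cv) (pair1_measurable t).
  apply: measurable_funM; last exact: measurable_fun_inv mk.
  by have [] := bmM (bmB be (bm_cst _ (e t))) (bmB be' (bm_cst _ (e' t))).
by exists (L + L') => s; apply: div_le_sq => //; exact: kden_ge0.
Qed.

Lemma bm_CC t e : ptlip t e -> bm (fun s => (e s - e t) * crr t s).
Proof.
move=> pe.
have hx := bmM (uan_dbm ux) (bm_pquot pe (clip_ptlip t (clip_x cv))).
have hy := bmM (uan_dbm uy) (bm_pquot pe (clip_ptlip t (clip_y cv))).
by apply: bm_ext (bmD hx hy) _ => s; rewrite /crr; ring.
Qed.

Lemma CC_lin t e e' (a b : R) : ptlip t e -> ptlip t e' ->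
  CC (fun s => a * e s + b * e' s) t = a * CC e t + b * CC e' t.
Proof.
move=> /bm_CC pe /bm_CC pe'; rewrite /CC -!int01Z // -int01D; try exact: bmZ.
by apply: int01_eq => s _; ring.
Qed.

Lemma bm_kre t e : bm e -> bm (fun s => kr x y t s * e s).
Proof. by move=> be; apply: bmM => //; exact: bm_kr1 cv t. Qed.

Lemma dlpA_lin t e e' (a b : R) : bm e -> bm e' ->
  A (fun s => a * e s + b * e' s) t = a * A e t + b * A e' t.
Proof.
move=> be be'; rewrite /dlpA -!int01Z; try exact: bm_kre.
rewrite -int01D; try by apply: bmZ; exact: bm_kre.
by apply: int01_eq => s _; ring.
Qed.

Lemma dlpA_diff t e : bm e -> int01 (fun s => (e s - e t) * kr x y t s) = A e t - w * e t.
Proof.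
move=> be; rewrite -(wE t) /dlpA mulrC -int01Z; last by apply: bm_kre; exact: bm_cst.
rewrite -int01B; [|exact: bm_kre|by apply: bmZ; apply: bm_kre; exact: bm_cst].
by apply: int01_eq => s _; ring.
Qed.

Lemma TT_ReIm t g : ptlip t (fun s => complex.Re (g s)) -> ptlip t (fun s => complex.Im (g s)) ->
  let g1 s := complex.Re (g s) in let g2 s := complex.Im (g s) in
  TT x y g t = Complex (CC g1 t - (A g2 t - w * g2 t)) (A g1 t - w * g1 t + CC g2 t).
Proof.
move=> p1 p2 g1 g2.
have b1 : bm g1 by case: p1. have b2 : bm g2 by case: p2.
have bk e : bm e -> bm (fun s => (e s - e t) * kr x y t s).
  by move=> be; apply: bmM; [apply: bmB => //; exact: bm_cst|exact: bm_kr1 cv t].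
apply: complex_eq => /=.
  rewrite -dlpA_diff // /CC -int01B; [|exact: bm_CC|exact: bk].
  apply: int01_eq => s _; rewrite !(ReM, ImM, cG_Re, cG_Im, ReD, ImD, ReN, ImN) /g1 /g2 /crr /kr /knum /=; ring.
rewrite -dlpA_diff // /CC -int01D; [|exact: bk|exact: bm_CC].
apply: int01_eq => s _; rewrite !(ReM, ImM, cG_Re, cG_Im, ReD, ImD, ReN, ImN) /g1 /g2 /crr /kr /knum /=; ring.
Qed.

Variables (e : R -> R) (Be : R).
Hypotheses (ue : uan e Be) (pe : forall t, e (t + 1) = e t).

Let ce : clip x y e := uan_clip cv ue pe.

(** This is [(e s - e t) / (Z s - Z t)], extended to the diagonal through [quot]. *)
Let q t s : C := Complex (quot x y e x t s) (- quot x y e y t s).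

Let q_clip t : clip x y (fun s => complex.Re (q t s)) /\ clip x y (fun s => complex.Im (q t s)).
Proof.
have pk k s : (forall t, k (t + 1) = k t) -> quot x y e k t (s + 1) = quot x y e k t s.
  move=> kp; rewrite /quot pe kp (_ : kden x y t (s + 1) = kden x y t s) //.
  by rewrite /kden (cv_px cv) (cv_py cv).
have uk k Bk : uan k Bk -> (forall t, k (t + 1) = k t) -> exists B', uan (quot x y e k t) B'.
  move=> uk kp.
  have h1 : Be <= Num.max Be Bk by rewrite le_max lexx.
  have h2 : Bk <= Num.max Be Bk by rewrite le_max lexx orbT.
  exact: (quot_uan cv t (uan_le ue h1) (uan_le uk h2) pe kp).
have [B1 u1] := uk x B ux (cv_px cv); have [B2 u2] := uk y B uy (cv_py cv).
split=> /=; first by apply: (uan_clip cv u1) => s; exact: pk (cv_px cv).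
have [b2 [L L0 hL]] := uan_clip cv u2 (fun s => pk y s (cv_py cv)).
split; first exact: bmN.
by exists L => // s u; rewrite -opprD sqrrN.
Qed.

Let q_eq t s : rC (e s) - rC (e t) = q t s * (Z s - Z t).
Proof.
have [D0|D0] := eqVneq (kden x y t s) 0.
  rewrite ((cZ_eq x y s t).2 D0) subrr mulr0.
  have [_ [L _ /(_ t s)]] := ce; rewrite D0 mulr0 => h.
  have /eqP : (e s - e t) ^+ 2 = 0 by apply/eqP; rewrite eq_le h sqr_ge0.
  by rewrite sqrf_eq0 subr_eq0 => /eqP ->; rewrite subrr.
rewrite /q /quot (negbTE D0).
apply: complex_eq; rewrite !(ReM, ImM, cG_Re, cG_Im, ReD, ImD, ReN, ImN) /=; last by ring.
have D1 : kden x y t s / kden x y t s = 1 by rewrite divff.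
rewrite -[LHS]mulr1 -D1 {1}/kden; ring.
Qed.

Let f s : C := rC (e s).

Let bmq t : cbm (q t).
Proof. by have [[? _] [? _]] := q_clip t. Qed.

Let TT_q t : TT x y f t = cint (fun s => Z' s * q t s).
Proof.
have [p hp] := kden_eq0_01 cv t.
apply: (@cint_exceptl _ [:: p; 1]); first exact: cbmM (cbmZ' cv) (bmq t).
move=> s s01; rewrite !inE negb_or => /andP[sp s1].
by rewrite /f q_eq -mulrA cG_inv ?mulr1 //; exact: hp.
Qed.

Let W t s : C := cint (fun u => Z' u * ((q t u - q t s) * G u s)).

Let bH t : cbm (fun p : R * R => Z' p.2 * ((q t p.2 - q t p.1) * G p.2 p.1)).
Proof.
have [c1 c2] := q_clip t.
by apply: cbmM (cbm_quot cv c1 c2); exact: cbm_snd (cbmZ' cv).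
Qed.

Let bF : cbm (fun p : R * R => Z' p.2 * ((f p.2 - f p.1) * G p.2 p.1)).
Proof.
apply: cbmM; first exact: cbm_snd (cbmZ' cv).
apply: (cbm_quot cv) => //=.
by split; [exact: bm_cst|exists 0 => // s u; rewrite subrr expr0n mul0r].
Qed.

(** Off the exceptional parameters, the difference of the integrands at [s] and at [t] is
    [Z s - Z t] times the integrand of the transform of [q t] at [s]. *)
Let TT_diff t s : TT x y f s - TT x y f t = (Z s - Z t) * W t s.
Proof.
rewrite /TT -cintB; [|exact: (cbm_sect1 s bF)|exact: (cbm_sect1 t bF)].
have bW : cbm (fun u => Z' u * ((q t u - q t s) * G u s)) by exact: (cbm_sect1 s (bH t)).
rewrite /W -cintZ //.
have [p hp] := kden_eq0_01 cv t; have [p' hp'] := kden_eq0_01 cv s.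
apply: (@cint_exceptl _ [:: p; 1; p']); first by apply: cbmM bW; exact: cbm_cst.
move=> u u01; rewrite !inE !negb_or => /and3P[up u1 up'].
have g1 := cG_inv (hp u u01 up u1); have g2 := cG_inv (hp' u u01 up' u1).
have e1 := q_eq t u; have e2 := q_eq t s.
have -> : f u - f s = q t u * (Z u - Z t) - q t s * (Z s - Z t).
  by rewrite -e1 -e2 /f; ring.
rewrite /f e1 -(mulrA (q t u)) g1 mulr1.
have -> : q t u * (Z u - Z t) - q t s * (Z s - Z t) = q t u * (Z u - Z s) + (Z s - Z t) * (q t u - q t s) by ring.
transitivity (Z' u * (q t u * ((Z u - Z s) * G u s) - q t u) + (Z s - Z t) * (Z' u * ((q t u - q t s) * G u s))); first by ring.
by rewrite g2; ring.
Qed.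

Let bW t : cbm (W t). Proof. exact: (cbm_cint (bH t)). Qed.

Let TT_ptlip t : ptlip t (fun s => complex.Re (TT x y f s)) /\ ptlip t (fun s => complex.Im (TT x y f s)).
Proof.
have [bT1 bT2] : cbm (TT x y f) by exact: (cbm_cint bF).
have [[_ [M1 hM1]] [_ [M2 hM2]]] := bW t.
have M10 : 0 <= M1 by exact: le_trans (normr_ge0 _) (hM1 0).
have M20 : 0 <= M2 by exact: le_trans (normr_ge0 _) (hM2 0).
have key (a b c d : R) : `|c| <= M1 -> `|d| <= M2 ->
    (a * c - b * d) ^+ 2 <= 2 * (M1 ^+ 2 + M2 ^+ 2) * (a ^+ 2 + b ^+ 2) /\
    (a * d + b * c) ^+ 2 <= 2 * (M1 ^+ 2 + M2 ^+ 2) * (a ^+ 2 + b ^+ 2).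
  move=> /norm_sqr_le hc /norm_sqr_le hd.
  have a0 := sqr_ge0 a; have b0 := sqr_ge0 b.
  have h : (c ^+ 2 + d ^+ 2) * (a ^+ 2 + b ^+ 2) <= (M1 ^+ 2 + M2 ^+ 2) * (a ^+ 2 + b ^+ 2).
    by apply: ler_wpM2r; [exact: addr_ge0|exact: lerD].
  have s1 := sqr_ge0 (a * c - b * d); have s2 := sqr_ge0 (a * d + b * c).
  have E : (a * c - b * d) ^+ 2 + (a * d + b * c) ^+ 2 = (c ^+ 2 + d ^+ 2) * (a ^+ 2 + b ^+ 2) by ring.
  split; lra.
have L0 : 0 <= 2 * (M1 ^+ 2 + M2 ^+ 2) by rewrite mulr_ge0 // addr_ge0 ?sqr_ge0.
split; split=> //; exists (2 * (M1 ^+ 2 + M2 ^+ 2)) => // s.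
  rewrite -ReN -ReD TT_diff ReM !(ReD, ImD, ReN, ImN) /=.
  by have [] := key (x s - x t) (y s - y t) _ _ (hM1 s) (hM2 s).
rewrite -ImN -ImD TT_diff ImM !(ReD, ImD, ReN, ImN) /=.
by have [] := key (x s - x t) (y s - y t) _ _ (hM1 s) (hM2 s).
Qed.

(** [TT_diff] turns the iterated transform into the double integral of [q t] evaluated by
    [Cauchy_commutator]. After division by [- 2 i w] this is idempotence of the transform. *)
Lemma TT_sqr t : TT x y (TT x y f) t = Complex 0 (- (2 * w)) * TT x y f t.
Proof.
have [c1 c2] := q_clip t.
rewrite [in RHS]TT_q -(Cauchy_commutator cv wE c1 c2) /TT.
have [p hp] := kden_eq0_01 cv t.
transitivity (cint (fun s => Z' s * W t s)).
  apply: (@cint_exceptl _ [:: p; 1]); first exact: cbmM (cbmZ' cv) (bW t).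
  move=> s s01; rewrite !inE negb_or => /andP[sp s1].
  rewrite TT_diff (_ : _ * G s t = (Z s - Z t) * G s t * W t s); last by ring.
  by rewrite cG_inv ?mul1r //; exact: hp.
apply: cint_eq => s _; rewrite /W -cintZ; last exact: (cbm_sect1 s (bH t)).
by apply: cint_eq => u _; rewrite mulrA.
Qed.

Let TTf t : TT x y f t = Complex (CC e t) (A e t - w * e t).
Proof.
have [be _] := ce.
have b0 : ptlip t (fun=> 0).
  by split; [exact: bm_cst|exists 0 => // s; rewrite subrr expr0n mul0r].
rewrite TT_ReIm /=; [|exact: clip_ptlip|by []].
have -> : A (fun=> 0) t = 0.
  rewrite /dlpA -[RHS](int01_cst 0); apply: int01_eq => s _; exact: mulr0.
have -> : CC (fun=> 0) t = 0.
  by rewrite /CC -[RHS](int01_cst 0); apply: int01_eq => s _; rewrite subrr mul0r.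
by apply: complex_eq => /=; ring.
Qed.

Lemma CC_ptlip t : ptlip t (CC e).
Proof.
have [+ _] := TT_ptlip t.
by congr ptlip; apply: funext => s; rewrite TTf.
Qed.

(** Real and imaginary parts of [TT_sqr] for the transform [CC + i (A - w)]; the terms linear in [w]
    cancel. *)
Lemma CC_dlpA t : CC (CC e) t = A (A e) t - w ^+ 2 * e t /\ A (CC e) t + CC (A e) t = 0.
Proof.
have := TT_sqr t.
have [be _] := ce.
have [B' uA] := dlpA_uan cv be.
have pA : ptlip t (A e) by apply: clip_ptlip; apply: (uan_clip cv uA); exact: dlpA_periodic cv e.
have [p1 p2] := TT_ptlip t.
rewrite TT_ReIm // TTf.
have -> : (fun s => complex.Re (TT x y f s)) = CC e by apply: funext => s; rewrite TTf.
have -> : (fun s => complex.Im (TT x y f s)) = (fun s => 1 * A e s + (- w) * e s).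
  by apply: funext => s; rewrite TTf /=; ring.
rewrite CC_lin //; last exact: clip_ptlip.
have [bA _] := pA.
rewrite dlpA_lin // => h.
have hR := congr1 (@complex.Re R) h; have hI := congr1 (@complex.Im R) h.
rewrite ReM /= in hR; rewrite ImM /= in hI.
move: hR hI; set c := CC (CC e) t; set d := A (A e) t; set g := A e t; set k := A (CC e) t; set l := CC (A e) t.
set n := CC e t; move: c d g k l n (e t) => c d g k l n r hR hI; split.
  by rewrite -[c](addrK (- (1 * d + - w * g - w * (g - w * r)))) hR; ring.
have -> : k + l = (k - w * n + (1 * l + - w * n)) + 2 * w * n by ring.
by rewrite hI; ring.
Qed.

End CauchySquare.

(** * The logarithmic energy *)

Section PositiveKernel.
Context {R : realType}.
Implicit Types (t s : R) (f g : R -> R) (n N : nat).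

Lemma le_add_geometric (r y z K : R) N0 : 0 <= r < 1 ->
  (forall N, (N0 <= N)%N -> y <= z + K * r ^+ N) -> y <= z.
Proof.
move=> /andP[r0 r1] h.
have : z + K * r ^+ N @[N --> \oo] --> z + K * 0.
  apply: cvgD; first exact: cvg_cst.
  by apply: cvgM; [exact: cvg_cst|apply: cvg_expr; rewrite ger0_norm].
rewrite mulr0 addr0 => c; rewrite -(cvg_lim (@Rhausdorff R) c).
apply: limr_ge; first by apply/cvg_ex; exists z.
by near=> N; apply: h; near: N; exact: nbhs_infty_ge.
Unshelve. all: by end_near.
Qed.

(** Mean value theorem for the remainder along the segment from 0 to [q]: its derivative is a single
    geometric term. *)
Lemma ln_series_bound (r q : R) N : 0 <= r < 1 -> `|q| <= r ->
  `|- ln (1 - q) - \sum_(i < N) q ^+ i.+1 / i.+1%:R| <= r ^+ N / (1 - r).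
Proof.
move=> /andP[r0 r1] qr.
pose g z := - ln (1 - z * q) - \sum_(i < N) (z * q) ^+ i.+1 / i.+1%:R.
pose g' z := q * ((z * q) ^+ N / (1 - z * q)).
have zq (z : R) : 0 <= z <= 1 -> `|z * q| <= r.
  move=> /andP[z0 z1]; rewrite normrM (ger0_norm z0); apply: le_trans qr; exact: ler_piMl.
have pos (z : R) : 0 <= z <= 1 -> 1 - r <= 1 - z * q.
  by move=> /zq; rewrite ler_norml; lra.
have dg (z : R) : 0 <= z <= 1 -> is_derive z (1 : R) g (g' z).
  move=> /pos p; have p0 : 0 < 1 - z * q by lra.
  have dl : is_derive z (1 : R) (fun z => 1 - z * q) (- q).
    by apply: is_derive_eq; rewrite /GRing.scale /=; ring.
  have dln := @is_derive1_comp _ (@ln R) (fun z => 1 - z * q) z _ _ (is_derive1_ln p0) dl.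
  have ds : is_derive z (1 : R) (fun z => \sum_(i < N) (z * q) ^+ i.+1 / i.+1%:R) (q * \sum_(i < N) (z * q) ^+ i).
    rewrite mulr_sumr.
    have di (i : 'I_N) : is_derive z (1 : R) (fun z => (z * q) ^+ i.+1 / i.+1%:R) (q * (z * q) ^+ i).
      have dq : is_derive z (1 : R) (fun z => z * q) q.
        by apply: is_derive_eq; rewrite /GRing.scale /=; ring.
      have := is_deriveZ (i.+1%:R^-1 : R) (is_deriveX i.+1 dq).
      have -> : i.+1%:R^-1 \*: (fun z0 : R => z0 * q) ^+ i.+1 = (fun z => (z * q) ^+ i.+1 / i.+1%:R).
        by apply: funext => v; rewrite /= /GRing.scale /= mulrC fctE.
      move=> h; apply: (is_derive_eq h); by rewrite /GRing.scale /=; field; rewrite ?nat1r ?natr1 pnatr_eq0.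
    have := is_derive_sum di.
    by congr is_derive; apply: funext => v; rewrite fct_sumE.
  have h := is_deriveB (is_deriveN dln) ds.
  apply: (is_derive_eq h); rewrite /g'.
  have -> : \sum_(i < N) (z * q) ^+ i = (1 - (z * q) ^+ N) / (1 - z * q).
    have <- : (1 - z * q) * (\sum_(i < N) (z * q) ^+ i) = 1 - (z * q) ^+ N.
      rewrite -[in RHS](expr1n R N) subrXX; congr (_ * _).
      by apply: eq_bigr => i _; rewrite expr1n mul1r.
    by rewrite [RHS]mulrC mulKf ?gt_eqF.
  by field; rewrite gt_eqF.
have cg : {within `[0, 1], continuous g}.
  apply: derivable_within_continuous => z; rewrite in_itv /= => /dg; case => //.
have [||c] := @MVT _ g g' 0 1 _ _ cg; [exact: ltr01|by move=> z; rewrite in_itv /= => /andP[z0 z1]; apply: dg; rewrite !ltW|].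
rewrite in_itv /= => /andP[/ltW c0 /ltW c1].
have -> : g 0 = 0.
  rewrite /g mul0r subr0 ln1 oppr0 add0r big1 ?oppr0 // => i _.
  by rewrite ?mul0r expr0n mul0r.
rewrite !subr0 mulr1 {1}/g mul1r => ->.
have c01 : 0 <= c <= 1 by rewrite c0.
have p := pos c c01; have p0 : 0 < 1 - r by lra.
rewrite /g' !normrM normfV (ger0_norm (_ : 0 <= 1 - c * q)); last lra.
have h1 : `|(c * q) ^+ N| <= r ^+ N by rewrite normrX; apply: lerXn2r; rewrite ?nnegrE //; exact: zq.
have h2 : (1 - c * q)^-1 <= (1 - r)^-1 by rewrite lef_pV2 ?posrE //; lra.
apply: (@le_trans _ _ (1 * (r ^+ N / (1 - r)))); last by rewrite mul1r.
apply: ler_pM => //; first by rewrite mulr_ge0 // invr_ge0; lra.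
  lra.
by apply: ler_pM => //; rewrite invr_ge0; lra.
Qed.

Lemma bm_sum d (T : measurableType d) (I : Type) (r : seq I) (F : I -> T -> R) :
  (forall i, bm (F i)) -> bm (fun z => \sum_(i <- r) F i z).
Proof.
move=> bF; elim: r => [|i r IH]; first by under eq_fun do rewrite big_nil; exact: bm_cst.
by under eq_fun do rewrite big_cons; exact: bmD.
Qed.

Lemma bmX d (T : measurableType d) (f : T -> R) n : bm f -> bm (fun z => f z ^+ n).
Proof.
move=> bf; elim: n => [|n IH]; first by under eq_fun do rewrite expr0; exact: bm_cst.
by under eq_fun do rewrite exprS; exact: bmM.
Qed.

Lemma int01_sum (I : Type) (r : seq I) (F : I -> R -> R) : (forall i, bm (F i)) ->
  int01 (fun t => \sum_(i <- r) F i t) = \sum_(i <- r) int01 (F i).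
Proof.
move=> bF; elim: r => [|i r IH].
  by rewrite big_nil -[RHS](int01_cst 0); apply: int01_eq => t _; rewrite big_nil.
rewrite big_cons -IH -int01D //; last exact: bm_sum.
by apply: int01_eq => t _; rewrite big_cons.
Qed.

Variables (k : nat) (psi : 'I_k -> R -> R).
Hypothesis bpsi : forall i, bm (psi i).
Implicit Types (c : 'I_k -> R).

Definition psd c t s : R := \sum_(i < k) c i * (psi i t * psi i s).

(** The quadratic form of the pointwise power of order [n] of the kernel [psd c]. *)
Definition moment c n f : R := int01 (fun t => int01 (fun s => f t * f s * psd c t s ^+ n)).

Lemma bm_psd c : bm (fun p : R * R => psd c p.1 p.2).
Proof.
apply: bm_sum => i; apply: bmZ; apply: bmM; [exact: bm_fst|exact: bm_snd].
Qed.

Lemma bm_moment c n f : bm f -> bm (fun p : R * R => f p.1 * f p.2 * psd c p.1 p.2 ^+ n).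
Proof.
move=> bf; apply: bmM; first by apply: bmM; [exact: bm_fst|exact: bm_snd].
by apply: bmX; exact: bm_psd.
Qed.

Lemma moment0 c f : bm f -> moment c 0 f = int01 f ^+ 2.
Proof.
move=> bf; rewrite expr2 -int01Z //; apply: int01_eq => t _.
rewrite mulrC -int01Z //.
by apply: int01_eq => s _; rewrite expr0 mulr1.
Qed.

(** Schur's product theorem one factor at a time: expanding a single factor [psd] passes [psi i] to
    the test function, so positivity descends to order 0, where the form is a square. *)
Lemma momentS c n f : bm f -> moment c n.+1 f = \sum_(i < k) c i * moment c n (fun t => f t * psi i t).
Proof.
move=> bf.
have bb i := bm_moment c n (bmM bf (bpsi i)).
transitivity (\sum_(i < k) int01 (fun t => c i * int01 (fun s => f t * psi i t * (f s * psi i s) * psd c t s ^+ n))).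
  rewrite -int01_sum => [|i]; last by apply: bmZ; exact: (bm_int01 (bb i)).
  apply: int01_eq => t _.
  transitivity (\sum_(i < k) int01 (fun s => c i * (f t * psi i t * (f s * psi i s) * psd c t s ^+ n))).
    rewrite -int01_sum => [|i]; last by apply: bmZ; exact: (bm_sect1 t (bb i)).
    apply: int01_eq => s _; rewrite exprS {1}/psd mulr_suml mulr_sumr.
    by apply: eq_bigr => i _; ring.
  by apply: eq_bigr => i _; rewrite int01Z //; exact: (bm_sect1 t (bb i)).
by apply: eq_bigr => i _; rewrite int01Z //; exact: (bm_int01 (bb i)).
Qed.

Lemma moment_ge0 c n f : (forall i, 0 <= c i) -> bm f -> 0 <= moment c n f.
Proof.
move=> c0; elim: n f => [|n IH] f bf; first by rewrite moment0 // sqr_ge0.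
by rewrite momentS // sumr_ge0 // => i _; rewrite mulr_ge0 // IH //; exact: bmM.
Qed.

(** In [momentS] all terms are nonnegative with positive weights, so the vanishing of the moments is
    inherited by every [f * psi i]. *)
Lemma moments_eq0 c f : (forall i, 0 < c i) -> bm f -> (forall n, moment c n f = 0) ->
  forall n t, int01 (fun s => f s * psd c t s ^+ n) = 0.
Proof.
move=> c0 bf f0 n t; elim: n f bf f0 => [|n IH] f bf f0.
  have /eqP := f0 0%N; rewrite moment0 // sqrf_eq0 => /eqP <-.
  by apply: int01_eq => s _; rewrite expr0 mulr1.
have z i j : moment c j (fun t => f t * psi i t) = 0.
  have /eqP := f0 j.+1; rewrite momentS // psumr_eq0 => [|l _]; last first.
    by apply: mulr_ge0; [rewrite ltW|apply: moment_ge0; [move=> o; rewrite ltW|exact: bmM]].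
  by move=> /allP /(_ i (mem_index_enum _)); rewrite mulf_eq0 (gt_eqF (c0 i)) => /eqP.
have bb i : bm (fun s => f s * psi i s * psd c t s ^+ n).
  by apply: bmM; [exact: bmM|apply: bmX; exact: (bm_sect1 t (bm_psd c))].
transitivity (\sum_(i < k) int01 (fun s => c i * psi i t * (f s * psi i s * psd c t s ^+ n))).
  rewrite -int01_sum => [|i]; last exact: bmZ.
  apply: int01_eq => s _; rewrite exprS mulrCA {1}/psd mulr_suml.
  by apply: eq_bigr => i _; ring.
apply: big1 => i _; rewrite (int01Z _ (bb i)) (IH _ _ (z i)) ?mulr0 //; exact: bmM.
Qed.

(** Every term in the expansion of [- ln (1 - Q)] contributes a nonnegative amount, so each one
    alone is a lower bound. A term is kept, rather than 0, for the sake of the equality case. *)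
Lemma log_kernel_ge c f n (r : R) : (forall i, 0 <= c i) -> bm f -> 0 <= r < 1 ->
  (forall t s, `|psd c t s| <= r) -> bm (fun p : R * R => ln (1 - psd c p.1 p.2)) ->
  moment c n.+1 f / n.+1%:R <= - int01 (fun t => int01 (fun s => f t * f s * ln (1 - psd c t s))).
Proof.
move=> c0 bf r01 cr bl.
have [_ [E hE]] := bf.
have E0 : 0 <= E by exact: le_trans (normr_ge0 _) (hE 0).
have bff : bm (fun p : R * R => f p.1 * f p.2) by apply: bmM; [exact: bm_fst|exact: bm_snd].
have bL : bm (fun p : R * R => f p.1 * f p.2 * ln (1 - psd c p.1 p.2)) by exact: bmM bff bl.
have bS i := bmZ (i.+1%:R^-1) (bm_moment c i.+1 bf).
have SE N : \sum_(i < N) moment c i.+1 f / i.+1%:R =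
    int01 (fun t => int01 (fun s => \sum_(i < N) i.+1%:R^-1 * (f t * f s * psd c t s ^+ i.+1))).
  transitivity (\sum_(i < N) int01 (fun t => int01 (fun s => i.+1%:R^-1 * (f t * f s * psd c t s ^+ i.+1)))).
    apply: eq_bigr => i _; rewrite mulrC /moment -int01Z; last exact: (bm_int01 (bm_moment c i.+1 bf)).
    by apply: int01_eq => t _; rewrite -int01Z //; exact: (bm_sect1 t (bm_moment c i.+1 bf)).
  rewrite -int01_sum => [|i]; last exact: (bm_int01 (bS i)).
  by apply: int01_eq => t _; rewrite -int01_sum // => i; exact: (bm_sect1 t (bS i)).
apply: (@le_add_geometric r _ _ (E * E / (1 - r)) n.+1) => // N nN.
apply: (@le_trans _ _ (\sum_(i < N) moment c i.+1 f / i.+1%:R)).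
  rewrite (bigD1 (Ordinal nN)) //= lerDl sumr_ge0 // => i _.
  by rewrite divr_ge0 // moment_ge0.
have bSN : bm (fun p : R * R => \sum_(i < N) i.+1%:R^-1 * (f p.1 * f p.2 * psd c p.1 p.2 ^+ i.+1)).
  by apply: bm_sum => i; exact: bS.
rewrite -subr_le0 opprD addrA SE opprK -int01D; [|exact: (bm_int01 bSN)|exact: (bm_int01 bL)].
have bT : bm (fun p : R * R => \sum_(i < N) i.+1%:R^-1 * (f p.1 * f p.2 * psd c p.1 p.2 ^+ i.+1) +
   f p.1 * f p.2 * ln (1 - psd c p.1 p.2)) by exact: bmD bSN bL.
rewrite subr_le0.
under [X in int01 X]eq_fun => t do rewrite -(int01D (bm_sect1 t bSN) (bm_sect1 t bL)).
apply: le_trans (ler_norm _) _; apply: int01_bnd => [|t _]; first exact: (bm_int01 bT).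
apply: int01_bnd => [|s _]; first exact: (bm_sect1 t bT).
have -> : \sum_(i < N) i.+1%:R^-1 * (f t * f s * psd c t s ^+ i.+1) + f t * f s * ln (1 - psd c t s) =
   - (f t * f s) * (- ln (1 - psd c t s) - \sum_(i < N) psd c t s ^+ i.+1 / i.+1%:R).
  rewrite mulrBr mulrNN mulNr opprK addrC mulr_sumr; congr (_ + _).
  by apply: eq_bigr => i _; ring.
rewrite normrM normrN normrM.
have -> : E * E / (1 - r) * r ^+ N = E * E * (r ^+ N / (1 - r)) by ring.
apply: ler_pM => //; first exact: ler_pM.
exact: ln_series_bound.
Qed.

End PositiveKernel.

(** * The energy as a limit of positive quadratic forms *)

Section Energy.
Context {R : realType}.
Variables (x y : R -> R) (B m : R).
Hypothesis cv : curve x y B m.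
Implicit Types (t s h e : R) (u f : R -> R) (n : nat).

Let ux : uan x B := cv_x cv.
Let uy : uan y B := cv_y cv.
Local Notation CC := (CC x y).
Local Notation crr := (crr x y).
Local Notation eps n := (n.+1%:R^-1 : R).

Lemma bm_lnkden e : 0 < e -> bm (fun p : R * R => ln (kden x y p.1 p.2 + e)).
Proof.
move=> e0; split.
  apply: (measurableT_comp (@measurable_ln R)).
  by apply: measurable_funD => //; exact: measurable_kden cv.
pose M : R := 8 * B ^+ 2 + e.
exists (`|ln e| + `|ln M|) => p.
have D0 := kden_ge0 x y p.1 p.2.
have DM : kden x y p.1 p.2 + e <= M.
  have h1 := norm_sqr_le (uan_bnd p.1 ux); have h2 := norm_sqr_le (uan_bnd p.1 uy).
  have h3 := norm_sqr_le (uan_bnd p.2 ux); have h4 := norm_sqr_le (uan_bnd p.2 uy).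
  have q1 := sqr_ge0 (x p.1 + x p.2); have q2 := sqr_ge0 (y p.1 + y p.2).
  rewrite /kden /M; nra.
have l1 : ln e <= ln (kden x y p.1 p.2 + e) by rewrite ler_ln ?posrE //; lra.
have l2 : ln (kden x y p.1 p.2 + e) <= ln M by rewrite ler_ln ?posrE //; lra.
have a1 := ler_norm (- ln e); have a2 := ler_norm (ln M); have a3 := normr_ge0 (ln M); have a4 := normr_ge0 (ln e).
rewrite normrN in a1.
by rewrite ler_norml; apply/andP; split; lra.
Qed.

Lemma CC_log_regularized u Bu e t : uan u Bu -> (forall t, u (t + 1) = u t) -> 0 < e ->
  int01 (fun s => kden x y t s / (kden x y t s + e) * ((u s - u t) * crr t s)) =
  - (2^-1 * int01 (fun s => derive1 u s * ln (kden x y t s + e))).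
Proof.
move=> uu pu e0.
pose N s := (x s - x t) * derive1 x s + (y s - y t) * derive1 y s.
pose L s := 2^-1 * ln (kden x y t s + e).
pose D s := kden x y t s + e.
have Dp s : 0 < D s by exact: ltr_wpDl (kden_ge0 _ _ _ _) e0.
pose F s := (u s - u t) * L s.
pose F' s := (u s - u t) * (N s / D s) + derive1 u s * L s.
have cu := uan_continuous uu; have cu' := uan_dcontinuous uu.
have dL s : is_derive s (1 : R) L (N s / D s) by exact: (is_derive_log_kden cv t s e0).
have cL : continuous L.
  by move=> s; apply: differentiable_continuous; apply/derivable1_diffP; case: (dL s).
have cND : continuous (fun s => N s / D s) by exact: (continuous_dlog_kden cv (t := t) e0).
have dF s : is_derive s (1 : R) F (F' s).
  have du : is_derive s (1 : R) (fun z => u z - u t) (derive1 u s).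
    have h := uan_derive s uu; apply: is_derive_eq; ring.
  have h := is_deriveM du (dL s).
  by apply: (is_derive_eq h); rewrite /F' /GRing.scale /=; ring.
have c1 : continuous (fun s => (u s - u t) * (N s / D s)).
  by move=> s; apply: cvgM; [apply: cvgB; [exact: cu|exact: cvg_cst]|exact: cND].
have c2 : continuous (fun s => derive1 u s * L s).
  by move=> s; apply: cvgM; [exact: cu'|exact: cL].
have cF : continuous F' by move=> s; apply: cvgD; [exact: c1|exact: c2].
have pk s : kden x y t (s + 1) = kden x y t s by rewrite /kden (cv_px cv) (cv_py cv).
have bu : bm (fun s => u s - u t) by apply: bmB; [exact: uan_bm uu|exact: bm_cst].
have bV : bm (fun s => (D s)^-1).
  have [mD _] : measurable_fun setT D /\ True.
    split=> //; apply: measurable_funD => //.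
    exact: measurableT_comp (measurable_kden cv) (pair1_measurable t).
  split; first exact: measurable_fun_inv.
  exists e^-1 => s; rewrite ger0_norm ?invr_ge0 ?(ltW (Dp _)) //.
  by rewrite lef_pV2 ?posrE // lerDr kden_ge0.
have bN : bm N.
  have bd k Bk : uan k Bk -> bm (fun s => (k s - k t) * derive1 k s).
    by move=> uk; apply: bmM; [apply: bmB; [exact: uan_bm uk|exact: bm_cst]|exact: uan_dbm uk].
  by apply: bmD; [exact: bd ux|exact: bd uy].
have b1 : bm (fun s => (u s - u t) * (N s / D s)) by apply: bmM => //; exact: bmM.
have b2 : bm (fun s => derive1 u s * L s).
  by apply: bmM; [exact: uan_dbm uu|apply: bmZ; exact: (bm_sect1 t (bm_lnkden e0))].
have b3 : bm (fun s => derive1 u s * ln (kden x y t s + e)).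
  by apply: bm_ext (bmZ 2 b2) _ => s; rewrite /L; field.
have := FTC01 dF cF; rewrite int01D // /F.
have -> : (u 1 - u t) * L 1 - (u 0 - u t) * L 0 = 0.
  by rewrite /L -[1]add0r pu pk subrr.
move=> E0; rewrite -int01Z //.
have -> : int01 (fun s => 2^-1 * (derive1 u s * ln (kden x y t s + e))) = int01 (fun s => derive1 u s * L s).
  by apply: int01_eq => s _; rewrite /L; ring.
have -> : int01 (fun s => kden x y t s / (kden x y t s + e) * ((u s - u t) * crr t s)) = int01 (fun s => (u s - u t) * (N s / D s)).
  apply: int01_eq => s _; rewrite /crr /N /D.
  have [D0|D0] := eqVneq (kden x y t s) 0.
    have [-> ->] := (cZ_eq x y _ _).2 D0; rewrite !subrr; ring.
  by field; rewrite D0 gt_eqF // Dp.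
by apply/eqP; rewrite -subr_eq0 opprK; apply/eqP.
Qed.

(* The identity [|Z(s) - Z(t)|^2 + e = FF t * FF s * (1 - Q t s)] holds for the positive
   kernel [Q] with these features and weights; expanding [- ln (1 - Q)] in powers of [Q]
   then exhibits the logarithmic kernel as positive on functions of mean zero. *)
Definition FF t : R := 1 + x t ^+ 2 + y t ^+ 2.
Definition cweight e (i : 'I_4) : R := nth 0 [:: 1 - e; 2; 2; 1] i.
Definition feature (i : 'I_4) t : R := nth 0 [:: 1; x t; y t; x t ^+ 2 + y t ^+ 2] i / FF t.

Lemma FF_ge1 t : 1 <= FF t.
Proof. by rewrite /FF -addrA lerDl addr_ge0 ?sqr_ge0. Qed.

Lemma FF_le t : FF t <= 1 + 2 * B ^+ 2.
Proof.
have h1 := norm_sqr_le (uan_bnd t ux); have h2 := norm_sqr_le (uan_bnd t uy).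
rewrite /FF; lra.
Qed.

Lemma bm_feature i : bm (feature i).
Proof.
have bF : bm FF by apply: bmD; [apply: bmD; [exact: bm_cst|exact: bmX (uan_bm ux)]|exact: bmX (uan_bm uy)].
have bV : bm (fun t => (FF t)^-1).
  split; first by apply: measurable_fun_inv; case: bF.
  exists 1 => t; have h := FF_ge1 t; rewrite ger0_norm ?invr_ge0 ?invf_le1; lra.
apply: bmM => //; case: i => [[|[|[|[|//]]]]] //= _.
- exact: bm_cst.
- exact: uan_bm ux.
- exact: uan_bm uy.
- by apply: bmD; apply: bmX; [exact: uan_bm ux|exact: uan_bm uy].
Qed.

Lemma psd_feature e t s : psd feature (cweight e) t s = 1 - (kden x y t s + e) / (FF t * FF s).
Proof.
have h1 := FF_ge1 t; have h2 := FF_ge1 s.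
rewrite /psd !big_ord_recl big_ord0 /feature /cweight /= /kden.
have n1 : FF t != 0 by rewrite gt_eqF //; lra.
have n2 : FF s != 0 by rewrite gt_eqF //; lra.
have pE : FF t = 1 + x t ^+ 2 + y t ^+ 2 by []. have qE : FF s = 1 + x s ^+ 2 + y s ^+ 2 by [].
move: (FF t) (FF s) n1 n2 pE qE {h1 h2} => p q n1 n2 pE qE.
apply: (mulIf n1); apply: (mulIf n2).
rewrite [RHS](_ : _ = p * q - ((x s - x t) ^+ 2 + (y s - y t) ^+ 2 + e)); last by field; rewrite n1 n2.
rewrite [LHS](_ : _ = (1 - e) + 2 * (x t * x s) + 2 * (y t * y s) + (x t ^+ 2 + y t ^+ 2) * (x s ^+ 2 + y s ^+ 2)); last by field; rewrite n1 n2.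
rewrite pE qE; ring.
Qed.

Lemma cweight_ge0 e i : e <= 1 -> 0 <= cweight e i.
Proof. by move=> e1; rewrite /cweight; case: i => [[|[|[|[|//]]]]] //= _; rewrite ?subr_ge0. Qed.

Lemma cweight_gt0 i : 0 < cweight 0 i.
Proof. by rewrite /cweight; case: i => [[|[|[|[|//]]]]] //= _; rewrite subr0. Qed.

(** For [e > 0] the kernel stays away from 1 even on the diagonal, so the logarithmic series
    converges uniformly. *)
Lemma psd_bound e t s : 0 <= e <= 1 -> `|psd feature (cweight e) t s| <= 1 - e / (1 + 2 * B ^+ 2) ^+ 2.
Proof.
move=> /andP[e0 e1]; rewrite psd_feature.
set K := 1 + 2 * B ^+ 2; set P := FF t * FF s.
have h1 := FF_ge1 t; have h2 := FF_ge1 s; have h3 := FF_le t; have h4 := FF_le s; have B0 := sqr_ge0 B.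
have P1 : 1 <= P by rewrite /P; nra.
have PK : P <= K ^+ 2 by rewrite expr2 /K /P; apply: ler_pM; lra.
have K0 : 0 < K ^+ 2 by lra.
have P0 : 0 < P by lra.
have D0 := kden_ge0 x y t s.
have eK : e / K ^+ 2 <= e / P by rewrite ler_wpM2l // lef_pV2 ?posrE.
have lo : e / P <= (kden x y t s + e) / P by rewrite ler_pM2r ?invr_gt0 // lerDr.
have hi : (kden x y t s + e) / P <= 2 - e / P.
  rewrite -subr_ge0 (_ : 2 - e / P - _ = (2 * P - e - (kden x y t s + e)) / P); last by field; rewrite gt_eqF.
  rewrite divr_ge0 // /P /FF /kden; last by rewrite ltW.
  have q1 := sqr_ge0 (x t + x s); have q2 := sqr_ge0 (y t + y s).
  have q3 : 0 <= (x t ^+ 2 + y t ^+ 2) * (x s ^+ 2 + y s ^+ 2) by rewrite mulr_ge0 ?addr_ge0 ?sqr_ge0.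
  nra.
by rewrite ler_norml; apply/andP; split; lra.
Qed.

Definition log_energy e f : R := - int01 (fun t => int01 (fun s => f t * (f s * ln (kden x y t s + e)))).

Lemma bm_lnFF : bm (fun t => ln (FF t)).
Proof.
have [mF _] : bm FF by apply: bmD; [apply: bmD; [exact: bm_cst|exact: bmX (uan_bm ux)]|exact: bmX (uan_bm uy)].
split; first exact: (measurableT_comp (@measurable_ln R)).
exists (ln (1 + 2 * B ^+ 2)) => t.
have h1 := FF_ge1 t; have h2 := FF_le t.
by rewrite ger0_norm ?ln_ge0 // ler_ln ?posrE //; lra.
Qed.

Lemma ln_psd e t s : 0 < e -> ln (1 - psd feature (cweight e) t s) = ln (kden x y t s + e) - ln (FF t) - ln (FF s).
Proof.
move=> e0; rewrite psd_feature opprB addrC subrK.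
have h1 := FF_ge1 t; have h2 := FF_ge1 s; have D0 := kden_ge0 x y t s.
have P0 : 0 < FF t * FF s by rewrite mulr_gt0 //; lra.
rewrite lnM ?posrE ?invr_gt0 //; last lra.
by rewrite lnV ?posrE // lnM ?posrE; [rewrite opprD addrA|lra|lra].
Qed.

(** Since [f] has mean zero, the terms [ln (FF t)] and [ln (FF s)] of [ln_psd] integrate to zero
    against [f t * f s]. *)
Lemma log_energy_ge e f n : 0 < e <= 1 -> bm f -> int01 f = 0 ->
  moment feature (cweight e) n.+1 f / n.+1%:R <= log_energy e f.
Proof.
move=> /andP[e0 e1] bf f0.
have bl : bm (fun p : R * R => ln (kden x y p.1 p.2 + e) - ln (FF p.1) - ln (FF p.2)).
  by apply: bmB; [apply: bmB; [exact: bm_lnkden|exact: bm_fst bm_lnFF]|exact: bm_snd bm_lnFF].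
pose K : R := (1 + 2 * B ^+ 2) ^+ 2.
have K1 : 1 <= K by rewrite exprn_ege1 // lerDl mulr_ge0 ?sqr_ge0.
have e01 : 0 <= e <= 1 by rewrite e1 ltW.
have r01 : 0 <= 1 - e / K < 1.
  have h : 0 < e / K by rewrite divr_gt0 //; lra.
  have h' : e / K <= 1 by rewrite ler_pdivrMr ?mul1r; lra.
  lra.
have bl' : bm (fun p : R * R => ln (1 - psd feature (cweight e) p.1 p.2)).
  by apply: bm_ext bl _ => p; rewrite ln_psd.
have := @log_kernel_ge _ _ feature bm_feature (cweight e) f n _ (fun i => cweight_ge0 i e1) bf r01 (fun t s => psd_bound t s e01) bl'.
congr (_ <= - _); rewrite /moment.
have bfl : bm (fun t => f t * ln (FF t)) by apply: bmM => //; exact: bm_lnFF.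
set k0 := int01 (fun t => f t * ln (FF t)).
have b1 t : bm (fun s => f t * (f s * ln (kden x y t s + e))).
  by apply: bmZ; apply: bmM => //; exact: (bm_sect1 t (bm_lnkden e0)).
transitivity (int01 (fun t => int01 (fun s => f t * (f s * ln (kden x y t s + e))) - k0 * f t)).
  apply: int01_eq => t _.
  transitivity (int01 (fun s => f t * (f s * ln (kden x y t s + e))) - (int01 (fun s => (f t * ln (FF t)) * f s) + int01 (fun s => f t * (f s * ln (FF s))))).
    rewrite -int01D; [|exact: bmZ|exact: bmZ].
    rewrite -int01B; [|exact: b1|by apply: bmD; exact: bmZ].
    by apply: int01_eq => s _; rewrite ln_psd //; ring.
  by rewrite (int01Z (f t * ln (FF t)) bf) f0 mulr0 add0r (int01Z (f t) bfl) (mulrC k0).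
rewrite int01B; last exact: bmZ.
  by rewrite int01Z // f0 mulr0 subr0.
have bb : bm (fun p : R * R => f p.1 * (f p.2 * ln (kden x y p.1 p.2 + e))).
  by apply: bmM; [exact: bm_fst|apply: bmM; [exact: bm_snd|exact: bm_lnkden]].
exact: (bm_int01 bb).
Qed.

Lemma log_energy_cvg u Bu : uan u Bu -> (forall t, u (t + 1) = u t) ->
  2^-1 * log_energy (eps n) (derive1 u) @[n --> \oo] --> int01 (fun t => derive1 u t * CC u t).
Proof.
move=> uu pu.
have cu := uan_clip cv uu pu.
have b1 : bm (fun p : R * R => (u p.2 - u p.1) * crr p.1 p.2).
  have hx := bmM (bm_snd _ (uan_dbm ux)) (bm_quot cv cu (clip_x cv)).
  have hy := bmM (bm_snd _ (uan_dbm uy)) (bm_quot cv cu (clip_y cv)).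
  by apply: bm_ext (bmD hx hy) _ => p; rewrite /crr; ring.
have bF : bm (fun p : R * R => derive1 u p.1 * ((u p.2 - u p.1) * crr p.1 p.2)).
  by apply: bmM => //; exact: bm_fst (uan_dbm uu).
have := regularize_cvg cv bF.
have -> : int01 (fun s => int01 (fun z => derive1 u (s, z).1 * ((u (s, z).2 - u (s, z).1) * crr (s, z).1 (s, z).2))) =
    int01 (fun t => derive1 u t * CC u t).
  by apply: int01_eq => t _; rewrite /= int01Z //; exact: (bm_sect1 t b1).
have F0 s z : kden x y s z = 0 -> derive1 u (s, z).1 * ((u (s, z).2 - u (s, z).1) * crr (s, z).1 (s, z).2) = 0.
  by move=> D0; rewrite /= /crr D0 invr0 !mulr0.
move=> /(_ F0) h; apply: (fun k => cvg_ext k h) => n /=.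
have e0 : 0 < eps n by rewrite invr_gt0.
have bL : bm (fun p : R * R => derive1 u p.1 * (derive1 u p.2 * ln (kden x y p.1 p.2 + eps n))).
  by apply: bmM; [exact: bm_fst (uan_dbm uu)|apply: bmM; [exact: bm_snd (uan_dbm uu)|exact: bm_lnkden]].
rewrite /log_energy mulrN -mulNr -int01Z; last exact: (bm_int01 bL).
apply: int01_eq => t _.
have bl : bm (fun s => derive1 u s * ln (kden x y t s + eps n)).
  by apply: bmM; [exact: uan_dbm uu|exact: (bm_sect1 t (bm_lnkden e0))].
rewrite int01Z // mulrCA mulNr -(CC_log_regularized t uu pu e0) -int01Z; last first.
  exact: bmM (bm_sect1 t (bm_damp cv n)) (bm_sect1 t b1).
by apply: int01_eq => s _; rewrite /damp; ring.
Qed.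

Lemma moment_cvg f n : bm f ->
  moment feature (cweight (eps j)) n f @[j --> \oo] --> moment feature (cweight 0) n f.
Proof.
move=> bf; have [_ [E hE]] := bf.
have E0 : 0 <= E by exact: le_trans (normr_ge0 _) (hE 0).
have bM e := @bm_moment _ _ feature bm_feature (cweight e) n f bf.
have eb j : 0 <= eps j <= 1.
  by rewrite invr_ge0 ler0n /= invf_le1 ?ltr0n // ler1n.
have bd e t s : 0 <= e <= 1 -> `|f t * f s * psd feature (cweight e) t s ^+ n| <= E * E * 1.
  move=> e01; rewrite !normrM; apply: ler_pM => //; first exact: ler_pM.
  rewrite normrX exprn_ile1 //; apply: le_trans (psd_bound t s e01) _.
  by case/andP: e01 => e0 _; rewrite gerBl divr_ge0 // exprn_ge0 // addr_ge0 // mulr_ge0 // sqr_ge0.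
apply: (@int01_dct _ _ _ (E * E * 1)) => [j||j t _|t _].
- exact: (bm_int01 (bM (eps j))).
- exact: (bm_int01 (bM 0)).
- by apply: int01_bnd => [|s _]; [exact: (bm_sect1 t (bM (eps j)))|exact: bd].
apply: (@int01_dct _ _ _ (E * E * 1)) => [j||j s _|s _].
- exact: (bm_sect1 t (bM (eps j))).
- exact: (bm_sect1 t (bM 0)).
- exact: bd.
apply: cvgM; first exact: cvg_cst.
apply: (@cvg_comp _ _ _ (fun j => psd feature (cweight (eps j)) t s) (fun z => z ^+ n)); last exact: exprn_continuous.
rewrite psd_feature.
apply: (cvg_ext (a := fun j => 1 - (kden x y t s + eps j) / (FF t * FF s))) => [j|]; first by rewrite psd_feature.
apply: cvgB; first exact: cvg_cst.
apply: cvgM; last exact: cvg_cst.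
by apply: cvgD; [exact: cvg_cst|exact: cvg_harmonic].
Qed.

(** By periodicity [derive1 u] has mean zero, so [log_energy_ge] applies; then [e] tends to 0 on
    both sides. *)
Lemma energy_ge_moment u Bu n : uan u Bu -> (forall t, u (t + 1) = u t) ->
  2^-1 * (moment feature (cweight 0) n.+1 (derive1 u) / n.+1%:R) <= int01 (fun t => derive1 u t * CC u t).
Proof.
move=> uu pu.
have bu := uan_dbm uu.
have c1 : 2^-1 * (moment feature (cweight (eps j)) n.+1 (derive1 u) / n.+1%:R) @[j --> \oo] -->
    2^-1 * (moment feature (cweight 0) n.+1 (derive1 u) / n.+1%:R).
  apply: cvgM; first exact: cvg_cst.
  by apply: cvgM; [exact: moment_cvg|exact: cvg_cst].
have c2 := log_energy_cvg uu pu.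
rewrite -(cvg_lim (@Rhausdorff R) c1) -(cvg_lim (@Rhausdorff R) c2).
apply: ler_lim; [by apply/cvg_ex; eexists; exact: c1|by apply/cvg_ex; eexists; exact: c2|].
near=> j; rewrite ler_wpM2l ?invr_ge0 //; apply: log_energy_ge => //; last exact: uan_int0 uu pu.
by rewrite invr_gt0 ltr0n /= invf_le1 ?ltr0n // ler1n.
Unshelve. all: by end_near.
Qed.

End Energy.

(** * Definiteness of the energy modulo constants *)

Section EnergyDefinite.
Context {R : realType}.
Local Notation mu := (@lebesgue_measure R).

Lemma int01_sub_ge (g : R -> R) (a b c : R) : bm g -> 0 <= a -> a <= b -> b <= 1 ->
  (forall t, 0 <= t <= 1 -> 0 <= g t) -> (forall t, a <= t <= b -> c <= g t) -> 0 <= c ->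
  c * (b - a) <= int01 g.
Proof.
move=> bg a0 ab b1 g0 gc c0.
rewrite -lee_fin -int01_E //.
have -> : (c * (b - a))%:E = (\int[mu]_(t in `[a, b]) c%:E)%E.
  have muP : mu `[a, b]%classic = (b - a)%:E.
    rewrite lebesgue_measure_itv /= lte_fin; case: ltP => h.
      by rewrite -EFinB.
    by congr EFin; lra.
  by rewrite integral_cst //= EFinM; congr (_ * _)%E.
have [mg _] := bg.
apply: (@le_trans _ _ (\int[mu]_(t in `[a, b]) (g t)%:E)%E).
  apply: ge0_le_integral => //.
  by apply/measurable_EFinP; exact: measurable_funTS.
apply: ge0_subset_integral => //.
  by apply/measurable_EFinP; exact: measurable_funTS.
by move=> t; rewrite /= !in_itv /= => /andP[h1 h2]; apply/andP; split; lra.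
Qed.

Lemma int01_gt0 (g : R -> R) (t0 : R) : bm g -> 0 <= t0 <= 1 -> (forall t, 0 <= t <= 1 -> 0 <= g t) ->
  {for t0, continuous g} -> 0 < g t0 -> 0 < int01 g.
Proof.
move=> bg t01 g0 cg gp.
have [d d0 hd] : exists2 d, 0 < d & forall t, `|t - t0| < d -> g t0 / 2 <= g t.
  have /nbhs_ballP[d d0 hd] : \forall t \near t0, g t0 / 2 < g t.
    by apply: (cvgr_gt _ cg); lra.
  by exists d => // t td; apply: ltW; apply: hd; rewrite /ball /= distrC.
pose e := Num.min (d / 2) 2^-1.
have e0 : 0 < e by rewrite lt_min; lra.
have ed : e <= d / 2 by rewrite ge_min lexx.
have e2 : e <= 2^-1 by rewrite ge_min lexx orbT.
have near t : t0 - e <= t <= t0 + e -> g t0 / 2 <= g t.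
  by move=> h; apply: hd; rewrite ltr_norml; lra.
have ge : 0 < g t0 / 2 * e by rewrite mulr_gt0 //; lra.
apply: lt_le_trans ge _.
have [t2|t2] := lerP t0 2^-1.
  have := @int01_sub_ge g t0 (t0 + e) (g t0 / 2) bg.
  rewrite (_ : t0 + e - t0 = e); last by ring.
  apply => //; try lra.
  by move=> t ht; apply: near; lra.
have := @int01_sub_ge g (t0 - e) t0 (g t0 / 2) bg.
rewrite (_ : t0 - (t0 - e) = e); last by ring.
apply => //; try lra.
by move=> t ht; apply: near; lra.
Qed.

Lemma bernoulli_ineq (z : R) n : 1 <= z -> n%:R * (z - 1) <= z ^+ n.
Proof.
move=> z1; suff : 1 + n%:R * (z - 1) <= z ^+ n by lra.
elim: n => [|n IH]; first by rewrite mul0r addr0 expr0.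
have n0 : 0 <= n%:R :> R by [].
rewrite exprS -natr1; move: IH; set p := z ^+ n; move: (n%:R : R) n0 => k k0 IH.
have h : (1 + k * (z - 1)) * z <= z * p by rewrite mulrC ler_wpM2l //; lra.
have h2 : 0 <= k * (z - 1) ^+ 2 by rewrite mulr_ge0 ?sqr_ge0.
have h3 : (1 + k * (z - 1)) * z = 1 + (k + 1) * (z - 1) + k * (z - 1) ^+ 2 by ring.
lra.
Qed.

Variables (x y : R -> R) (B m : R).
Hypothesis cv : curve x y B m.
Implicit Types (t s h e : R) (u f : R -> R) (n : nat).

Let ux : uan x B := cv_x cv.
Let uy : uan y B := cv_y cv.
Local Notation CC := (CC x y).
Local Notation Q := (psd (feature x y) (cweight 0)).

(** For [e = 0] the weighted features form unit vectors, as [1 + 2 |Z|^2 + |Z|^4 = (1 + |Z|^2)^2]: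
    the kernel is 1 where the chord vanishes and recedes from 1 with the squared chord. *)
Lemma psd0_bound e t s : 0 <= e <= 1 -> e <= kden x y t s ->
  `|Q t s| <= 1 - e / (1 + 2 * B ^+ 2) ^+ 2.
Proof.
move=> e01 eD; have := psd_bound cv t s e01; rewrite !psd_feature.
set K := (1 + _) ^+ 2; set P := _ * FF x y s.
have h1 := FF_ge1 x y t; have h2 := FF_ge1 x y s; have h3 := FF_le cv t; have h4 := FF_le cv s.
have P1 : 1 <= P by rewrite /P; nra.
have PK : P <= K by rewrite /K expr2; apply: ler_pM; lra.
have eK : e / K <= e / P by case/andP: e01 => e0 _; rewrite ler_wpM2l // lef_pV2 ?posrE; lra.
have lo : e / P <= kden x y t s / P by rewrite ler_pM2r // invr_gt0; lra.
have eP : 0 <= e / P by rewrite divr_ge0 //; lra.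
have -> : (kden x y t s + e) / P = kden x y t s / P + e / P by ring.
by rewrite addr0 !ler_norml => /andP[q1 q2]; apply/andP; split; lra.
Qed.

Lemma bm_psd0 t : bm (fun s => Q t s).
Proof. exact: (bm_sect1 t (bm_psd (bm_feature cv) (cweight 0))). Qed.

(* [Q t0] peaks at [t0], so its even powers concentrate there; Bernoulli's inequality replaces
   the asymptotics. *)
Lemma peak_le0 f t0 : continuous f -> bm f -> (forall t, f (t + 1) = f t) -> 0 <= t0 <= 1 ->
  (forall n t, int01 (fun s => f s * Q t s ^+ n) = 0) -> f t0 <= 0.
Proof.
move=> cf bf pf t01 f0; rewrite leNgt; apply/negP => fp.
have [_ [E hE]] := bf.
have E0 : 0 <= E by exact: le_trans (normr_ge0 _) (hE 0).
have [d d0 hd] : exists2 d, 0 < d & forall t, `|t - t0| < d -> 0 <= f t.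
  have /nbhs_ballP[d d0 hd] : \forall t \near t0, 0 < f t by exact: (cvgr_gt _ (cf t0)).
  by exists d => // t td; apply: ltW; apply: hd; rewrite /ball /= distrC.
have m0 := cv_m cv.
pose e := Num.min (m * d ^+ 2) 2^-1.
have e0 : 0 < e by rewrite lt_min mulr_gt0 ?exprn_gt0 //=; lra.
have em : e <= m * d ^+ 2 by rewrite ge_min lexx.
have e2 : e <= 2^-1 by rewrite ge_min lexx orbT.
pose K := (1 + 2 * B ^+ 2) ^+ 2.
have K1 : 1 <= K by rewrite exprn_ege1 // lerDl mulr_ge0 ?sqr_ge0.
pose r := 1 - e / K.
have eK : 0 < e / K <= 2^-1.
  rewrite divr_gt0 //=; last lra.
  by rewrite ler_pdivrMr; lra.
pose q := r ^+ 2.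
have q0 : 0 < q by rewrite /q exprn_gt0 // /r; lra.
have q1 : q < 1 by rewrite /q expr_lt1 // /r; clear - ux uy eK; lra.
have far s : f s < 0 -> Q t0 s ^+ 2 <= q.
  move=> fs; apply: norm_sqr_le; apply: psd0_bound; first by lra.
  pose n := Num.floor (s - t0 + 2^-1).
  have h1 := floor_le (s - t0 + 2^-1); have h2 := floorD1_gt (s - t0 + 2^-1).
  rewrite -/n in h1 h2; rewrite intrD in h2.
  set h := s - t0 - n%:~R.
  have hl : `|h| <= 2^-1 by rewrite /h ler_norml; lra.
  have E1 (g : R -> R) : (forall t, g (t + 1) = g t) -> g s = g (t0 + h).
    by move=> pg; rewrite -(periodic_int (t0 + h) n pg); congr g; rewrite /h; ring.
  have := cv_far cv t0 hl; rewrite -(E1 x (cv_px cv)) -(E1 y (cv_py cv)) => D.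
  apply: le_trans D; apply: le_trans em _; rewrite ler_pM2l // -(real_normK (num_real h)).
  apply: norm_sqr_le; rewrite (gtr0_norm d0) leNgt; apply/negP => hd'.
  by move: fs; rewrite (E1 f pf) ltNge hd // addrC addKr.
(* Where [f] is negative, [Q t0 s ^+ 2] is at most [q], so the positive part vanishes there and [g]
   is nonnegative; at [t0] it is positive because [Q t0 t0 = 1 > q]. *)
pose g s := f s * Num.max (Q t0 s ^+ 2 / q - 1) 0.
have g0 s : 0 <= g s.
  have [fs|fs] := ltrP (f s) 0; last by rewrite mulr_ge0 // le_max lexx orbT.
  rewrite /g max_r ?mulr0 // subr_le0 ler_pdivrMr // mul1r; exact: far.
have bQ : bm (fun s => Q t0 s ^+ 2 / q - 1).
  have h := bmX 2 (bm_psd0 t0).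
  by apply: bm_ext (bmB (bmZ q^-1 h) (bm_cst _ 1)) _ => s; rewrite mulrC.
have bg : bm g.
  apply: bmM => //; case: bQ => mQ [M hM]; split.
    by apply: measurable_maxr => //; exact: measurable_cst.
  exists M => s; apply: le_trans (hM s); rewrite /Num.max; case: ifP => // _.
  by rewrite normr0.
have Q00 : Q t0 t0 = 1.
  by rewrite psd_feature /kden !subrr expr0n !addr0 mul0r subr0.
have cQ : continuous (fun s => Q t0 s).
  have cx := uan_continuous ux; have cy := uan_continuous uy.
  have cF : continuous (FF x y).
    move=> s; rewrite /FF; apply: cvgD; [apply: cvgD; [exact: cvg_cst|]|].
      by apply: (@cvg_comp _ _ _ x (fun z => z ^+ 2)); [exact: cx|exact: exprn_continuous].
    by apply: (@cvg_comp _ _ _ y (fun z => z ^+ 2)); [exact: cy|exact: exprn_continuous].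
  have -> : (fun s => Q t0 s) = (fun s => 1 - (kden x y t0 s + 0) / (FF x y t0 * FF x y s)).
    by apply: funext => s; rewrite psd_feature.
  move=> s; apply: cvgB; first exact: cvg_cst.
  apply: cvgM; first by apply: cvgD; [exact: (continuous_kden cv)|exact: cvg_cst].
  have h1 := FF_ge1 x y t0; have h2 := FF_ge1 x y s.
  apply: cvgV; first by rewrite mulf_neq0 // gt_eqF //; clear - ux uy h1 h2; lra.
  by apply: cvgM; [exact: cvg_cst|exact: cF].
have cg : {for t0, continuous g}.
  apply: cvgM; first exact: cf.
  apply: (@continuous_max _ _ (fun s => Q t0 s ^+ 2 / q - 1) (fun=> 0)); last exact: cvg_cst.
  apply: cvgB; last exact: cvg_cst.
  apply: cvgM; last exact: cvg_cst.
  by apply: (@cvg_comp _ _ _ (fun s => Q t0 s) (fun z => z ^+ 2)); [exact: cQ|exact: exprn_continuous].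
have gt0 : 0 < g t0.
  rewrite /g Q00 expr1n mulr_gt0 // lt_max subr_gt0 ltr_pdivlMr // mul1r q1 //.
have := int01_gt0 bg t01 (fun t _ => g0 t) cg gt0.
suff : int01 g <= 0 by move=> h1 h2; lra.
(* Where [f] is nonnegative, Bernoulli gives [n * (z / q - 1) <= (z / q) ^+ n]; where it is
   negative, the power is at most 1 and costs at most [E]. The integral of [f * Q ^+ (2 * n)] is 0
   by hypothesis. *)
have key n : n%:R * int01 g <= E.
  rewrite -int01Z //.
  have bh : bm (fun s => q^-1 ^+ n * (f s * Q t0 s ^+ (2 * n)%N)).
    by apply: bmZ; apply: bmM => //; apply: bmX; exact: bm_psd0.
  have E1 : int01 (fun s => q^-1 ^+ n * (f s * Q t0 s ^+ (2 * n)%N) + E) = E.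
    rewrite int01D //; last exact: bm_cst.
    rewrite int01_cst int01Z ?f0 ?mulr0 ?add0r //.
    by apply: bmM => //; apply: bmX; exact: bm_psd0.
  rewrite -[X in _ <= X]E1; apply: int01_le => [||s _].
  - exact: bmZ.
  - by apply: bmD => //; exact: bm_cst.
  rewrite exprM /g.
  have Q0 := sqr_ge0 (Q t0 s); move: (Q t0 s ^+ 2) Q0 (far s) => z z0 zq.
  have -> : q^-1 ^+ n * (f s * z ^+ n) = f s * (z / q) ^+ n by rewrite exprMn exprVn; ring.
  have w0 : 0 <= z / q by rewrite divr_ge0 // ltW.
  have fE := hE s.
  have [fs|fs] := ltrP (f s) 0.
    have w1 : z / q <= 1 by rewrite ler_pdivrMr // mul1r; exact: zq.
    rewrite max_r ?mulr0; last by clear - ux uy w1; lra.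
    have wn : (z / q) ^+ n <= 1 by rewrite exprn_ile1.
    have : - E <= f s by move: fE; rewrite ler_norml => /andP[].
    have wn0 : 0 <= (z / q) ^+ n by rewrite exprn_ge0.
    nra.
  have [w1|w1] := lerP (z / q) 1.
    by rewrite max_r ?mulr0; [rewrite addr_ge0 // mulr_ge0 // exprn_ge0|clear - ux uy w1; lra].
  rewrite max_l; last by clear - ux uy w1; lra.
  have bi := bernoulli_ineq n (ltW w1).
  rewrite mulrCA; apply: le_trans (ler_wpM2l fs bi) _; clear - ux uy E0; lra.
rewrite leNgt; apply/negP => ig.
have := archi_boundP (divr_ge0 E0 (ltW ig)).
by rewrite ltr_pdivrMr // ltNge key.
Qed.

Lemma energy_ge0 u Bu : uan u Bu -> (forall t, u (t + 1) = u t) -> 0 <= int01 (fun t => derive1 u t * CC u t).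
Proof.
move=> uu pu; apply: le_trans (energy_ge_moment cv 0 uu pu).
rewrite mulr_ge0 ?invr_ge0 // divr_ge0 //.
apply: (moment_ge0 (bm_feature cv)); last exact: uan_dbm uu.
by move=> i; rewrite ltW // cweight_gt0.
Qed.

(** Zero energy makes all moments of [u'] vanish, hence all integrals of [u'] against powers of
    [Q t]; the peak argument, for [u'] and for [- u'], then gives [u' = 0]. *)
Lemma energy_eq0 u Bu : uan u Bu -> (forall t, u (t + 1) = u t) ->
  int01 (fun t => derive1 u t * CC u t) = 0 -> forall s t, u s = u t.
Proof.
move=> uu pu P0.
have bu := uan_dbm uu.
have M0 n : moment (feature x y) (cweight 0) n (derive1 u) = 0.
  case: n => [|n]; first by rewrite moment0 // (uan_int0 uu pu) expr0n.
  apply/eqP; rewrite eq_le; apply/andP; split; last first.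
    by apply: (moment_ge0 (bm_feature cv)) => // i; rewrite ltW // cweight_gt0.
  have := energy_ge_moment cv n uu pu; rewrite P0.
  by rewrite pmulr_rle0 ?invr_gt0 // pmulr_lle0 // invr_gt0.
have I0 := moments_eq0 (bm_feature cv) (@cweight_gt0 R) bu M0.
have cu := uan_dcontinuous uu; have pu' := uan_dperiodic uu pu.
have cN : continuous (fun s => - derive1 u s) by move=> s; apply: cvgN; exact: cu.
have IN n t : int01 (fun s => - derive1 u s * Q t s ^+ n) = 0.
  have h : bm (fun s => derive1 u s * Q t s ^+ n) by apply: bmM => //; apply: bmX; exact: bm_psd0.
  transitivity (- int01 (fun s => derive1 u s * Q t s ^+ n)); last by rewrite I0 oppr0.
  by rewrite -int01N //; apply: int01_eq => s _; ring.
apply: (uan_derive0_cst uu) => t.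
suff h t0 : 0 <= t0 <= 1 -> derive1 u t0 = 0.
  rewrite -(subrK (Num.floor t)%:~R t) periodic_int //; apply: h.
  have h1 := floor_le t; have h2 := floorD1_gt t; rewrite intrD in h2; lra.
move=> t01; have h1 := peak_le0 cu bu pu' t01 I0.
have h2 : - derive1 u t0 <= 0.
  by apply: (@peak_le0 (fun s => - derive1 u s)) => //; [exact: bmN|move=> s; rewrite pu'].
by apply/eqP; rewrite eq_le h1 -oppr_le0.
Qed.

End EnergyDefinite.

(** * Eigenfunctions with |lambda| = 1 *)

Section Rigidity.
Context {R : realType}.
Variables (x y : R -> R) (B m w : R).
Hypothesis cv : curve x y B m.
Hypothesis wE : forall t, dlpA x y (fun=> 1) t = w.
Implicit Types (t s h : R) (u v : R -> R).
Local Notation A := (dlpA x y).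
Local Notation CC := (CC x y).

Lemma bm_CCf u Bu : uan u Bu -> (forall t, u (t + 1) = u t) -> bm (CC u).
Proof. by move=> uu pu; case: (CC_ptlip cv wE uu pu 0). Qed.

Lemma uan_ptlip t u Bu : uan u Bu -> (forall t, u (t + 1) = u t) -> ptlip x y t u.
Proof. by move=> uu pu; exact: (clip_ptlip t (uan_clip cv uu pu)). Qed.

(** For [W = CC u] the relations give [A W = - a * W] and [CC W = A (A u) - w ^+ 2 * u = 0]. So [W]
    has zero energy and is constant, which turns the energy of [u] into a multiple of the integral
    of [u']. *)
Lemma real_rigidity u Bu (a : R) : uan u Bu -> (forall t, u (t + 1) = u t) ->
  (forall t, A u t = a * u t) -> a ^+ 2 = w ^+ 2 -> a != 0 -> forall s t, u s = u t.
Proof.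
move=> uu pu Au aw a0.
have bu := uan_bm uu.
pose W := CC u.
have bW : bm W := bm_CCf uu pu.
have AuE : A u = (fun t => a * u t + 0 * u t) by apply: funext => t; rewrite Au; ring.
have AW t : A W t = - (a * W t).
  have [_ h] := CC_dlpA cv wE uu pu t.
  have pt := uan_ptlip t uu pu.
  move: h; rewrite AuE (CC_lin cv) // -/W => h.
  by apply/eqP; rewrite -addr_eq0 -[X in _ == X]h; apply/eqP; ring.
have [B1 uAW] := dlpA_uan cv bW.
(* So far [W] is only known to be bounded and measurable; analyticity comes from
   [W = - a^-1 * A W]. *)
have [B2 uW'] := uan_scale (- a^-1) uAW.
have WE : (fun t => - a^-1 * A W t) = W.
  by apply: funext => t; rewrite AW mulrNN mulKf.
rewrite WE in uW'.
have pW t : W (t + 1) = W t by rewrite -WE /= (dlpA_periodic cv).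
have CW t : CC W t = 0.
  have [-> _] := CC_dlpA cv wE uu pu t.
  by rewrite AuE (dlpA_lin cv) // Au -aw; ring.
have W0 : int01 (fun t => derive1 W t * CC W t) = 0.
  by rewrite -[RHS](int01_cst 0); apply: int01_eq => t _; rewrite CW mulr0.
have Wc := energy_eq0 cv uW' pW W0.
apply: (energy_eq0 cv uu pu).
transitivity (int01 (fun t => W 0 * derive1 u t)).
  by apply: int01_eq => t _; rewrite -/W (Wc t 0) mulrC.
by rewrite int01Z ?(uan_int0 uu pu) ?mulr0 //; exact: uan_dbm uu.
Qed.

(* For [b <> 0], pairing [u'] with [A (C v)] kills the mixed terms and leaves [b (P(u) + P(v)) = 0]
   for the energies [P]. *)
Lemma complex_rigidity u v Bu Bv (a b : R) : uan u Bu -> (forall t, u (t + 1) = u t) ->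
  uan v Bv -> (forall t, v (t + 1) = v t) ->
  (forall t, A u t = a * u t - b * v t) -> (forall t, A v t = b * u t + a * v t) ->
  a ^+ 2 + b ^+ 2 = w ^+ 2 -> w != 0 -> forall s t, u s = u t /\ v s = v t.
Proof.
move=> uu pu uv pv Au Av abw w0.
have [b0|b0] := eqVneq b 0.
  have aw : a ^+ 2 = w ^+ 2 by rewrite -abw b0 expr0n addr0.
  have a0 : a != 0 by rewrite -sqrf_eq0 aw sqrf_eq0.
  move=> s t; split.
    by apply: (real_rigidity uu pu) aw a0 _ _ => z; rewrite Au b0 mul0r subr0.
  by apply: (real_rigidity uv pv) aw a0 _ _ => z; rewrite Av b0 mul0r add0r.
have bCu := bm_CCf uu pu; have bCv := bm_CCf uv pv.
have bu' := uan_dbm uu; have bv' := uan_dbm uv.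
have adj := dlpA_adjoint cv uu pu bCv.
pose Puu := int01 (fun t => derive1 u t * CC u t).
pose Pvv := int01 (fun t => derive1 v t * CC v t).
pose Puv := int01 (fun t => derive1 u t * CC v t).
have b1 : bm (fun t => derive1 u t * CC u t) by exact: bmM.
have b2 : bm (fun t => derive1 v t * CC v t) by exact: bmM.
have b3 : bm (fun t => derive1 u t * CC v t) by exact: bmM.
have E1 : int01 (fun t => derive1 u t * A (CC v) t) = - b * Puu - a * Puv.
  rewrite /Puu /Puv -!int01Z // -int01B; [|exact: bmZ|exact: bmZ].
  apply: int01_eq => t _.
  have [_ h] := CC_dlpA cv wE uv pv t.
  have AvE : A v = (fun t => b * u t + a * v t) by apply: funext => z; rewrite Av.
  rewrite AvE (CC_lin cv) in h; [|exact: uan_ptlip uu pu|exact: uan_ptlip uv pv].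
  have -> : A (CC v) t = - (b * CC u t + a * CC v t) by apply/eqP; rewrite -addr_eq0 h.
  ring.
have E2 : int01 (fun s => CC v s * derive1 (A u) s) = a * Puv - b * Pvv.
  rewrite /Pvv /Puv -!int01Z // -int01B; [|exact: bmZ|exact: bmZ].
  apply: int01_eq => t _.
  have -> : derive1 (A u) t = a * derive1 u t - b * derive1 v t.
    have AuE : A u = (fun t => a * u t - b * v t) by apply: funext => z; rewrite Au.
    rewrite AuE derive1E.
    have du := uan_derive t uu; have dv := uan_derive t uv.
    have dd : is_derive t (1 : R) (fun t => a * u t - b * v t) (a * derive1 u t - b * derive1 v t).
      exact: (is_deriveB (is_deriveZ a du) (is_deriveZ b dv)).
    by have [_ ->] := dd.
  ring.
have Pu0 : 0 <= Puu := energy_ge0 cv uu pu.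
have Pv0 : 0 <= Pvv := energy_ge0 cv uv pv.
have hu : Puu = 0 -> forall s t, u s = u t := energy_eq0 cv uu pu.
have hv : Pvv = 0 -> forall s t, v s = v t := energy_eq0 cv uv pv.
rewrite adj E2 in E1; clearbody Puu Pvv Puv.
have : b * (Puu + Pvv) = 0.
  have -> : b * (Puu + Pvv) = - (- b * Puu - a * Puv) - (a * Puv - b * Pvv) by ring.
  by rewrite -E1; ring.
move/eqP; rewrite mulf_eq0 (negbTE b0) /= paddr_eq0 // => /andP[/eqP h1 /eqP h2] s t.
by split; [exact: hu|exact: hv].
Qed.

End Rigidity.

(** * The spectral gap *)

Section UltraLimit.
Context {R : realType} {T : Type} (F : set_system T).
Context {UF : UltraFilter F}.

Lemma ultra_fmap (U : Type) (f : T -> U) : UltraFilter (f @ F).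
Proof.
split; first exact: fmap_proper_filter.
move=> G PG FG; apply/seteqP; split=> // A GA.
have [//|FnA] := in_ultra_setVsetC (f @^-1` A) UF.
have : G (A `&` ~` A) by apply: filterI => //; exact: FG.
by rewrite setICr => /filter_not_empty.
Qed.

(** Limits along one ultrafilter take the place of successive extractions of subsequences. *)
Lemma ultra_lim (z : T -> R) (a b : R) : (forall n, a <= z n <= b) ->
  exists2 l, a <= l <= b & z n @[n --> F] --> l.
Proof.
move=> zM; have := @segment_compact R a b; rewrite compact_ultra => /(_ _ (ultra_fmap z)).
have : (z @ F) `[a, b]%classic.
  have : F (z @^-1` `[a, b]%classic) by apply: (filterS _ filterT) => n _; rewrite /= in_itv /=; exact: zM.
  by [].
by move=> h /(_ h) [l [/=]]; rewrite in_itv /= => lM zl; exists l.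
Qed.

End UltraLimit.

Section SpectralGap.
Context {R : realType}.
Variables (x y : R -> R) (B m w : R).
Hypothesis cv : curve x y B m.
Hypothesis wE : forall t, dlpA x y (fun=> 1) t = w.
Implicit Types (t s h : R) (u v : R -> R) (a b : R).
Local Notation A := (dlpA x y).

(* The eigenvalue equation for [u + i v] and the eigenvalue [a + i b]. *)
Definition eigenpair u v a b : Prop :=
  [/\ bm u, bm v, forall t, A u t = a * u t - b * v t & forall t, A v t = b * u t + a * v t].

(** Dividing the system by [lambda = a + i b] expresses [u] and [v] through [A u] and [A v], with
    coefficients at most [1 / |lambda|] in modulus; two of them give the factor 2 in the new [M]. *)
Lemma eigenpair_pexp : exists M c, [/\ 0 <= M, 0 < c & forall u v a b E, eigenpair u v a b -> 0 < a ^+ 2 + b ^+ 2 ->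
  (forall t, `|u t| <= E) -> (forall t, `|v t| <= E) -> forall t,
  (exists p, pexp u t p (M * E / Num.sqrt (a ^+ 2 + b ^+ 2)) c) /\
  (exists p, pexp v t p (M * E / Num.sqrt (a ^+ 2 + b ^+ 2)) c)].
Proof.
have [M [c [c0 hM]]] := dlpA_pexp cv.
exists (2 * `|M|), c; split; [by rewrite mulr_ge0|by []|move=> u v a b E [bu bv Au Av] ab0 uE vE t].
have E0 : 0 <= E by exact: le_trans (normr_ge0 _) (uE 0).
set r := Num.sqrt _.
have r0 : 0 < r by rewrite sqrtr_gt0.
have rE : r ^+ 2 = a ^+ 2 + b ^+ 2 by rewrite sqr_sqrtr // ltW.
have le_r (k : R) : k ^+ 2 <= a ^+ 2 + b ^+ 2 -> `|k / r ^+ 2| <= r^-1.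
  move=> kr; rewrite normrM normfV (gtr0_norm (exprn_gt0 2 r0)) ler_pdivrMr ?exprn_gt0 //.
  rewrite expr2 mulKf ?gt_eqF // -(gtr0_norm r0) -ler_sqr ?nnegrE // !real_normK ?num_real // rE.
  exact: kr.
have ar : `|a / r ^+ 2| <= r^-1 by apply: le_r; rewrite lerDl sqr_ge0.
have br : `|b / r ^+ 2| <= r^-1 by apply: le_r; rewrite lerDr sqr_ge0.
have nbr : `|- b / r ^+ 2| <= r^-1 by rewrite mulNr normrN.
have [pu hu] := hM u E bu uE t; have [pv hv] := hM v E bv vE t.
have comb (k l : R) : `|k| <= r^-1 -> `|l| <= r^-1 -> `|k| * (M * E) + `|l| * (M * E) <= 2 * `|M| * E / r.
  move=> kr lr; rewrite -mulrDl.
  have ME : M * E <= `|M| * E by rewrite ler_wpM2r // ler_norm.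
  apply: le_trans (ler_wpM2l _ ME) _; first by rewrite addr_ge0.
  have -> : 2 * `|M| * E / r = (r^-1 + r^-1) * (`|M| * E) by ring.
  by apply: ler_wpM2r; [rewrite mulr_ge0|exact: lerD].
have rn : a ^+ 2 + b ^+ 2 != 0 by rewrite gt_eqF.
split.
  exists (fun n => a / r ^+ 2 * pu n + b / r ^+ 2 * pv n).
  apply: pexp_eq (pexp_le (pexp_add (pexp_scale (a / r ^+ 2) hu) (pexp_scale (b / r ^+ 2) hv)) (comb _ _ ar br) (lexx c)) _ => h _.
  by rewrite Au Av rE; field.
exists (fun n => - b / r ^+ 2 * pu n + a / r ^+ 2 * pv n).
apply: pexp_eq (pexp_le (pexp_add (pexp_scale (- b / r ^+ 2) hu) (pexp_scale (a / r ^+ 2) hv)) (comb _ _ nbr ar) (lexx c)) _ => h _.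
by rewrite Au Av rE; field.
Qed.

Hypothesis w0 : w != 0.

Lemma eigenpair_uan : exists B', forall u v a b, eigenpair u v a b -> w ^+ 2 / 2 <= a ^+ 2 + b ^+ 2 ->
  (forall t, `|u t| <= 1) -> (forall t, `|v t| <= 1) -> uan u B' /\ uan v B'.
Proof.
have [M [c [M0 c0 hM]]] := eigenpair_pexp.
have w2 : 0 < w ^+ 2 / 2 by rewrite divr_gt0 // exprn_even_gt0.
pose r := Num.sqrt (w ^+ 2 / 2).
have r0 : 0 < r by rewrite sqrtr_gt0.
exists (Num.max 1 (Num.max (M / r) c)) => u v a b ep wab u1 v1.
have ab0 : 0 < a ^+ 2 + b ^+ 2 by lra.
have rr : r <= Num.sqrt (a ^+ 2 + b ^+ 2) by rewrite ler_sqrt // ltW.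
have Mr : M * 1 / Num.sqrt (a ^+ 2 + b ^+ 2) <= Num.max 1 (Num.max (M / r) c).
  rewrite mulr1 !le_max; apply/orP; right; apply/orP; left.
  by rewrite ler_wpM2l // lef_pV2 ?posrE //; lra.
have cr : c <= Num.max 1 (Num.max (M / r) c) by rewrite !le_max lexx !orbT.
have one : 1 <= Num.max 1 (Num.max (M / r) c) by rewrite le_max lexx.
have h := hM u v a b 1 ep ab0 u1 v1.
by split; split=> // t; have [[p hp] [q hq]] := h t; [exists p; exact: pexp_le hp Mr cr|exists q; exact: pexp_le hq Mr cr].
Qed.

(** Divide by the maximum of [|u + i v|], attained at [c]. The continuity and periodicity behind
    this maximum are consequences of the eigenvalue equation. *)
Lemma eigenpair_normalize u v a b : eigenpair u v a b -> 0 < a ^+ 2 + b ^+ 2 ->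
  (exists t, u t = 0 /\ v t = 0) -> (exists t, u t <> 0 \/ v t <> 0) ->
  exists u' v' z c, [/\ eigenpair u' v' a b, 0 <= z <= 1 /\ (u' z = 0 /\ v' z = 0),
    forall t, (u' (t + 1) = u' t /\ v' (t + 1) = v' t) /\ (u t = 0 /\ v t = 0 -> u' t = 0 /\ v' t = 0),
    forall t, u' t ^+ 2 + v' t ^+ 2 <= 1 & 0 <= c <= 1 /\ u' c ^+ 2 + v' c ^+ 2 = 1].
Proof.
move=> ep ab0 [z [uz vz]] [q hq].
have [M [c [M0 c0 hM]]] := eigenpair_pexp.
have [bu bv Au Av] := ep.
have [_ [E1 hE1]] := bu; have [_ [E2 hE2]] := bv.
have cu k : (forall t, exists p K, pexp k t p K c) -> continuous k.
  move=> hk t; have [p [K hp]] := hk t.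
  by apply: differentiable_continuous; apply/derivable1_diffP; have := pexp_is_derive hp; case.
pose E := Num.max E1 E2.
have uE t : `|u t| <= E by apply: le_trans (hE1 t) _; rewrite le_max lexx.
have vE t : `|v t| <= E by apply: le_trans (hE2 t) _; rewrite le_max lexx orbT.
have h := hM u v a b E ep ab0 uE vE.
have cu' : continuous u by apply: cu => t; have [[p hp] _] := h t; exists p, (M * E / Num.sqrt (a ^+ 2 + b ^+ 2)).
have cv' : continuous v by apply: cu => t; have [_ [p hp]] := h t; exists p, (M * E / Num.sqrt (a ^+ 2 + b ^+ 2)).
have abn : a ^+ 2 + b ^+ 2 != 0 by rewrite gt_eqF.
have pu t : u (t + 1) = u t.
  have e1 := Au (t + 1); have e2 := Av (t + 1).
  rewrite (dlpA_periodic cv) Au in e1; rewrite (dlpA_periodic cv) Av in e2.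
  apply: (mulfI abn).
  transitivity (a * (a * u (t + 1) - b * v (t + 1)) + b * (b * u (t + 1) + a * v (t + 1))); first by ring.
  by rewrite -e1 -e2; ring.
have pv t : v (t + 1) = v t.
  have e1 := Au (t + 1); have e2 := Av (t + 1).
  rewrite (dlpA_periodic cv) Au in e1; rewrite (dlpA_periodic cv) Av in e2.
  apply: (mulfI abn).
  transitivity (a * (b * u (t + 1) + a * v (t + 1)) - b * (a * u (t + 1) - b * v (t + 1))); first by ring.
  by rewrite -e1 -e2; ring.
pose p t := u t ^+ 2 + v t ^+ 2.
have cp : continuous p.
  move=> t; apply: cvgD.
    by apply: (@cvg_comp _ _ _ u (fun z => z ^+ 2)); [exact: cu'|exact: exprn_continuous].
  by apply: (@cvg_comp _ _ _ v (fun z => z ^+ 2)); [exact: cv'|exact: exprn_continuous].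
have [e e01 he] : exists2 e, e \in `[0, 1]%R & forall t, t \in `[0, 1]%R -> p t <= p e.
  by apply: EVT_max; [exact: ler01|exact: continuous_subspaceT].
rewrite in_itv /= in e01.
have fl t : 0 <= t - (Num.floor t)%:~R <= 1.
  have h1 := floor_le t; have h2 := floorD1_gt t; rewrite intrD in h2; lra.
have per k t : (forall t, k (t + 1) = k t) -> k (t - (Num.floor t)%:~R) = k t :> R.
  by move=> pk; rewrite -[in RHS](subrK (Num.floor t)%:~R t) periodic_int.
have pe t : p t <= p e.
  rewrite /p -(per u t pu) -(per v t pv); apply: he; rewrite in_itv /=; exact: fl.
have pe0 : 0 < p e.
  apply: lt_le_trans (pe q); rewrite lt_neqAle addr_ge0 ?sqr_ge0 // andbT eq_sym.
  rewrite paddr_eq0 ?sqr_ge0 // !sqrf_eq0; apply/negP => /andP[/eqP h1 /eqP h2].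
  by case: hq.
pose r := Num.sqrt (p e).
have r0 : 0 < r by rewrite sqrtr_gt0.
have rE : r ^+ 2 = p e by rewrite sqr_sqrtr // ltW.
have sq t : (r^-1 * u t) ^+ 2 + (r^-1 * v t) ^+ 2 = p t / p e.
  by rewrite /p !exprMn exprVn rE; ring.
have scale k t : bm k -> A (fun s => r^-1 * k s) t = r^-1 * A k t.
  move=> bk; rewrite /dlpA -int01Z; last by apply: bmM => //; exact: bm_kr1 cv t.
  by apply: int01_eq => s _; ring.
exists (fun t => r^-1 * u t), (fun t => r^-1 * v t), (z - (Num.floor z)%:~R), e; split.
- split; [exact: bmZ|exact: bmZ|move=> t|move=> t]; rewrite scale //.
    by rewrite Au; ring.
  by rewrite Av; ring.
- by split; [exact: fl|rewrite !per // uz vz mulr0].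
- by move=> t; rewrite pu pv; split=> // -[-> ->]; rewrite mulr0.
- by move=> t; rewrite sq ler_pdivrMr // mul1r.
- by split=> //; rewrite sq divff // gt_eqF.
Qed.

Lemma ultra_diagonal (F : set_system nat) (fs : nat -> R -> R) (f : R -> R) (zs : nat -> R) (z L l : R) :
  ProperFilter F -> (forall n t h, `|fs n (t + h) - fs n t| <= L * `|h|) ->
  fs n z @[n --> F] --> f z -> zs n @[n --> F] --> z -> fs n (zs n) @[n --> F] --> l -> l = f z.
Proof.
move=> PF lip cf cz cl.
have d0 : `|fs n (zs n) - fs n z| @[n --> F] --> `|l - f z|.
  by apply: (@cvg_comp _ _ _ _ (fun z => `|z|)); [exact: cvgB cl cf|exact: norm_continuous].
have d1 : L * `|zs n - z| @[n --> F] --> L * `|z - z|.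
  apply: cvgM; first exact: cvg_cst.
  apply: (@cvg_comp _ _ _ (fun n => zs n - z) (fun z => `|z|)); last exact: norm_continuous.
  by apply: cvgB => //; exact: cvg_cst.
rewrite subrr normr0 mulr0 in d1.
have : `|l - f z| <= 0.
  apply: (ler_cvg_to d0 d1); near=> n.
  by have := lip n z (zs n - z); rewrite (_ : z + (zs n - z) = zs n) //; ring.
by rewrite normr_le0 subr_eq0 => /eqP.
Unshelve. all: by end_near.
Qed.

(** Otherwise there are normalized eigenpairs with a zero for which [a ^+ 2 + b ^+ 2] tends to
    [w ^+ 2]. A limit is an eigenpair with equality, hence constant by rigidity, yet it keeps a zero
    and a point of modulus 1. *)
Lemma spectral_gap : exists2 d, 0 < d & forall u v a b, eigenpair u v a b -> 0 < a ^+ 2 + b ^+ 2 ->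
  (exists t, u t = 0 /\ v t = 0) -> (exists t, u t <> 0 \/ v t <> 0) -> d <= `|a ^+ 2 + b ^+ 2 - w ^+ 2|.
Proof.
apply: contrapT => H.
have w2 : 0 < w ^+ 2 by rewrite exprn_even_gt0.
(* [eps n <= w ^+ 2 / 2] keeps [a ^+ 2 + b ^+ 2] at least [w ^+ 2 / 2], as the uniform bounds of
   [eigenpair_uan] require. *)
pose eps n : R := w ^+ 2 / 2 * n.+1%:R^-1.
have eps0 n : 0 < eps n by rewrite mulr_gt0 ?invr_gt0 ?divr_gt0.
pose P n (q : (R -> R) * (R -> R) * (R * R) * (R * R)) :=
  let: (u, v, (a, b), (z, c)) := q in
  [/\ eigenpair u v a b /\ `|a ^+ 2 + b ^+ 2 - w ^+ 2| < eps n, 0 <= z <= 1 /\ (u z = 0 /\ v z = 0),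
    forall t, u (t + 1) = u t /\ v (t + 1) = v t,
    forall t, u t ^+ 2 + v t ^+ 2 <= 1 & 0 <= c <= 1 /\ u c ^+ 2 + v c ^+ 2 = 1].
have exP n : exists q, P n q.
  apply: contrapT => nP; apply: H; exists (eps n) => // u v a b ep ab0 hz hn.
  rewrite leNgt; apply/negP => lt.
  have [u' [v' [z [c [h1 h2 h3 h4 h5]]]]] := eigenpair_normalize ep ab0 hz hn.
  by apply: nP; exists (u', v', (a, b), (z, c)); split=> // t; case: (h3 t).
have [q hq] := choice exP.
pose us n := (q n).1.1.1. pose vs n := (q n).1.1.2.
pose as_ n := (q n).1.2.1. pose bs n := (q n).1.2.2.
pose zs n := (q n).2.1. pose cs n := (q n).2.2.
have hP n : [/\ eigenpair (us n) (vs n) (as_ n) (bs n) /\ `|as_ n ^+ 2 + bs n ^+ 2 - w ^+ 2| < eps n,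
    0 <= zs n <= 1 /\ (us n (zs n) = 0 /\ vs n (zs n) = 0),
    forall t, us n (t + 1) = us n t /\ vs n (t + 1) = vs n t,
    forall t, us n t ^+ 2 + vs n t ^+ 2 <= 1 & 0 <= cs n <= 1 /\ us n (cs n) ^+ 2 + vs n (cs n) ^+ 2 = 1].
  have := hq n; rewrite /P /us /vs /as_ /bs /zs /cs.
  by case: (q n) => [[[u v] [a b]] [z c]].
have epsle n : eps n <= w ^+ 2 / 2.
  by rewrite /eps ger_pMr ?divr_gt0 // invf_le1 ?ltr0n // ler1n.
have ablo n : w ^+ 2 / 2 <= as_ n ^+ 2 + bs n ^+ 2.
  have [[_ h] _ _ _ _] := hP n; have := epsle n; move: h; rewrite ltr_norml => /andP[]; lra.
have abhi n : as_ n ^+ 2 + bs n ^+ 2 <= 2 * w ^+ 2.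
  have [[_ h] _ _ _ _] := hP n; have := epsle n; move: h; rewrite ltr_norml => /andP[]; lra.
have u1 n t : `|us n t| <= 1.
  have [_ _ _ /(_ t) h _] := hP n; rewrite -(@ler_sqr _ _ 1) ?nnegrE // real_normK ?num_real // expr1n.
  have := sqr_ge0 (vs n t); lra.
have v1 n t : `|vs n t| <= 1.
  have [_ _ _ /(_ t) h _] := hP n; rewrite -(@ler_sqr _ _ 1) ?nnegrE // real_normK ?num_real // expr1n.
  have := sqr_ge0 (us n t); lra.
have [B' hB'] := eigenpair_uan.
have uuan n : uan (us n) B' by have [[ep _] _ _ _ _] := hP n; case: (hB' _ _ _ _ ep (ablo n) (u1 n) (v1 n)).
have vuan n : uan (vs n) B' by have [[ep _] _ _ _ _] := hP n; case: (hB' _ _ _ _ ep (ablo n) (u1 n) (v1 n)).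
have [F [UF hF]] := ultraFilterLemma (@eventually_filter).
have PF : ProperFilter F by case: UF.
pose L : R := 12 * B' ^+ 2.
have L0 : 0 <= L by rewrite mulr_ge0 // sqr_ge0.
have M1 k : k ^+ 2 <= 2 * w ^+ 2 -> - (1 + 2 * w ^+ 2) <= k <= 1 + 2 * w ^+ 2.
  by move=> h; have h1 := sqr_ge0 (k - 1); have h2 := sqr_ge0 (k + 1); apply/andP; split; nra.
have aM n : - (1 + 2 * w ^+ 2) <= as_ n <= 1 + 2 * w ^+ 2.
  by apply: M1; have := abhi n; have := sqr_ge0 (bs n); lra.
have bM n : - (1 + 2 * w ^+ 2) <= bs n <= 1 + 2 * w ^+ 2.
  by apply: M1; have := abhi n; have := sqr_ge0 (as_ n); lra.
have [a _ ca] := ultra_lim aM; have [b _ cb] := ultra_lim bM.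
have [z z01 cz] := @ultra_lim _ _ F UF zs 0 1 (fun n => let: And5 _ (conj h _) _ _ _ := hP n in h).
have [c c01 cc] := @ultra_lim _ _ F UF cs 0 1 (fun n => let: And5 _ _ _ _ (conj h _) := hP n in h).
have uq (g : nat -> R) (l l' : R) : g n @[n --> F] --> l -> g n @[n --> F] --> l' -> l = l'.
  by move=> h1 h2; exact: cvg_unique h1 h2.
have bd1 (r : R) : `|r| <= 1 -> -1 <= r <= 1 by rewrite ler_norml.
(* Pointwise limits of the equi-Lipschitz sequences along the ultrafilter. *)
have LIM (fs : nat -> R -> R) : (forall n t, `|fs n t| <= 1) -> (forall n, uan (fs n) B') ->
    (forall n t, fs n (t + 1) = fs n t) ->
    exists f : R -> R, [/\ forall t, fs n t @[n --> F] --> f t, forall t, `|f t| <= 1, bm f,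
      forall t, f (t + 1) = f t & forall t, A (fs n) t @[n --> F] --> A f t].
  move=> f1 fuan fp.
  have lip n t h : `|fs n (t + h) - fs n t| <= L * `|h| by exact: uan_lip.
  have exf t : exists l : R, fs n t @[n --> F] --> l.
    have [l _ hl] := @ultra_lim _ _ F UF (fun n => fs n t) (-1) 1 (fun n => bd1 _ (f1 n t)).
    by exists l.
  have [f hf] := choice exf.
  have nrm (k : R) (g : nat -> R) (l : R) : g n @[n --> F] --> l -> (forall n, `|g n| <= k) -> `|l| <= k.
    move=> gl gk; have c1 : `|g n| @[n --> F] --> `|l|.
      by apply: (@cvg_comp _ _ _ g (fun z => `|z|)); [exact: gl|exact: norm_continuous].
    by apply: (ler_cvg_to c1 (cvg_cst k)); near=> n.
  have ff1 t : `|f t| <= 1 by apply: (nrm 1 _ _ (hf t)) => n.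
  have flip t h : `|f (t + h) - f t| <= L * `|h|.
    by apply: (nrm _ (fun n => fs n (t + h) - fs n t)) => [|n]; [apply: cvgB; exact: hf|exact: lip].
  have cf : continuous f := lip_continuous flip.
  have bf : bm f by apply: bm_cont => //; exists 1.
  exists f; split=> // t.
    by apply: (uq _ _ _ (hf (t + 1))); under eq_fun do rewrite fp; exact: hf.
  have [_ [K hK]] := bm_kr cv.
  have K0 : 0 <= K by exact: le_trans (normr_ge0 _) (hK (0, 0)).
  apply/cvgrPdist_le => e e0.
  pose e1 := e / (1 + K).
  have e10 : 0 < e1 by rewrite divr_gt0 //; clear - wE w0 cv K0; lra.
  (* Arzela-Ascoli along the ultrafilter: if closeness failed, points where it fails would converge
     to some [s], and by the common Lipschitz constant the values there would converge to [f s]. *)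
  have unif : \forall n \near F, forall s, 0 <= s <= 1 -> `|f s - fs n s| <= e1.
    have [//|nF] := in_ultra_setVsetC [set n | forall s, 0 <= s <= 1 -> `|f s - fs n s| <= e1] UF.
    exfalso.
    have exs n : exists s, 0 <= s <= 1 /\ ((~ forall s, 0 <= s <= 1 -> `|f s - fs n s| <= e1) -> e1 < `|f s - fs n s|).
      have [h|h] := pselect (forall s, 0 <= s <= 1 -> `|f s - fs n s| <= e1).
        by exists 0; split; [rewrite lexx ler01|].
      have [s hs] : exists s, ~ (0 <= s <= 1 -> `|f s - fs n s| <= e1) by exact/existsNP.
      have [s01 hs'] : 0 <= s <= 1 /\ ~ (`|f s - fs n s| <= e1) by exact/not_implyP.
      by exists s; split=> // _; rewrite ltNge; apply/negP.
    have [ss hss] := choice exs.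
    have [s s01 cs'] := @ultra_lim _ _ F UF ss 0 1 (fun n => (hss n).1).
    have [l _ hl] := @ultra_lim _ _ F UF (fun n => fs n (ss n)) (-1) 1 (fun n => bd1 _ (f1 n (ss n))).
    have le := ultra_diagonal PF lip (hf s) cs' hl.
    have d0 : `|f (ss n) - fs n (ss n)| @[n --> F] --> `|f s - l|.
      apply: (@cvg_comp _ _ _ (fun n => f (ss n) - fs n (ss n)) (fun z => `|z|)); last exact: norm_continuous.
      apply: cvgB => //.
      by apply: (@cvg_comp _ _ _ ss f); [exact: cs'|exact: cf].
    rewrite le subrr normr0 in d0.
    have : e1 <= 0.
      apply: (ler_cvg_to (cvg_cst e1) d0).
      by apply: filterS nF => n hn; apply: ltW; apply: (hss n).2.
    clear - wE w0 cv e10; lra.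
  near=> n.
  have hn : forall s, 0 <= s <= 1 -> `|f s - fs n s| <= e1 by near: n.
  have bk g : bm g -> bm (fun s => kr x y t s * g s).
    by move=> bg; apply: bmM => //; exact: bm_kr1 cv t.
  have bfn : bm (fs n) by exact: uan_bm (fuan n).
  rewrite /dlpA -int01B; [|exact: bk|exact: bk].
  apply: (@le_trans _ _ (K * e1)); last first.
    by rewrite /e1 mulrCA ger_pMr // ler_pdivrMr; clear - wE w0 cv K0; lra.
  apply: int01_bnd => [|s s01]; first by apply: bmB; exact: bk.
  by rewrite -mulrBr normrM ler_pM // ?(hK (t, s)) // hn.
have up n t : us n (t + 1) = us n t by have [_ _ /(_ t)[-> _] _ _] := hP n.
have vp n t : vs n (t + 1) = vs n t by have [_ _ /(_ t)[_ ->] _ _] := hP n.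
have [u [cu uu1 bu pu cAu]] := LIM us u1 uuan up.
have [v [cv' vv1 bv pv cAv]] := LIM vs v1 vuan vp.
have ab : a ^+ 2 + b ^+ 2 = w ^+ 2.
  have c1 : as_ n ^+ 2 + bs n ^+ 2 - w ^+ 2 @[n --> F] --> a ^+ 2 + b ^+ 2 - w ^+ 2.
    apply: cvgB; last exact: cvg_cst.
    apply: cvgD.
      by apply: (@cvg_comp _ _ _ as_ (fun z => z ^+ 2)); [exact: ca|exact: exprn_continuous].
    by apply: (@cvg_comp _ _ _ bs (fun z => z ^+ 2)); [exact: cb|exact: exprn_continuous].
  have c2 : `|as_ n ^+ 2 + bs n ^+ 2 - w ^+ 2| @[n --> F] --> `|a ^+ 2 + b ^+ 2 - w ^+ 2|.
    by apply: (@cvg_comp _ _ _ (fun n => as_ n ^+ 2 + bs n ^+ 2 - w ^+ 2) (fun z => `|z|)); [exact: c1|exact: norm_continuous].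
  have c3 : eps n @[n --> \oo] --> w ^+ 2 / 2 * 0 by apply: cvgM; [exact: cvg_cst|exact: cvg_harmonic].
  have c4 : eps n @[n --> F] --> w ^+ 2 / 2 * 0.
    by move=> S /c3 h; exact: hF h.
  have : `|a ^+ 2 + b ^+ 2 - w ^+ 2| <= w ^+ 2 / 2 * 0.
    by apply: (ler_cvg_to c2 c4); near=> n; have [[_ /ltW]] := hP n.
  by rewrite mulr0 normr_le0 subr_eq0 => /eqP.
have Au t : A u t = a * u t - b * v t.
  apply: (uq _ _ _ (cAu t)).
  have E n : A (us n) t = as_ n * us n t - bs n * vs n t by have [[[_ _ -> _] _] _ _ _ _] := hP n.
  under eq_fun do rewrite E.
  by apply: cvgB; apply: cvgM => //.
have Av t : A v t = b * u t + a * v t.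
  apply: (uq _ _ _ (cAv t)).
  have E n : A (vs n) t = bs n * us n t + as_ n * vs n t by have [[[_ _ _ ->] _] _ _ _ _] := hP n.
  under eq_fun do rewrite E.
  by apply: cvgD; apply: cvgM => //.
have [uu uv] : uan u B' /\ uan v B'.
  by apply: (hB' u v a b) => //; rewrite ab; clear - wE w0 cv w2; lra.
have diag (fs : nat -> R -> R) (f : R -> R) (ts : nat -> R) t : (forall n, uan (fs n) B') -> (forall n t, `|fs n t| <= 1) ->
    (forall t, fs n t @[n --> F] --> f t) -> ts n @[n --> F] --> t -> fs n (ts n) @[n --> F] --> f t.
  move=> fuan f1 cf ct.
  have [l _ hl] := @ultra_lim _ _ F UF (fun n => fs n (ts n)) (-1) 1 (fun n => bd1 _ (f1 n (ts n))).
  by rewrite -(ultra_diagonal PF (fun n t h => uan_lip t h (fuan n)) (cf t) ct hl).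
have uz : u z = 0.
  apply: (uq _ _ _ (diag us u zs z uuan u1 cu cz)).
  have E n : us n (zs n) = 0 by have [_ [_ [-> _]] _ _ _] := hP n.
  under eq_fun do rewrite E; exact: cvg_cst.
have vz : v z = 0.
  apply: (uq _ _ _ (diag vs v zs z vuan v1 cv' cz)).
  have E n : vs n (zs n) = 0 by have [_ [_ [_ ->]] _ _ _] := hP n.
  under eq_fun do rewrite E; exact: cvg_cst.
have uvc : u c ^+ 2 + v c ^+ 2 = 1.
  have h : us n (cs n) ^+ 2 + vs n (cs n) ^+ 2 @[n --> F] --> u c ^+ 2 + v c ^+ 2.
    apply: cvgD.
      by apply: (@cvg_comp _ _ _ (fun n => us n (cs n)) (fun z => z ^+ 2)); [exact: diag uuan u1 cu cc|exact: exprn_continuous].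
    by apply: (@cvg_comp _ _ _ (fun n => vs n (cs n)) (fun z => z ^+ 2)); [exact: diag vuan v1 cv' cc|exact: exprn_continuous].
  apply: (uq _ _ _ h).
  have E n : us n (cs n) ^+ 2 + vs n (cs n) ^+ 2 = 1 by have [_ _ _ _ [_ ->]] := hP n.
  under eq_fun do rewrite E; exact: cvg_cst.
have [e1 e2] := complex_rigidity cv wE uu pu uv pv Au Av ab w0 c z.
by move: uvc; rewrite e1 e2 uz vz expr0n addr0 => /esym/eqP; rewrite oner_eq0.
Unshelve. all: by end_near.
Qed.

End SpectralGap.

(** * Change of parametrization *)

Section Primitive.
Context {R : realType}.
Local Notation mu := (@lebesgue_measure R).
Implicit Types (g F : R -> R).

Lemma derive0_between F (a b : R) : (forall z : R, a <= z <= b -> is_derive z (1 : R) F 0) -> a <= b -> F a = F b.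
Proof.
move=> dF; rewrite le_eqVlt => /predU1P[->//|ab].
have cF : {within `[a, b], continuous F}.
  by apply: derivable_within_continuous => z; rewrite in_itv /= => /dF; case.
have [c _] := @MVT _ F (fun=> 0) a b ab (fun z zab => dF z (subset_itv_oo_cc zab)) cF.
by rewrite mul0r => /eqP; rewrite subr_eq0 => /eqP.
Qed.

Lemma primitive_ex g : continuous g -> bm g -> exists G, forall z, is_derive z (1 : R) G (g z).
Proof.
move=> cg [mg [M hM]].
pose F (N z : R) := (\int[mu]_(t in `[- N, z]) g t)%R.
have dF (N z : R) : - N < z -> is_derive z (1 : R) (F N) (g z).
  move=> Nz; have zu : z < z + 1 by rewrite ltrDl.
  have ig : mu.-integrable `[- N, z + 1]%classic (EFin \o g).
    apply: measurable_bounded_integrable => //=.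
    - by rewrite lebesgue_measure_itv /= lte_fin; case: ifP => _; rewrite ?ltry // -EFinB ltry.
    - exact: measurable_funTS.
    - exists M; split; rewrite ?num_real // => x xM y _.
      by apply: le_trans (hM y) _; exact: ltW.
  have [d1 d2] := continuous_FTC1_closed zu ig Nz (cg z).
  by apply: DeriveDef; [exact: d1|rewrite -[RHS]d2 derive1E].
have indep (N N' z : R) : 0 < N -> 0 < N' -> - N < z -> - N' < z -> F N z - F N 0 = F N' z - F N' 0.
  move=> N0 N0' Nz Nz'.
  have dD (v : R) : - N < v -> - N' < v -> is_derive v (1 : R) (fun v => F N v - F N' v) 0.
    by move=> h1 h2; have := is_deriveB (dF N v h1) (dF N' v h2); rewrite subrr.
  have : F N z - F N' z = F N 0 - F N' 0.
    have [z0|z0] := lerP z 0.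
      by apply: (@derive0_between (fun v => F N v - F N' v)) => // v /andP[h1 h2]; apply: dD; lra.
    by symmetry; apply: (@derive0_between (fun v => F N v - F N' v)) => [v /andP[h1 h2]|]; [apply: dD; lra|exact: ltW].
  lra.
exists (fun z => F (`|z| + 1) z - F (`|z| + 1) 0) => z.
have a0 := normr_ge0 z; have a1 := ler_norm (- z); rewrite normrN in a1.
have d1 : is_derive z (1 : R) (fun v => F (`|z| + 2) v - F (`|z| + 2) 0) (g z).
  have h := is_deriveB (dF (`|z| + 2) z _) (is_derive_cst (F (`|z| + 2) 0) z 1).
  by rewrite subr0 in h; apply: h; lra.
apply: near_eq_is_derive d1; near=> v.
have vz : `|v - z| < 1 by rewrite distrC; near: v; apply: (nbhsx_ballx z 1 ltr01).
have b0 := normr_ge0 v; have b1 := ler_norm (- v); rewrite normrN in b1.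
by apply: indep; move: vz; rewrite ltr_norml => /andP[h1 h2]; lra.
Unshelve. all: by end_near.
Qed.

Lemma periodic_primitive g : continuous g -> bm g -> (forall t, g (t + 1) = g t) ->
  exists2 G, forall z, is_derive z (1 : R) G (g z - int01 g) & forall z, G (z + 1) = G z.
Proof.
move=> cg bg pg; have [G dG] := primitive_ex cg bg.
set c := int01 g.
have dl z : is_derive z (1 : R) (fun v => c * v) c.
  by apply: is_derive_eq; rewrite /GRing.scale /=; ring.
exists (fun z => G z - c * z) => [z|z]; first exact: (is_deriveB (dG z) (dl z)).
have cE : c = G 1 - G 0 := FTC01 dG cg.
pose K z := G (z + 1) - G z.
have dK v : is_derive v (1 : R) K 0.
  have ds : is_derive v (1 : R) (fun v => v + 1) 1.
    by apply: is_derive_eq; rewrite addr0.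
  have := is_deriveB (@is_derive1_comp _ G (fun v => v + 1) v _ _ (dG (v + 1)) ds) (dG v).
  by rewrite pg mulr1 subrr.
have := derive0_cst dK z 0; rewrite /K add0r -cE => h.
have -> : G (z + 1) = c + G z by rewrite -h; ring.
ring.
Qed.

End Primitive.

(** * Comparing two parametrizations through a map given by choice *)

Section Reparametrization.
Context {R : realType}.
Variables (x y X Y : R -> R) (B m B0 m0 : R) (U : R -> R).
Hypotheses (cv : curve x y B m) (cv0 : curve X Y B0 m0).
Hypotheses (UX : forall s, X s = x (U s)) (UY : forall s, Y s = y (U s)).
Implicit Types (s t z h : R) (f g : R -> R) (n : nat).

Let ux : uan x B := cv_x cv.
Let uy : uan y B := cv_y cv.
Let uX : uan X B0 := cv_x cv0.
Let uY : uan Y B0 := cv_y cv0.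

(* The derivative of [U], which itself is only defined modulo the period. *)
Definition lift_speed s : R :=
  (derive1 X s * derive1 x (U s) + derive1 Y s * derive1 y (U s)) / (derive1 x (U s) ^+ 2 + derive1 y (U s) ^+ 2).

(** Shifting [U s] by an integer to within [1 / 2] of [U s0] yields [z], and periodic functions do
    not see the shift. The chord-arc bound makes [z] Lipschitz at [s0]; Taylor expansions of both
    curves then give its derivative. *)
Lemma local_lift s0 : exists2 z : R -> R,
  forall f s, (forall t, f (t + 1) = f t) -> f (z s) = f (U s) :> R &
  z s0 = U s0 /\ is_derive s0 (1 : R) z (lift_speed s0).
Proof.
have [_ _ px py m_gt0 far] := cv; have [B1 _] := ux; have [B01 _] := uX.
pose n s := Num.floor (U s - U s0 + 2^-1).
pose z s := U s - (n s)%:~R.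
have zP s : `|z s - U s0| <= 2^-1.
  have h1 := floor_le (U s - U s0 + 2^-1); have h2 := floorD1_gt (U s - U s0 + 2^-1).
  rewrite -/(n s) in h1 h2; rewrite intrD in h2.
  by rewrite /z ler_norml; lra.
have per f s : (forall t, f (t + 1) = f t) -> f (z s) = f (U s) :> R.
  by move=> pf; rewrite -[in RHS](subrK (n s)%:~R (U s)) periodic_int.
have z0 : z s0 = U s0.
  rewrite /z (_ : n s0 = 0) ?subr0 // /n subrr add0r.
  have h1 := floor_le (2^-1 : R); have h2 := floorD1_gt (2^-1 : R); rewrite intrD in h2.
  apply/eqP; rewrite eq_le -ltzD1 -[X in _ && X]ltzD1 -!(ltr_int R) intrD; apply/andP; split; lra.
pose K := 24 * B0 ^+ 2.
have K0 : 0 <= K by rewrite mulr_ge0 ?sqr_ge0.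
pose C := K * (1 + m^-1).
have im : 0 < m^-1 by rewrite invr_gt0.
have C0 : 0 <= C by rewrite mulr_ge0 //; lra.
have lip h : `|z (s0 + h) - U s0| <= C * `|h|.
  have D := far (U s0) (z (s0 + h) - U s0) (zP (s0 + h)).
  rewrite (_ : U s0 + (z (s0 + h) - U s0) = z (s0 + h)) in D; last by ring.
  rewrite (per x) // (per y) // -!UX -!UY in D.
  have l1 := norm_sqr_le (uan_lip s0 h uX); have l2 := norm_sqr_le (uan_lip s0 h uY).
  have Kh : (X (s0 + h) - X s0) ^+ 2 + (Y (s0 + h) - Y s0) ^+ 2 <= (K * `|h|) ^+ 2.
    have -> : (K * `|h|) ^+ 2 = 4 * (12 * B0 ^+ 2 * `|h|) ^+ 2 by rewrite /K; ring.
    have := sqr_ge0 (12 * B0 ^+ 2 * `|h|); lra.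
  set d := z (s0 + h) - U s0 in D *.
  have E : m * d ^+ 2 <= m * (C * `|h|) ^+ 2.
    apply: le_trans D _; apply: le_trans Kh _.
    have -> : m * (C * `|h|) ^+ 2 = (K * `|h|) ^+ 2 * (m * (1 + m^-1) ^+ 2) by rewrite /C; ring.
    apply: ler_peMr; first exact: sqr_ge0.
    have -> : m * (1 + m^-1) ^+ 2 = m + 2 + m^-1 by field; rewrite gt_eqF.
    lra.
  rewrite ler_pM2l // in E.
  have a2 : `|d| ^+ 2 = d ^+ 2 by rewrite real_normK ?num_real.
  have c0 : 0 <= C * `|h| by rewrite mulr_ge0.
  have a0 := normr_ge0 d.
  by rewrite leNgt; apply/negP => lt; move: E; rewrite -a2; nra.
exists z; first exact: per.
split=> //.
set u0 := U s0 in z0 *.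
set S := derive1 x u0 ^+ 2 + derive1 y u0 ^+ 2.
have S0 : m <= S := curve_speed u0 cv.
pose Q := 10 * B0 ^+ 3 + 10 * B ^+ 3 * C ^+ 2.
have Q0 : 0 <= Q by rewrite addr_ge0 // !mulr_ge0 ?sqr_ge0 ?exprn_ge0 //; clear - ux uy uX uY UX UY B1 B01 C0 K0 im; lra.
apply: (@quad_derive _ z s0 _ (2 * Q * B ^+ 2 / m) 1 ltr01) => h _.
rewrite z0; set d := z (s0 + h) - u0.
have key (k k' : R -> R) : uan k B -> uan k' B0 -> (forall t, k (t + 1) = k t) -> (forall s, k' s = k (U s)) ->
    `|h * derive1 k' s0 - d * derive1 k u0| <= Q * h ^+ 2.
  move=> uk uk' pk kU.
  have t1 := uan_taylor s0 h uk'; have t2 := uan_taylor u0 d uk.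
  rewrite (_ : u0 + d = z (s0 + h)) in t2; last by rewrite /d; ring.
  rewrite (per k) // -kU -[k u0]kU in t2.
  have dh : d ^+ 2 <= C ^+ 2 * h ^+ 2.
    by have := norm_sqr_le (lip h); rewrite exprMn real_normK ?num_real.
  have B3 : 0 <= 10 * B ^+ 3 by rewrite mulr_ge0 // exprn_ge0 //; clear - ux uy uX uY UX UY B1; lra.
  have t3 : `|k' (s0 + h) - k' s0 - d * derive1 k u0| <= 10 * B ^+ 3 * C ^+ 2 * h ^+ 2.
    apply: le_trans t2 _.
    have -> : 10 * B ^+ 3 * C ^+ 2 * h ^+ 2 = 10 * B ^+ 3 * (C ^+ 2 * h ^+ 2) by ring.
    exact: ler_wpM2l.
  have -> : h * derive1 k' s0 - d * derive1 k u0 =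
    (k' (s0 + h) - k' s0 - d * derive1 k u0) - (k' (s0 + h) - k' s0 - h * derive1 k' s0) by ring.
  apply: le_trans (ler_normB _ _) _; rewrite /Q; clear - ux uy uX uY UX UY t1 t3; lra.
have kx := key x X ux uX px UX; have ky := key y Y uy uY py UY.
have bx := uan_dbnd u0 ux; have by_ := uan_dbnd u0 uy.
have Sp : 0 < S := lt_le_trans m_gt0 S0.
have -> : d - lift_speed s0 * h = - ((h * derive1 X s0 - d * derive1 x u0) * derive1 x u0 +
    (h * derive1 Y s0 - d * derive1 y u0) * derive1 y u0) / S.
  have alg (p q a b k : R) : p ^+ 2 + q ^+ 2 != 0 ->
      k - (a * p + b * q) / (p ^+ 2 + q ^+ 2) * h = - ((h * a - k * p) * p + (h * b - k * q) * q) / (p ^+ 2 + q ^+ 2).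
    by move=> n0; field.
  by apply: alg; rewrite gt_eqF.
rewrite normrM normrN normfV (gtr0_norm Sp).
have -> : 2 * Q * B ^+ 2 / m * h ^+ 2 = (2 * (Q * h ^+ 2 * B ^+ 2)) / m by ring.
apply: ler_pM => //; first by rewrite invr_ge0 ltW.
  apply: le_trans (ler_normD _ _) _; rewrite !normrM.
  have := ler_pM (normr_ge0 _) (normr_ge0 _) kx bx; have := ler_pM (normr_ge0 _) (normr_ge0 _) ky by_; clear - ux uy uX uY UX UY; lra.
by rewrite lef_pV2 ?posrE.
Qed.

Lemma transfer_is_derive f l s : is_derive (U s) (1 : R) f l -> (forall t, f (t + 1) = f t) ->
  is_derive s (1 : R) (fun v => f (U v)) (l * lift_speed s).
Proof.
move=> df pf; have [z zU [zs dz]] := local_lift s.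
have -> : (fun v => f (U v)) = f \o z by apply: funext => v; rewrite /= zU.
by apply: is_derive1_comp => //; rewrite zs.
Qed.

Lemma transfer_continuous f : continuous f -> (forall t, f (t + 1) = f t) -> continuous (fun s => f (U s)).
Proof.
move=> cf pf s; have [z zU [zs dz]] := local_lift s.
have -> : (fun v => f (U v)) = f \o z by apply: funext => v; rewrite /= zU.
apply: continuous_comp; last exact: cf.
by apply: differentiable_continuous; apply/derivable1_diffP; case: dz.
Qed.

Lemma transfer_derive1 k k' b b0 s : uan k b -> uan k' b0 -> (forall t, k (t + 1) = k t) -> (forall s, k' s = k (U s)) ->
  derive1 k' s = derive1 k (U s) * lift_speed s.
Proof.
move=> uk uk' pk kU.
have d1 := transfer_is_derive (uan_derive (U s) uk) pk.
have -> : k' = (fun v => k (U v)) by apply: funext.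
by rewrite derive1E; case: d1.
Qed.

Lemma kden_lift t s : kden X Y t s = kden x y (U t) (U s).
Proof. by rewrite /kden !UX !UY. Qed.

Lemma knum_lift t s : knum X Y t s = knum x y (U t) (U s) * lift_speed s.
Proof.
rewrite /knum (transfer_derive1 s ux uX (cv_px cv) UX) (transfer_derive1 s uy uY (cv_py cv) UY) !UX !UY; ring.
Qed.

Lemma kr_lift t s : kr X Y t s = kr x y (U t) (U s) * lift_speed s.
Proof. by rewrite /kr knum_lift kden_lift; ring. Qed.

Lemma continuous_lift_speed : continuous lift_speed.
Proof.
have cx := transfer_continuous (uan_dcontinuous ux) (uan_dperiodic ux (cv_px cv)).
have cy := transfer_continuous (uan_dcontinuous uy) (uan_dperiodic uy (cv_py cv)).
have cX := uan_dcontinuous uX; have cY := uan_dcontinuous uY.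
move=> s; apply: cvgM.
  by apply: cvgD; apply: cvgM; [exact: cX|exact: cx|exact: cY|exact: cy].
apply: cvgV.
  by rewrite gt_eqF //; have := curve_speed (U s) cv; have := cv_m cv; lra.
apply: cvgD.
  by apply: (@cvg_comp _ _ _ (fun s => derive1 x (U s)) (fun z => z ^+ 2)); [exact: cx|exact: exprn_continuous].
by apply: (@cvg_comp _ _ _ (fun s => derive1 y (U s)) (fun z => z ^+ 2)); [exact: cy|exact: exprn_continuous].
Qed.

Lemma bm_lift_speed : bm lift_speed.
Proof.
have [_ [M hM]] := uan_dbm ux; have [_ [N hN]] := uan_dbm uy.
have [_ [M' hM']] := uan_dbm uX; have [_ [N' hN']] := uan_dbm uY.
apply: bm_cont; first exact: continuous_lift_speed.
exists ((M' * M + N' * N) * m^-1) => s.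
have S0 := curve_speed (U s) cv; have m_gt0 := cv_m cv.
have Sp : 0 < derive1 x (U s) ^+ 2 + derive1 y (U s) ^+ 2 by lra.
rewrite /lift_speed normrM normfV (gtr0_norm Sp).
apply: ler_pM => //; first by rewrite invr_ge0; lra.
  by apply: le_trans (ler_normD _ _) _; rewrite !normrM; apply: lerD; apply: ler_pM.
by rewrite lef_pV2 ?posrE //; lra.
Qed.

Lemma bm_lift f : continuous f -> bm f -> (forall t, f (t + 1) = f t) -> bm (fun s => f (U s)).
Proof.
move=> cf [_ [M hM]] pf; apply: bm_cont; first exact: transfer_continuous.
by exists M => s; exact: hM.
Qed.

(** The primitive of [g] minus its mean is periodic, so its composition with [U] is differentiable
    and takes equal values at the ends. Only the mean is left, multiplied by [int01 lift_speed], the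
    degree of [U]. *)
Lemma change_of_variables g : continuous g -> bm g -> (forall t, g (t + 1) = g t) ->
  int01 (fun s => g (U s) * lift_speed s) = int01 g * int01 lift_speed.
Proof.
move=> cg bg pg; have [G dG pG] := periodic_primitive cg bg pg.
set c := int01 g in dG *.
have cgl : continuous (fun s => (g (U s) - c) * lift_speed s).
  move=> s; apply: cvgM; last exact: continuous_lift_speed.
  by apply: cvgB; [exact: transfer_continuous|exact: cvg_cst].
have := FTC01 (fun s => transfer_is_derive (dG (U s)) pG) cgl.
have -> : G (U 1) = G (U 0).
  have D0 : kden x y (U 0) (U 1) = 0.
    by rewrite -kden_lift /kden -[1]add0r (cv_px cv0) (cv_py cv0) !subrr expr0n addr0.
  have [n ->] := kden_eq0 cv D0.
  by rewrite periodic_int.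
rewrite subrr => E.
have b1 := bm_lift cg bg pg; have b2 := bm_lift_speed.
apply/eqP; rewrite -subr_eq0 -int01Z // -int01B; [|exact: bmM|exact: bmZ].
by apply/eqP; rewrite -[RHS]E; apply: int01_eq => s _; ring.
Qed.

(** [change_of_variables] is for continuous integrands, while [kr] has a default value on the
    diagonal. The kernel is therefore damped, and the damping is removed in the limit. *)
Lemma dlpA_lift f t : continuous f -> bm f -> (forall t, f (t + 1) = f t) ->
  dlpA X Y (fun s => f (U s)) t = int01 lift_speed * dlpA x y f (U t).
Proof.
move=> cf bf pf.
have lim (x' y' : R -> R) (B' m' : R) (cv' : curve x' y' B' m') f' t' : bm f' ->
    int01 (fun s => damp x' y' n t' s * (kr x' y' t' s * f' s)) @[n --> \oo] --> dlpA x' y' f' t'.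
  move=> bf'; have bk : bm (fun s => kr x' y' t' s * f' s) by apply: bmM => //; exact: bm_kr1 cv' t'.
  have [_ [M hM]] := bk.
  apply: (@int01_dct _ _ _ M) => [n||n s _|s _] //.
  - by apply: bmM => //; exact: (bm_sect1 t' (bm_damp cv' n)).
  - rewrite normrM; apply: le_trans (hM s); exact: ler_piMl (normr_ge0 _) (damp_bnd _ _ _ _ _).
  have [D0|D0] := eqVneq (kden x' y' t' s) 0.
    by rewrite /kr D0 invr0 mulr0 mul0r; under eq_fun do rewrite mulr0; exact: cvg_cst.
  rewrite -[X in _ --> X]mul1r; apply: cvgM; [exact: damp_cvg|exact: cvg_cst].
have bfU := bm_lift cf bf pf.
have l1 := lim _ _ _ _ cv0 (fun s => f (U s)) t bfU.
have l2 := lim _ _ _ _ cv f (U t) bf.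
have l3 : int01 lift_speed * int01 (fun s => damp x y n (U t) s * (kr x y (U t) s * f s)) @[n --> \oo] -->
    int01 lift_speed * dlpA x y f (U t).
  by apply: cvgM; [exact: cvg_cst|exact: l2].
suff E n : int01 (fun s => damp X Y n t s * (kr X Y t s * f (U s))) =
    int01 lift_speed * int01 (fun s => damp x y n (U t) s * (kr x y (U t) s * f s)).
  apply: (cvg_unique (@Rhausdorff R) l1); apply: cvg_ext l3 => n; exact/esym/E.
pose g s := knum x y (U t) s / (kden x y (U t) s + n.+1%:R^-1) * f s.
have gE s : damp x y n (U t) s * (kr x y (U t) s * f s) = g s.
  rewrite /damp /kr /g.
  have [D0|D0] := eqVneq (kden x y (U t) s) 0.
    have [e1 e2] := (cZ_eq x y _ _).2 D0.
    by rewrite D0 mul0r mul0r /knum e1 e2 !subrr !mul0r subrr !mul0r.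
  have : 0 < kden x y (U t) s + n.+1%:R^-1 by apply: ltr_wpDl; [exact: kden_ge0|rewrite invr_gt0].
  by move: (kden x y (U t) s + _) => E E0; field; rewrite D0 gt_eqF.
have bg : bm g.
  have := bmM (bm_sect1 (U t) (bm_damp cv n)) (bmM (bm_kr1 cv (U t)) bf).
  by move=> h; exact: (bm_ext h gE).
have cg : continuous g.
  have cx := uan_continuous ux; have cy := uan_continuous uy.
  have cx' := uan_dcontinuous ux; have cy' := uan_dcontinuous uy.
  move=> s; apply: cvgM; last exact: cf.
  apply: cvgM.
    by apply: cvgB; (apply: cvgM; [apply: cvgB; [|exact: cvg_cst]|]); [exact: cx|exact: cy'|exact: cy|exact: cx'].
  apply: cvgV.
    by rewrite gt_eqF //; apply: ltr_wpDl; [exact: kden_ge0|rewrite invr_gt0].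
  by apply: cvgD; [exact: (continuous_kden cv)|exact: cvg_cst].
have pg s : g (s + 1) = g s.
  rewrite /g pf /knum /kden (cv_px cv) (cv_py cv).
  by rewrite (uan_dperiodic ux (cv_px cv)) (uan_dperiodic uy (cv_py cv)).
rewrite [RHS]mulrC [X in _ = X * _](int01_eq (g := g)) => [|s _]; last exact: gE.
rewrite -change_of_variables //; apply: int01_eq => s _.
by rewrite -gE kr_lift /damp kden_lift; ring.
Qed.

End Reparametrization.

(** * Zeros of eigenfunctions *)

Section Winding.
Context {R : realType}.
Implicit Types (s t z h : R).

Lemma pexp_shift_arg (f : R -> R) (c t : R) a M r : pexp f (t + c) a M r -> pexp (fun z => f (z + c)) t a M r.
Proof. by move=> [M0 c0 ha hf]; split=> // h N hh; rewrite addrAC; exact: hf. Qed.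

Lemma derive1_shift (f : R -> R) B c t : uan f B -> derive1 (fun z => f (z + c)) t = derive1 f (t + c).
Proof.
move=> [_ /(_ (t + c))[a ha]].
by rewrite (uan_coef1 ha) (uan_coef1 (pexp_shift_arg ha)).
Qed.

Lemma curve_shift (x y : R -> R) B m c : curve x y B m -> curve (fun z => x (z + c)) (fun z => y (z + c)) B m.
Proof.
case=> [[B1 ux] [_ uy]] px py m0 far; split=> //.
- by split=> // t; have [a ha] := ux (t + c); exists a; exact: pexp_shift_arg.
- by split=> // t; have [a ha] := uy (t + c); exists a; exact: pexp_shift_arg.
- by move=> t; rewrite addrAC.
- by move=> t; rewrite addrAC.
- by move=> t h hh; rewrite (addrAC t); exact: far.
Qed.

Lemma dlpA_one_lift (x y X Y : R -> R) B m B0 m0 (U : R -> R) t : curve x y B m -> curve X Y B0 m0 ->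
  (forall s, X s = x (U s)) -> (forall s, Y s = y (U s)) ->
  dlpA X Y (fun=> 1) t = int01 (lift_speed x y X Y U) * dlpA x y (fun=> 1) (U t).
Proof.
move=> cv cv0 UX UY; apply: (dlpA_lift cv cv0 UX UY t (f := fun=> 1)) => //.
- by move=> z; exact: cvg_cst.
- exact: bm_cst.
Qed.

(** A translation of the parameter moves a lowest point of the curve to 0. *)
Lemma curve_winding (x y : R -> R) B m : curve x y B m ->
  exists2 w, w ^+ 2 = pi ^+ 2 & forall t, dlpA x y (fun=> 1) t = w.
Proof.
move=> cv; have ux := cv_x cv; have uy := cv_y cv.
have [c _ hc] : exists2 c, c \in `[0, 1]%R & forall t, t \in `[0, 1]%R -> y c <= y t.
  by apply: EVT_min; [exact: ler01|apply: continuous_subspaceT; exact: uan_continuous uy].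
have ymin t : y c <= y t.
  rewrite -(subrK (Num.floor t)%:~R t) (periodic_int _ _ (cv_py cv)); apply: hc; rewrite in_itv /=.
  have h1 := floor_le t; have h2 := floorD1_gt t; rewrite intrD in h2; lra.
have cvc := curve_shift c cv.
have [|w w2 wE] := winding_sq cvc; first by move=> t; rewrite add0r.
exists w => // t; rewrite (winding_cst cv t (0 + c)) -(wE 0).
rewrite (dlpA_one_lift 0 cv cvc (U := fun z => z + c)) // (_ : int01 _ = 1) ?mul1r //.
rewrite -[RHS]int01_cst; apply: int01_eq => s _.
rewrite /lift_speed (derive1_shift c s ux) (derive1_shift c s uy) -!expr2 divff //.
by rewrite gt_eqF //; have := curve_speed (s + c) cv; have := cv_m cv; lra.
Qed.

(** The degree is the ratio of two winding integrals whose squares are both [pi ^+ 2]. *)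
Lemma lift_speed_int_sq (x y X Y : R -> R) B m B0 m0 (U : R -> R) : curve x y B m -> curve X Y B0 m0 ->
  (forall s, X s = x (U s)) -> (forall s, Y s = y (U s)) ->
  int01 (lift_speed x y X Y U) ^+ 2 = 1.
Proof.
move=> cv cv0 UX UY.
have [w w2 wE] := curve_winding cv; have [w' w2' wE'] := curve_winding cv0.
have := dlpA_one_lift 0 cv cv0 UX UY; rewrite wE wE' => h.
have p2 : pi ^+ 2 != 0 :> R by rewrite expf_neq0 // gt_eqF // pi_gt0.
by apply: (mulIf p2); rewrite mul1r -{1}w2 -w2' h exprMn.
Qed.

End Winding.

(** * From the double layer potential to eigenpairs *)

Section Interface.
Context {R : realType}.
Local Notation mu := (@lebesgue_measure R).
Implicit Types (s t z h : R).

Lemma param_curve (Omega : set (R * R)) gamma : analytic_boundary_param Omega gamma ->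
  exists B m, curve (fst \o gamma) (snd \o gamma) B m.
Proof.
case=> a1 a2 reg per inj _ _.
have p1 t : (fst \o gamma) (t + 1) = (fst \o gamma) t by rewrite /= per.
have p2 t : (snd \o gamma) (t + 1) = (snd \o gamma) t by rewrite /= per.
have [B1 u1] := uan_intro a1 p1; have [B2 u2] := uan_intro a2 p2.
have h1 : B1 <= Num.max B1 B2 by rewrite le_max lexx.
have h2 : B2 <= Num.max B1 B2 by rewrite le_max lexx orbT.
have [||m cm] := curve_far (uan_le u1 h1) (uan_le u2 h2) p1 p2; last by exists (Num.max B1 B2), m.
  move=> t; rewrite lt_neqAle addr_ge0 ?sqr_ge0 // andbT eq_sym paddr_eq0 ?sqr_ge0 // !sqrf_eq0.
  apply/negP => /andP[/eqP e1 /eqP e2]; have := reg t; rewrite /velocity e1 e2.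
  by move/eqP; apply.
move=> s t s01 t01 /= e1 e2; apply: inj; rewrite ?inE /= ?in_itv //=.
by case: (gamma s) (gamma t) e1 e2 => a b [c d] /= -> ->.
Qed.

Lemma derive_log_potential (p a v : R * R) : 0 < (a.1 - p.1) ^+ 2 + (a.2 - p.2) ^+ 2 ->
  'D_v (log_potential p) a =
  - pi^-1 * (((a.1 - p.1) * v.1 + (a.2 - p.2) * v.2) / ((a.1 - p.1) ^+ 2 + (a.2 - p.2) ^+ 2)).
Proof.
move=> D0.
pose q z := (a.1 - p.1 + z * v.1) ^+ 2 + (a.2 - p.2 + z * v.2) ^+ 2.
pose g z := log_potential p (z *: v + a).
have gE z : 0 < q z -> g z = - (2 * pi)^-1 * ln (q z).
  move=> q0; rewrite /g /log_potential /eucl.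
  have -> : (p - (z *: v + a)).1 ^+ 2 + (p - (z *: v + a)).2 ^+ 2 = q z by rewrite /q /= /GRing.scale /=; ring.
  have s0 : 0 < Num.sqrt (q z) by rewrite sqrtr_gt0.
  rewrite lnV ?posrE // -[in RHS](sqr_sqrtr (ltW q0)) expr2 lnM ?posrE //.
  have pi0 : (pi : R) != 0 by rewrite gt_eqF // pi_gt0.
  by move: (pi : R) pi0 => c c0; field; rewrite c0.
have q00 : q 0 = (a.1 - p.1) ^+ 2 + (a.2 - p.2) ^+ 2 by rewrite /q !mul0r !addr0.
have dq : is_derive (0 : R) (1 : R) q (2 * ((a.1 - p.1) * v.1 + (a.2 - p.2) * v.2)).
  by rewrite /q; apply: is_derive_eq; rewrite /GRing.scale /=; ring.
have cq : {for (0 : R), continuous q}.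
  by apply: differentiable_continuous; apply/derivable1_diffP; case: dq.
have l0 : is_derive (0 : R) (1 : R) (fun z => - (2 * pi)^-1 * ln (q z))
   (- (2 * pi)^-1 * ((q 0)^-1 * (2 * ((a.1 - p.1) * v.1 + (a.2 - p.2) * v.2)))).
  have q0' : 0 < q 0 by rewrite q00.
  exact: (is_deriveZ (- (2 * pi)^-1) (@is_derive1_comp _ (@ln R) q 0 _ _ (is_derive1_ln q0') dq)).
have dg : is_derive (0 : R) (1 : R) g (- (2 * pi)^-1 * ((q 0)^-1 * (2 * ((a.1 - p.1) * v.1 + (a.2 - p.2) * v.2)))).
  apply: near_eq_is_derive l0.
  have : \forall z \near (0 : R), 0 < q z by apply: (cvgr_gt _ cq); rewrite q00.
  by apply: filterS => z /gE ->.
have -> : 'D_v (log_potential p) a = 'D_1 g 0.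
  suff E : (fun z => z^-1 *: ((log_potential p \o shift a) (z *: v) - log_potential p a)) =
      (fun z => z^-1 *: ((g \o shift 0) (z *: (1 : R)) - g 0)) by rewrite /derive E.
  apply: funext => z /=.
  have -> : z *: (1 : R) + 0 = z by rewrite addr0 /GRing.scale /= mulr1.
  by rewrite /g scale0r add0r.
have [_ ->] := dg; rewrite q00.
have pi0 : (pi : R) != 0 by rewrite gt_eqF // pi_gt0.
move: ((a.1 - p.1) ^+ 2 + (a.2 - p.2) ^+ 2) D0 ((a.1 - p.1) * v.1 + (a.2 - p.2) * v.2) (pi : R) pi0 => D D0 N c c0.
by field; rewrite c0 gt_eqF.
Qed.

Lemma dlp_real_curve (gamma : R -> R * R) B m (f : R * R -> R) s :
  curve (fst \o gamma) (snd \o gamma) B m -> bm (fun t => f (gamma t)) ->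
  dlp_real gamma f (gamma s) = - pi^-1 * dlpA (fst \o gamma) (snd \o gamma) (fun t => f (gamma t)) s.
Proof.
move=> cv bf; set x := fst \o gamma; set y := snd \o gamma.
have bk : bm (fun t => kr x y s t * f (gamma t)) by apply: bmM => //; exact: bm_kr1 cv s.
rewrite /dlpA -int01Z // /dlp_real -/(int01 _).
have [p hp] := kden_eq0_01 cv s.
apply: (@int01_exceptl _ [:: p; 1]); first exact: bmZ.
move=> t t01; rewrite !inE negb_or => /andP[tp t1].
have D0 := hp t t01 tp t1.
have Dp : 0 < kden x y s t by rewrite lt_neqAle eq_sym D0 kden_ge0.
rewrite derive_log_potential //.
have S0 : 0 < derive1 x t ^+ 2 + derive1 y t ^+ 2 by have := curve_speed t cv; have := cv_m cv; rewrite -/x -/y; lra.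
have s0 : 0 < speed gamma t by rewrite /speed /eucl /velocity sqrtr_gt0.
rewrite /unit_normal /= /kr /knum.
have -> : ((gamma t).1 - (gamma s).1) ^+ 2 + ((gamma t).2 - (gamma s).2) ^+ 2 = kden x y s t by [].
rewrite -/x -/y -[(gamma t).1]/(x t) -[(gamma t).2]/(y t) -[(gamma s).1]/(x s) -[(gamma s).2]/(y s).
have pi0 : (pi : R) != 0 by rewrite gt_eqF // pi_gt0.
move: (speed gamma t) s0 (kden x y s t) Dp (pi : R) pi0 => sp s0 D Dp c c0.
by field; rewrite c0 !gt_eqF.
Qed.

Lemma ae_continuous_eq0 (h : R -> R) : continuous h -> bm h ->
  {ae mu, forall t, 0 <= t <= 1 -> h t = 0} -> forall t, 0 <= t <= 1 -> h t = 0.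
Proof.
move=> ch bh ae0 t t01; apply/eqP/negPn/negP => ht.
pose g z := h z * h z.
have bg : bm g by exact: bmM.
have cg : {for t, continuous g} by apply: cvgM; exact: ch.
have gt0 : 0 < g t by rewrite /g -expr2 exprn_even_gt0.
have g0 z : 0 <= z <= 1 -> 0 <= g z by rewrite /g -expr2 sqr_ge0.
have := int01_gt0 bg t01 g0 cg gt0.
suff -> : int01 g = 0 by rewrite ltxx.
apply: EFin_inj; rewrite -int01_E //.
rewrite (@ae_eq_integral _ _ _ mu `[0%R, 1%R]%classic (cst 0%E)) ?integral0 //.
  by apply/measurable_EFinP; case: bg => mg _; exact: measurable_funTS.
move: ae0; apply: filterS; first exact: (ae_filter_ringOfSetsType mu).
by move=> z hz /=; rewrite in_itv /= => z01; rewrite /g hz // mul0r.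
Qed.

Lemma uniq_bounded_finite (T : choiceType) (A : set T) (K : R) :
  (forall l : seq T, uniq l -> (forall p, p \in l -> A p) -> (size l)%:R <= K) ->
  finite_set A /\ (#|` fset_set A|)%fset%:R <= K.
Proof.
move=> h.
have fA : finite_set A.
  apply: contrapT => /(infinite_set_fset (Num.truncn K).+1) [S SA cS].
  have := h (enum_fset S) (fset_uniq S) (fun p pS => SA p pS).
  rewrite leNgt => /negP; apply; apply: lt_le_trans (truncnS_gt K) _.
  by rewrite ler_nat.
split=> //; apply: (h (enum_fset (fset_set A))); first exact: fset_uniq.
by move=> p pA; have : p \in fset_set A by []; rewrite in_fset_set // inE.
Qed.

(** Both sides of the eigenvalue equation are continuous in the parameter, so equality almost
    everywhere is equality everywhere. For [dlpA] the eigenvalue becomes [- pi * lambda]. *)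
Lemma eigen_eq_eigenpair (Omega : set (R * R)) gamma (lambda : R[i]) (e : R * R -> R[i]) :
  analytic_boundary_param Omega gamma -> analytic_on_boundary gamma e -> dlp_eigen_eq gamma lambda e ->
  let u t := complex.Re (e (gamma t)) in let v t := complex.Im (e (gamma t)) in
  [/\ eigenpair (fst \o gamma) (snd \o gamma) u v (- pi * complex.Re lambda) (- pi * complex.Im lambda),
    continuous u /\ continuous v & forall t, u (t + 1) = u t /\ v (t + 1) = v t].
Proof.
move=> pg [au av] eq u v.
have [B [m cv]] := param_curve pg.
have per := abp_periodic pg.
have pu t : u (t + 1) = u t by rewrite /u per.
have pv t : v (t + 1) = v t by rewrite /v per.
have [Bu uu] := uan_intro au pu; have [Bv uv] := uan_intro av pv.
have bu : bm u := uan_bm uu; have bv : bm v := uan_bm uv.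
have cu := uan_continuous uu; have cv' := uan_continuous uv.
set A := dlpA (fst \o gamma) (snd \o gamma).
have pi0 : (pi : R) != 0 by rewrite gt_eqF // pi_gt0.
have everywhere (h : R -> R) (a b : R) : bm h -> (forall t, h (t + 1) = h t) ->
    {ae mu, forall t, 0 <= t <= 1 -> - pi^-1 * A h t = a * u t + b * v t} ->
    forall t, A h t = - pi * a * u t + - pi * b * v t.
  move=> bh ph hae t.
  have [B' uA] := dlpA_uan cv bh.
  pose k z := - pi^-1 * A h z - (a * u z + b * v z).
  have bk : bm k by apply: bmB; [apply: bmZ; exact: uan_bm uA|apply: bmD; exact: bmZ].
  have ck : continuous k.
    have cA := uan_continuous uA.
    move=> z; apply: cvgB; first by apply: cvgM; [exact: cvg_cst|exact: cA].
    by apply: cvgD; apply: cvgM; [exact: cvg_cst|exact: cu|exact: cvg_cst|exact: cv'].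
  have k0 : {ae mu, forall t, 0 <= t <= 1 -> k t = 0}.
    move: hae; apply: filterS; first exact: (ae_filter_ringOfSetsType mu).
    by move=> z hz z01; rewrite /k hz // subrr.
  have := ae_continuous_eq0 ck bk k0 (t := t - (Num.floor t)%:~R).
  have pk z : k (z + 1) = k z by rewrite /k pu pv [A h _](dlpA_periodic cv).
  rewrite -(periodic_int _ (Num.floor t) pk) subrK => kt.
  have {}kt : k t = 0.
    by apply: kt; have h1 := floor_le t; have h2 := floorD1_gt t; rewrite intrD in h2; lra.
  have -> : A h t = - pi * (k t + (a * u t + b * v t)) by rewrite /k subrK mulrA mulrNN divff // mul1r.
  by rewrite kt; ring.
have dRe s : dlp gamma e (gamma s) = Complex (- pi^-1 * A u s) (- pi^-1 * A v s).
  by rewrite /dlp !(dlp_real_curve s cv).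
have hu t : A u t = - pi * complex.Re lambda * u t - - pi * complex.Im lambda * v t.
  rewrite (everywhere u (complex.Re lambda) (- complex.Im lambda)) //; first ring.
  move: eq; rewrite /dlp_eigen_eq /ae_boundary; apply: filterS; first exact: (ae_filter_ringOfSetsType mu).
  move=> z hz z01; have := congr1 (@complex.Re R) (hz z01); rewrite dRe ReM /= => ->.
  by rewrite /u /v; ring.
have hv t : A v t = - pi * complex.Im lambda * u t + - pi * complex.Re lambda * v t.
  rewrite (everywhere v (complex.Im lambda) (complex.Re lambda)) //.
  move: eq; rewrite /dlp_eigen_eq /ae_boundary; apply: filterS; first exact: (ae_filter_ringOfSetsType mu).
  move=> z hz z01; have := congr1 (@complex.Im R) (hz z01); rewrite dRe ImM /= => ->.
  by rewrite /u /v; ring.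
by split.
Qed.

(** The eigenvalue is multiplied by the degree and may change sign; the bound sees only its
    modulus. *)
Lemma eigenpair_lift (x y X Y : R -> R) B m B0 m0 (U : R -> R) (u v : R -> R) (a b : R) :
  curve x y B m -> curve X Y B0 m0 -> (forall s, X s = x (U s)) -> (forall s, Y s = y (U s)) ->
  continuous u -> continuous v -> (forall t, u (t + 1) = u t) -> (forall t, v (t + 1) = v t) ->
  eigenpair x y u v a b ->
  exists a' b', eigenpair X Y (fun s => u (U s)) (fun s => v (U s)) a' b' /\ a' ^+ 2 + b' ^+ 2 = a ^+ 2 + b ^+ 2.
Proof.
move=> cv cv0 UX UY cu cv' pu pv [bu bv Au Av].
have s2 := lift_speed_int_sq cv cv0 UX UY; set s := int01 _ in s2.
exists (s * a), (s * b); split; last by rewrite !exprMn s2; ring.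
split.
- exact: (bm_lift cv cv0 UX UY cu bu pu).
- exact: (bm_lift cv cv0 UX UY cv' bv pv).
- by move=> t; rewrite (dlpA_lift cv cv0 UX UY) // Au -/s; ring.
- by move=> t; rewrite (dlpA_lift cv cv0 UX UY) // Av -/s; ring.
Qed.

Lemma ln_ge_gap (r d : R) : 0 < r -> 0 < d -> d <= `|r ^+ 2 - 1| -> ln (1 + d) / 2 <= `|ln r|.
Proof.
move=> r0 d0 gap.
have r2 : 0 < r ^+ 2 by rewrite exprn_gt0.
have lr : ln (r ^+ 2) = 2 * ln r by rewrite expr2 lnM ?posrE //; ring.
have [h|h] := lerP 0 (r ^+ 2 - 1).
  rewrite ger0_norm // in gap.
  have : ln (1 + d) <= ln (r ^+ 2) by rewrite ler_ln ?posrE //; lra.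
  rewrite lr => q; apply: le_trans (ler_norm _); lra.
(* For [r < 1] the estimate rests on [(1 + d) * (1 - d) <= 1]. *)
rewrite ltr0_norm // in gap.
have : ln (1 + d) <= ln (r ^+ 2)^-1.
  rewrite ler_ln ?posrE ?invr_gt0 //; last by lra.
  rewrite -[leLHS]mulr1 -ler_pdivlMl; last by lra.
  rewrite -invfM -[leLHS]invr1 lef_pV2 ?posrE ?mulr_gt0 //; last by lra.
  have : 0 <= d ^+ 2 by exact: sqr_ge0.
  nra.
rewrite lnV ?posrE // lr => q; rewrite -normrN; apply: le_trans (ler_norm _); lra.
Qed.

End Interface.

(** * The count on one fixed parametrization *)

Section ZeroBound.
Context {R : realType}.
Variables (X Y : R -> R) (B m : R).
Hypothesis cv : curve X Y B m.

(** An empty list is trivial; a single zero already brings in the spectral gap, that is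
    [|ln r| >= eta]. The additive constant [ln K] of the count is then at most [|ln K| / eta] times
    [|ln r|], which absorbs it even near [r = 1]. *)
Lemma eigenpair_zero_count : exists2 C : R, 0 < C & forall (u v : R -> R) (a b r : R) (zs : seq R),
  eigenpair X Y u v a b -> 0 < r -> a ^+ 2 + b ^+ 2 = (pi * r) ^+ 2 ->
  (exists t, u t <> 0 \/ v t <> 0) -> uniq zs ->
  (forall z, z \in zs -> 0 <= z <= 1 /\ (u z = 0 /\ v z = 0)) -> (size zs)%:R <= C * `|ln r|.
Proof.
have [w w2 wE] := curve_winding cv.
have pi0 : 0 < (pi : R) := pi_gt0 R.
have w0 : w != 0 by rewrite -sqrf_eq0 w2 sqrf_eq0 gt_eqF.
have [d d0 hd] := spectral_gap cv wE w0.
have [M [c [M0 c0 hM]]] := eigenpair_pexp cv.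
have [C0 C00 hC0] := zero_count c0.
(* [K / r] is the argument of the logarithm in [zero_count], for the bound [(M + 1) / (pi * r)] and
   the value [2^-1]; the summand 1 makes [K] positive. *)
pose K : R := 8 * (M + 1) / pi.
have K0 : 0 < K by rewrite divr_gt0 // mulr_gt0 //; lra.
pose d1 := d / pi ^+ 2.
have d10 : 0 < d1 by rewrite divr_gt0 // exprn_gt0.
pose eta := ln (1 + d1) / 2.
have eta0 : 0 < eta by rewrite divr_gt0 // ln_gt0 //; lra.
exists (C0 * (`|ln K| / eta + 1)).
  by rewrite mulr_gt0 // ltr_wpDl // divr_ge0 // ltW.
move=> u v a b r zs ep r0 abr nz uz hz.
case: zs uz hz => [|z0 zs0]; first by rewrite mulr_ge0 // mulr_ge0 ?(ltW C00) // addr_ge0 // divr_ge0 // ltW.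
set zs := z0 :: zs0 => uz hz.
have ab0 : 0 < a ^+ 2 + b ^+ 2 by rewrite abr exprn_gt0 // mulr_gt0.
have hz0 : exists t, u t = 0 /\ v t = 0 by exists z0; case: (hz z0 (mem_head _ _)).
have gap : eta <= `|ln r|.
  apply: ln_ge_gap => //; have := hd u v a b ep ab0 hz0 nz.
  rewrite abr w2 exprMn (_ : pi ^+ 2 * r ^+ 2 - pi ^+ 2 = pi ^+ 2 * (r ^+ 2 - 1)); last by ring.
  by rewrite normrM ger0_norm ?sqr_ge0 // /d1 ler_pdivrMr ?exprn_gt0 // mulrC.
have [u' [v' [_ [s [ep' _ per le1 [s01 sE]]]]]] := eigenpair_normalize cv ep ab0 hz0 nz.
have u1 t : `|u' t| <= 1.
  rewrite -(@ler_sqr _ _ 1) ?nnegrE // real_normK ?num_real // expr1n.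
  by have := le1 t; have := sqr_ge0 (v' t); clear - cv; lra.
have v1 t : `|v' t| <= 1.
  rewrite -(@ler_sqr _ _ 1) ?nnegrE // real_normK ?num_real // expr1n.
  by have := le1 t; have := sqr_ge0 (u' t); clear - cv; lra.
have hp := hM u' v' a b 1 ep' ab0 u1 v1.
rewrite abr sqrtr_sqr ger0_norm ?mulr1 in hp; last by rewrite mulr_ge0 // ltW.
have zu z : z \in zs -> 0 <= z <= 1 /\ u' z = 0 by move=> /hz [z01 h]; have [_ /(_ h)[]] := per z.
have zv z : z \in zs -> 0 <= z <= 1 /\ v' z = 0 by move=> /hz [z01 h]; have [_ /(_ h)[]] := per z.
have half0 : 0 < 2^-1 :> R by rewrite invr_gt0.
have count : (size zs)%:R <= C0 * ln (K / r).
  have le_M : M / (pi * r) <= (M + 1) / (pi * r) by rewrite ler_pM2r ?invr_gt0 ?mulr_gt0 // lerDl.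
  have KE : K / r = 4 * ((M + 1) / (pi * r)) / 2^-1.
    by rewrite /K; move: (pi : R) pi0 => p p0; field; rewrite !gt_eqF.
  (* At [s] the squares of the two components sum to 1, so one of them is at least [1 / 2] in
     modulus; its zeros include all common zeros. *)
  have [hu|hu] := lerP 2^-1 `|u' s|.
    rewrite KE; apply: (hC0 u' _ 2^-1 s) => // t.
    by have [[p hpu] _] := hp t; exists p; exact: pexp_le hpu le_M (lexx c).
  have hv : 2^-1 <= `|v' s|.
    rewrite leNgt; apply/negP => hv.
    have q1 := norm_sqr_le (ltW hu); have q2 := norm_sqr_le (ltW hv).
    by clear - cv q1 q2 sE; lra.
  rewrite KE; apply: (hC0 v' _ 2^-1 s) => // t.
  by have [_ [p hpv]] := hp t; exists p; exact: pexp_le hpv le_M (lexx c).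
apply: le_trans count _; rewrite -mulrA ler_pM2l //.
rewrite lnM ?posrE ?invr_gt0 // lnV ?posrE // mulrDl mul1r.
have e1 := ler_norm (ln K); have e2 := ler_norm (- ln r); rewrite normrN in e2.
have e3 : `|ln K| <= `|ln K| / eta * `|ln r|.
  by rewrite mulrAC ler_pdivlMr // ler_wpM2l.
clear - cv e1 e2 e3; lra.
Qed.

End ZeroBound.

Theorem theorem3p10 (R : realType) (Omega : set (R * R)) :
  bounded_region Omega -> analytic_boundary Omega ->
  exists2 C : R, 0 < C &
    forall gamma : R -> R * R, analytic_boundary_param Omega gamma ->
    forall (lambda : R[i]) (e : R * R -> R[i]),
      dlp_eigenvalue gamma lambda -> lambda != 0 ->
      analytic_on_boundary gamma e ->
      dlp_eigen_eq gamma lambda e ->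
      (exists2 x, frontier Omega x & e x != 0) ->
      finite_set (boundary_zeros Omega e) /\
      (#|` fset_set (boundary_zeros Omega e)|)%fset%:R
        <= C * `|ln (Normc.normc lambda)|.
Proof.
move=> _ [gamma0 p0].
have [B0 [m0 cv0]] := param_curve p0.
(* [C] is fixed on [gamma0] before any other parametrization is introduced; eigenfunctions read on
   [gamma] are then pulled back to [gamma0]. *)
have [C C0 hC] := eigenpair_zero_count cv0.
exists C => // gamma pg lambda e _ l0 ea eq [x1 Fx1 ex1].
have [B [m cv]] := param_curve pg.
have [ep [cu cv'] per] := eigen_eq_eigenpair pg ea eq.
have lift s : exists z, gamma0 s = gamma z.
  have : range gamma0 (gamma0 s) by exists s.
  by rewrite (abp_image p0) -(abp_image pg) => -[z _ h]; exists z.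
have [U hU] := choice lift.
have UX s : (fst \o gamma0) s = (fst \o gamma) (U s) by rewrite /= hU.
have UY s : (snd \o gamma0) s = (snd \o gamma) (U s) by rewrite /= hU.
have [a [b [ep' ab]]] := eigenpair_lift cv cv0 UX UY cu cv' (fun t => (per t).1) (fun t => (per t).2) ep.
(* One parameter in [[0, 1[] for each boundary point: distinct zeros get distinct parameters, so the
   count for lists of parameters applies. *)
have param p : exists t, frontier Omega p -> 0 <= t < 1 /\ gamma0 t = p.
  have [Fp|nFp] := pselect (frontier Omega p); last by exists 0.
  have [t _ <-] : range gamma0 p by rewrite (abp_image p0).
  exists (t - (Num.floor t)%:~R) => _; split.
    by have h1 := floor_le t; have h2 := floorD1_gt t; rewrite intrD in h2; lra.
  have px := cv_px cv0; have py := cv_py cv0.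
  rewrite -[in RHS](subrK (Num.floor t)%:~R t).
  have := periodic_int (t - (Num.floor t)%:~R) (Num.floor t) px.
  have := periodic_int (t - (Num.floor t)%:~R) (Num.floor t) py.
  rewrite /=; case: (gamma0 _) => ? ?; case: (gamma0 _) => ? ? /= -> ->.
  by [].
have [tau htau] := choice param.
have r0 : 0 < Normc.normc lambda.
  rewrite lt_neqAle eq_sym; apply/andP; split; last by case: (lambda) => ? ?; exact: sqrtr_ge0.
  by apply: contra_neq l0 => /Normc.eq0_normc.
have abr : a ^+ 2 + b ^+ 2 = (pi * Normc.normc lambda) ^+ 2.
  rewrite ab [in RHS]exprMn [Normc.normc lambda ^+ 2](_ : _ = complex.Re lambda ^+ 2 + complex.Im lambda ^+ 2); first by ring.
  by case: (lambda) => r i /=; rewrite sqr_sqrtr // addr_ge0 ?sqr_ge0.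
have nz : exists t, complex.Re (e (gamma (U t))) <> 0 \/ complex.Im (e (gamma (U t))) <> 0.
  exists (tau x1); rewrite -hU (htau _ Fx1).2.
  apply: contrapT => /not_orP[/contrapT h1 /contrapT h2].
  by move/eqP: ex1; apply; apply: complex_eq.
apply: uniq_bounded_finite => l ul hl.
rewrite -(size_map tau l); apply: (hC _ _ _ _ _ _ ep' r0 abr nz).
  rewrite map_inj_in_uniq // => p q /hl[Fp _] /hl[Fq _] h.
  by rewrite -(htau _ Fp).2 -(htau _ Fq).2 h.
move=> z /mapP[p /hl[Fp ep0] ->]; have [t01 gt] := htau p Fp.
split; first by case/andP: t01 => -> /ltW ->.
by rewrite -hU gt ep0.
Qed.
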